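(* Let $\widetilde A\in\mathbb C^{n\times n}$ and an integer $r$ be such that there exist $A\in\mathbb C^{n\times n}$ with $\mathrm{rank}(A)=r$ and parameters $t,x,\beta>0$ such that $$\|\widetilde A-A\|\ \le\ \beta\ \le\ \frac15\cdot\frac{\sigma_r(A)}{\sigma_1(A)+2}\cdot\frac{x}{(2\sqrt2+t)\sqrt n}\ \le\ 1.$$ When run with machine precision $$\mathbf u\ \le\ \mathbf u_{\mathrm{DEFLATE}}(\beta,n)=\frac{\beta}{4\mu_{\mathrm{QR}}(n)+2\sqrt n\,c_N+2\mu_{\mathrm{MM}}(n)},$$ the output $\widetilde U=\mathrm{DEFLATE}(\widetilde A,r)$ satisfies the following with probability $1-2e^{-nt^2}-(r/2)x^2$ (i.e. at least this): there exists a semi-unitary $U\in\mathbb C^{n\times r}$ (orthonormal columns) such that $\mathrm{range}(U)=\mathrm{range}(A)$ and $$\|\widetilde U-U\|\ \le\ 6\cdot\frac{\sigma_1(A)+2}{\sigma_r(A)}\cdot\frac{(2\sqrt2+t)\sqrt n}{x}\cdot\beta.$$ Furthermore, the algorithm uses only $$T_{\mathrm{MM}}(n)+T_{\mathrm{QR}}(n)+T_N\cdot n^2$$ floating point operations.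
   Context: $\|\cdot\|$ is the operator norm and $\sigma_1(A)\ge\sigma_2(A)\ge\cdots$ are the singular values of $A$. **Floating point model.** $\mathbf u$ is machine precision: every $z\in\mathbb C$ has a floating point number $\mathrm{fl}(z)$ with $|\mathrm{fl}(z)-z|\le\mathbf u|z|$; for floating point $x,y$ and $\circ\in\{+,-,\times\}$, $|\mathrm{fl}(x\circ y)-x\circ y|\le\mathbf u|x\circ y|$. The input matrix $\widetilde A$ has floating point entries. **Black-box primitives.** - $\mathrm{MM}(A,B)$ multiplies $n\times n$ matrices using $T_{\mathrm{MM}}(n)$ floating point operations, with $\|\mathrm{MM}(A,B)-AB\|\le\mu_{\mathrm{MM}}(n)\mathbf u\|A\|\|B\|$; $\mu_{\mathrm{MM}}(n)\ge10$ is a low-degree polynomial in $n$. - $[Q,R]=\mathrm{QR}(A)$ computes a QR decomposition using $T_{\mathrm{QR}}(n)$ floating point operations such that for some matrix $A'$ and unitary $Q'$: $(Q')^*A'=R$ is upper triangular, $\|Q-Q'\|\le\mu_{\mathrm{QR}}(n)\mathbf u$, and $\|A-A'\|\le\mu_{\mathrm{QR}}(n)\mathbf u\|A\|$; $\mu_{\mathrm{QR}}(n)$ is a low-degree polynomial in $n$. - $\mathrm{Normal}()$ uses a constant number $T_N$ of operations; if $z$ is a complex Gaussian with $\mathrm{Re}(z),\mathrm{Im}(z)$ i.i.d. real Gaussians of mean $0$ and variance $1/2$, there is a coupling with $|\mathrm{Normal}()-z|\le|z|c_N\mathbf u$ with probability 1, for a constant $c_N$. **Algorithm DEFLATE$(\widetilde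 A,r)$.** Form $\widetilde G\in\mathbb C^{n\times n}$ with $\widetilde G_{ij}=\mathrm{Normal}()$ for all $i,j$ (independent samples); $M=\mathrm{MM}(\widetilde A,\widetilde G)$; $(Q,R)=\mathrm{QR}(M)$; return the first $r$ columns of $Q$. *)

(* Defs.v *)
From HB Require Import structures.
From mathcomp Require Import all_boot all_order all_algebra.
From mathcomp Require Import spectral.
From mathcomp Require Import complex.
From mathcomp Require Import all_classical all_reals all_analysis.

Set Implicit Arguments.
Unset Strict Implicit.
Unset Printing Implicit Defensive.

Import Order.TTheory GRing.Theory Num.Theory.
Import numFieldNormedType.Exports.

Local Open Scope classical_set_scope.
Local Open Scope complex_scope.
Local Open Scope sesquilinear_scope.
Local Open Scope ring_scope.

Section linear_algebra.
Variable R : realType.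

Definition cabs (z : R[i]) : R := Normc.normc z.

Definition l2norm m (v : 'cV[R[i]]_m) : R :=
  Num.sqrt (\sum_(i < m) cabs (v i 0) ^+ 2).

Definition opnorm m n (A : 'M[R[i]]_(m, n)) : R :=
  sup [set l2norm (A *m v) | v in [set v : 'cV[R[i]]_n | l2norm v <= 1]].

(* Square roots of the eigenvalues of A^* A, with multiplicity, in
   nonincreasing order; these eigenvalues are real and nonnegative, so taking
   real parts only changes the type. *)
Definition singular_values n (A : 'M[R[i]]_n) : seq R :=
  sort (fun a b => b <= a)
    [seq Num.sqrt (complex.Re (spectral_diag (A^t* *m A) 0 i)) | i : 'I_n].

(* sigma k A is the k-th singular value counted from 1; k = 0 is not
   meaningful. *)
Definition sigma (k : nat) n (A : 'M[R[i]]_n) : R :=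
  nth 0 (singular_values A) k.-1.

(* Column space: mathcomp's %MS operations are about row spaces. *)
Definition mxrange m n (A : 'M[R[i]]_(m, n)) : set 'cV[R[i]]_m :=
  range (fun v : 'cV[R[i]]_n => A *m v).

End linear_algebra.

Section probability.
Variable R : realType.

(* R[i] carries no sigma-algebra in the libraries; laws of complex random
   variables are measures on R * R. *)
Definition c2r (z : R[i]) : R * R := (complex.Re z, complex.Im z).
Definition r2c (p : R * R) : R[i] := p.1 +i* p.2.

(* normal_prob takes the standard deviation: Re and Im have variance 1/2. *)
Definition cgauss : set (measurableTypeR R * measurableTypeR R) -> \bar R :=
  (normal_prob 0 (Num.sqrt 2^-1) \x normal_prob 0 (Num.sqrt 2^-1))%E.

Definition is_coupling d1 d2 (T1 : measurableType d1) (T2 : measurableType d2)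
    (mu1 : set T1 -> \bar R) (mu2 : set T2 -> \bar R)
    (kappa : probability (T1 * T2)%type R) : Prop :=
  (forall B, measurable B -> kappa (fst @^-1` B) = mu1 B) /\
  (forall B, measurable B -> kappa (snd @^-1` B) = mu2 B).

Definition mutually_independent d (T : measurableType d) (P : probability T R)
    d' (S : measurableType d') (I : finType) (X : I -> T -> S) : Prop :=
  forall (J : {set I}) (B : I -> set S), (forall i, measurable (B i)) ->
    P [set w | forall i, i \in J -> B i (X i w)] =
    (\prod_(i in J) P (X i @^-1` B i))%E.

End probability.

(* The result of running a routine, with the number of floating point
   operations spent. *)
Record counted (X : Type) := Counted { value : X ; flops : nat }.

Definition cret X (a : X) : counted X := Counted a 0.

Definition cbind X Y (c : counted X) (f : X -> counted Y) : counted Y :=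
  Counted (value (f (value c))) (flops c + flops (f (value c))).

Notation "a <~ c ;; d" := (cbind c (fun a => d))
  (at level 100, c at next level, d at level 200, right associativity).

Definition cmatrix X m n (c : 'I_m -> 'I_n -> counted X) :
    counted 'M[X]_(m, n) :=
  Counted (\matrix_(i, j) value (c i j))
          (\sum_(i < m) \sum_(j < n) flops (c i j))%N.

Record fp_arith (R : realType) := FpArith {
  is_fp : pred R[i] ;
  mach_prec : R ;
  fl : R[i] -> {z : R[i] | is_fp z} ;
  fl_err : forall z, cabs (val (fl z) - z) <= mach_prec * cabs z ;
  fl_addP : forall x y : {z : R[i] | is_fp z},
    cabs (val (fl (val x + val y)) - (val x + val y))
      <= mach_prec * cabs (val x + val y) ;
  fl_subP : forall x y : {z : R[i] | is_fp z},
    cabs (val (fl (val x - val y)) - (val x - val y))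
      <= mach_prec * cabs (val x - val y) ;
  fl_mulP : forall x y : {z : R[i] | is_fp z},
    cabs (val (fl (val x * val y)) - (val x * val y))
      <= mach_prec * cabs (val x * val y) }.

Definition fp (R : realType) (F : fp_arith R) : Type :=
  {z : R[i] | is_fp F z}.

Definition fpval (R : realType) (F : fp_arith R) (x : fp F) : R[i] := val x.

Definition mxval (R : realType) (F : fp_arith R) m n (A : 'M[fp F]_(m, n)) :
    'M[R[i]]_(m, n) := map_mx (@fpval R F) A.

Record primitives (R : realType) (F : fp_arith R) := Primitives {
  MM : forall n, 'M[fp F]_n -> 'M[fp F]_n -> counted 'M[fp F]_n ;
  T_MM : nat -> nat ;
  mu_MM : {poly R} ;
  MM_flops : forall n (A B : 'M[fp F]_n), (flops (MM A B) <= T_MM n)%N ;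
  mu_MM_ge10 : forall n, (0 < n)%N -> 10 <= mu_MM.[n%:R] ;
  MM_err : forall n (A B : 'M[fp F]_n), (0 < n)%N ->
    opnorm (mxval (value (MM A B)) - mxval A *m mxval B)
      <= mu_MM.[n%:R] * mach_prec F * opnorm (mxval A) * opnorm (mxval B) ;

  QR : forall n, 'M[fp F]_n -> counted ('M[fp F]_n * 'M[fp F]_n) ;
  T_QR : nat -> nat ;
  mu_QR : {poly R} ;
  QR_flops : forall n (A : 'M[fp F]_n), (flops (QR A) <= T_QR n)%N ;
  (* is_trig_mx is lower triangularity, hence the transpose. *)
  QR_err : forall n (A : 'M[fp F]_n), (0 < n)%N ->
    exists A' Q' : 'M[R[i]]_n,
      [/\ Q' \is unitarymx,
          Q'^t* *m A' = mxval (value (QR A)).2,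
          is_trig_mx (mxval (value (QR A)).2)^T,
          opnorm (mxval (value (QR A)).1 - Q') <= mu_QR.[n%:R] * mach_prec F &
          opnorm (mxval A - A')
            <= mu_QR.[n%:R] * mach_prec F * opnorm (mxval A)] ;

  normal_law : probability (measurableTypeR R * measurableTypeR R)%type R ;
  T_N : nat ;
  c_N : R ;
  normal_coupling : exists2 kappa,
    is_coupling normal_law (@cgauss R) kappa &
    {ae kappa, forall p, cabs (r2c p.1 - r2c p.2)
                           <= cabs (r2c p.2) * c_N * mach_prec F} }.

(* call i j w is the (i, j)-th call to Normal() on the outcome w. *)
Record independent_normal_calls (R : realType) (F : fp_arith R)
    (pr : primitives F) d (Om : measurableType d) (P : probability Om R)
    m n (call : 'I_m -> 'I_n -> Om -> counted (fp F)) : Prop := {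
  call_flops : forall i j w, (flops (call i j w) <= T_N pr)%N ;
  call_meas : forall i j, measurable_fun setT
    (fun w => c2r (fpval (value (call i j w)))
              : measurableTypeR R * measurableTypeR R) ;
  call_law : forall i j (B : set (measurableTypeR R * measurableTypeR R)),
    measurable B ->
    P [set w | B (c2r (fpval (value (call i j w))))] = normal_law pr B ;
  call_indep : mutually_independent P
    (fun (ij : 'I_m * 'I_n) w =>
       c2r (fpval (value (call ij.1 ij.2 w)))
       : measurableTypeR R * measurableTypeR R) }.

Definition first_cols X n r (hrn : (r <= n)%N) (Q : 'M[X]_n) : 'M[X]_(n, r) :=
  colsub (widen_ord hrn) Q.

(* normal i j is the result of the call Normal() that fills entry (i, j). *)
Definition DEFLATE (R : realType) (F : fp_arith R) (pr : primitives F)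
    n r (hrn : (r <= n)%N) (At : 'M[fp F]_n)
    (normal : 'I_n -> 'I_n -> counted (fp F)) : counted 'M[fp F]_(n, r) :=
  Gt <~ cmatrix normal ;;
  M <~ MM pr At Gt ;;
  QR_M <~ QR pr M ;;
  cret (first_cols hrn QR_M.1).

Definition u_DEFLATE (R : realType) (F : fp_arith R) (pr : primitives F)
    (beta : R) (n : nat) : R :=
  beta / (4 * (mu_QR pr).[n%:R] + 2 * Num.sqrt n%:R * c_N pr
          + 2 * (mu_MM pr).[n%:R]).

(* Main.v *)
(* Put K = (2 sqrt 2 + t) sqrt n. If G is the exact Gaussian matrix to which the
   calls are coupled, then with the required probability |G| <= K, and the r x r
   Gaussian matrix W G_r, where the rows of W are the first r right singular
   vectors of A and G_r is formed by the first r columns of G, stretches every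
   vector by at least 2x/5. The coupling transfers both facts to the computed
   factor G~, at the price of sqrt n c_N u K.

   On that event the first r columns of the matrix factored by QR are close to
   A G~_r, which is bounded below by about (2x/5) sigma_r(A). Dividing by the
   triangular factor shows that the first r columns of Q are close to a matrix
   with range in range(A), and the isometric factor of its polar decomposition is
   the required U.

   The two tail bounds rest on the invariance of the Gaussian law under unitary
   maps, which comes from SU(2) invariance of Lebesgue measure. Both are obtained
   by testing against independent Gaussian vectors, so that no net argument and no
   density of singular values is needed. *)
Require Import Defs.
From HB Require Import structures.
From mathcomp Require Import all_boot all_order all_algebra.
From mathcomp Require Import spectral.
From mathcomp Require Import complex.
From mathcomp Require Import all_classical all_reals all_analysis.
From mathcomp Require Import measurable_realfun borel_hierarchy.
From mathcomp Require Import ring lra.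

Set Implicit Arguments.
Unset Strict Implicit.
Unset Printing Implicit Defensive.

Import Order.TTheory GRing.Theory Num.Theory.
Import numFieldNormedType.Exports.

Local Open Scope classical_set_scope.
Local Open Scope complex_scope.
Local Open Scope sesquilinear_scope.
Local Open Scope ring_scope.

(** The sample space of the calls need not carry any Gaussian variable, so probabilities are
    compared between laws on tuples of columns: independence identifies the law of the computed
    factor with a power of [normal_law], and a power of the coupling relates that to the Gaussian
    one. The failure event must therefore be a measurable set of matrices; it is expressed by
    inequalities between squared norms rather than by singular values.

    The number 2x/5 comes from the lower tail: the Gaussian test vector costs a factor e, rounded up
    to 3, and the second moment of a standard complex Gaussian is bounded by 100/99 only, which
    gives 3 (100/99) r (2x/5)^2 = (16/33) r x^2, below (r/2) x^2.

    In the unit K beta (sigma_1 + 2) / (x sigma_r), which the hypothesis on beta keeps at most 1/5,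
    the constant 6 is the sum of a small share for Q against an exact unitary matrix and two equal
    shares: one for the division by the triangular factor, one for passing to the isometric
    factor. *)

Section law.
Context d d' (T : measurableType d) (T' : measurableType d') (R : realType).

Definition mfun_of (f : T -> T') (mf : measurable_fun [set: T] f) : {mfun T >-> T'} :=
  HB.pack f (isMeasurableFun.Build _ _ _ _ f mf).

Definition law (P : probability T R) (f : T -> T') (mf : measurable_fun [set: T] f) :
    probability T' R :=
  distribution P (mfun_of mf).

Lemma lawE (P : probability T R) (f : T -> T') (mf : measurable_fun [set: T] f) A :
  law P mf A = P (f @^-1` A).
Proof. by []. Qed.

Lemma integral_law (P : probability T R) (f : T -> T') (mf : measurable_fun [set: T] f)
    (h : T' -> \bar R) : measurable_fun [set: T'] h -> (forall y, 0 <= h y)%E ->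
  (\int[law P mf]_y h y = \int[P]_x h (f x))%E.
Proof. by move=> mh h0; rewrite ge0_integral_distribution. Qed.

End law.

(** * Tuples of independent variables and their laws *)

Lemma measurable_fun_cons_pair d (T : measurableType d) n :
  measurable_fun setT (fun p : T * n.-tuple T => [tuple of p.1 :: p.2]).
Proof. exact: measurable_cons. Qed.

Section iid.
Context d (T : measurableType d) (R : realType).

(** Built by prepending one coordinate, so that Tonelli for the defining product peels off the first
    entry. *)
Fixpoint iid (mu : probability T R) n : probability (n.-tuple T) R :=
  match n with
  | 0 => dirac [tuple]
  | m.+1 => law (mu \x iid mu m)%E (@measurable_fun_cons_pair _ T m)
  end.

Lemma iidS_integral (mu : probability T R) n (h : n.+1.-tuple T -> \bar R) :
  measurable_fun [set: n.+1.-tuple T] h -> (forall y, 0 <= h y)%E ->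
  (\int[iid mu n.+1]_y h y = \int[mu]_x \int[iid mu n]_z h [tuple of x :: z])%E.
Proof.
move=> mh h0; rewrite /= integral_law// fubini_tonelli1//.
apply: (measurableT_comp mh); exact: measurable_fun_cons_pair.
Qed.

Lemma iidS_integral2 (mu : probability T R) n (h : n.+1.-tuple T -> \bar R) :
  measurable_fun [set: n.+1.-tuple T] h -> (forall y, 0 <= h y)%E ->
  (\int[iid mu n.+1]_y h y = \int[iid mu n]_z \int[mu]_x h [tuple of x :: z])%E.
Proof.
move=> mh h0; rewrite /= integral_law// fubini_tonelli2//.
apply: (measurableT_comp mh); exact: measurable_fun_cons_pair.
Qed.

Lemma integral_prob_setT (P : probability T R) (A : set T) : measurable A ->
  (\int[P]_x (\1_A x)%:E = P A)%E.
Proof. by move=> mA; rewrite integral_indic// setIT. Qed.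

Definition box n (B : 'I_n -> set T) : set (n.-tuple T) :=
  [set z | forall i, B i (tnth z i)].

Lemma measurable_box n (B : 'I_n -> set T) :
  (forall i, measurable (B i)) -> measurable (box B).
Proof.
move=> mB.
have -> : box B = \bigcap_(i in [set: 'I_n]) ((@tnth _ T ^~ i) @^-1` (B i)).
  by apply/seteqP; split => z /= h i => [_|]; exact: h.
apply: fin_bigcap_measurable => // i _.
by rewrite -[X in measurable X]setTI; exact: measurable_tnth.
Qed.

Lemma iid_box (mu : probability T R) n (B : 'I_n -> set T) :
  (forall i, measurable (B i)) -> (iid mu n (box B) = \prod_(i < n) mu (B i))%E.
Proof.
elim: n B => [|n IH] B mB.
  rewrite big_ord0 /= diracE mem_set//= => -[] //.
rewrite big_ord_recl -IH; last by move=> i; exact: mB.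
rewrite -product_measure1E//; last by apply: measurable_box => i; exact: mB.
congr (product_measure1 _ _ _).
apply/seteqP; split => -[x z] /=.
  by move=> h; split => /= [|i]; [exact: (h ord0)|have := h (lift ord0 i); rewrite tnthS].
move=> [/= hx hz] i; case: (unliftP ord0 i) => [j|] -> //.
by rewrite tnthS; exact: hz.
Qed.

(** Boxes form a pi-system. The generator [G] for a single coordinate is left free so that, for
    tuples of tuples, the faces can themselves be boxes. *)
Lemma iid_unique (mu : probability T R) n (G : set (set T))
    (nu : probability (n.-tuple T) R) :
  @measurable _ T = <<s G >> -> setI_closed G -> G setT ->
  (forall B : 'I_n -> set T, (forall i, G (B i)) ->
     nu (box B) = \prod_(i < n) mu (B i))%E ->
  forall A, measurable A -> nu A = iid mu n A.
Proof.
move=> mG GI GT nuE.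
have Gm B : G B -> measurable B by rewrite mG; exact: sub_sigma_algebra.
pose BG : set (set (n.-tuple T)) := [set A | exists2 B, (forall i, G (B i)) & A = box B].
apply: (measure_unique BG (fun=> setT)).
- apply/seteqP; split; last first.
    apply: smallest_sub; first exact: sigma_algebra_measurable.
    by move=> _ [B GB ->]; apply: measurable_box => i; exact/Gm.
  apply: smallest_sub; first exact: smallest_sigma_algebra.
  rewrite -bigcup_seq => A [i _ [B mB <-]]; rewrite setTI.
  (* The sets whose cylinder over coordinate i lies in the sigma-algebra of boxes form a
     sigma-algebra containing [G]. *)
  have : [set B | <<s BG >> ((@tnth _ T ^~ i) @^-1` B)] B.
    rewrite mG in mB; move: B mB; apply: smallest_sub.
      split => /=.
      + by rewrite preimage_set0; exact: sigma_algebra0.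
      + by move=> B sB; exact: (sigma_algebraCD sB).
      + by move=> F sF; rewrite preimage_bigcup; exact: sigma_algebra_bigcup.
    move=> B GB /=; apply: sub_sigma_algebra.
    exists (fun j => if j == i then B else setT) => [j|]; first by case: ifP.
    apply/seteqP; split => z /=.
      by move=> Bz j; case: eqP => // ->.
    by move=> /(_ i); rewrite eqxx.
  by [].
- move=> _ _ [B GB ->] [B' GB' ->]; exists (fun i => B i `&` B' i).
    by move=> i; exact: GI.
  apply/seteqP; split => z /=; first by move=> [h h'] i; split.
  by move=> h; split => i; case: (h i).
- by move=> _; exists (fun=> setT) => //; apply/seteqP; split.
- by rewrite bigcup_const.
- move=> _ [B GB ->]; rewrite [RHS]iid_box; first exact: nuE.
  by move=> i; exact/Gm.
- by move=> _; rewrite (le_lt_trans (probability_le1 _ _))// ltry.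
Qed.

Lemma iid_unique_setT (mu : probability T R) n (nu : probability (n.-tuple T) R) :
  (forall B : 'I_n -> set T, (forall i, measurable (B i)) ->
     nu (box B) = \prod_(i < n) mu (B i))%E ->
  forall A, measurable A -> nu A = iid mu n A.
Proof.
apply: iid_unique => //; last exact: measurableI.
by rewrite sigma_algebra_id//; exact: sigma_algebra_measurable.
Qed.

End iid.

Section iid_law.
Context d d' (T : measurableType d) (T' : measurableType d') (R : realType).

Lemma measurable_map_tuple n (f : T -> T') : measurable_fun [set: T] f ->
  measurable_fun [set: n.-tuple T] (@map_tuple n _ _ f).
Proof.
move=> mf; apply/measurable_fun_tnthP => i /=.
rewrite (_ : _ \o _ = f \o (@tnth _ T ^~ i)); last first.
  by apply/funext => z /=; rewrite tnth_map.
by apply: (measurableT_comp mf); exact: measurable_tnth.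
Qed.

Lemma iid_map (mu : probability T R) (nu : probability T' R) (f : T -> T') n
    (mf : measurable_fun [set: T] f) :
  (forall B, measurable B -> mu (f @^-1` B) = nu B) ->
  forall A, measurable A -> iid mu n (@map_tuple n _ _ f @^-1` A) = iid nu n A.
Proof.
move=> fE A mA.
apply: (@iid_unique_setT _ _ _ nu n (law (iid mu n) (measurable_map_tuple mf))) => // B mB.
under eq_bigr do rewrite -fE//.
rewrite -iid_box; last by move=> i; rewrite -[X in measurable X]setTI; exact: mf.
congr (iid mu n _).
by apply/seteqP; split => z /= h i; have := h i; rewrite tnth_map.
Qed.

Lemma measurable_subtuple m n (f : 'I_m -> 'I_n) :
  measurable_fun [set: n.-tuple T] (fun z => [tuple tnth z (f i) | i < m]).
Proof.
apply/measurable_fun_tnthP => i /=.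
rewrite (_ : _ \o _ = (@tnth _ T ^~ (f i))); first exact: measurable_tnth.
by apply/funext => z /=; rewrite tnth_mktuple.
Qed.

Lemma iid_subtuple (mu : probability T R) m n (f : 'I_m -> 'I_n) : injective f ->
  forall A, measurable A ->
  iid mu n ((fun z => [tuple tnth z (f i) | i < m]) @^-1` A) = iid mu m A.
Proof.
move=> finj A mA.
apply: (@iid_unique_setT _ _ _ mu m (law (iid mu n) (measurable_subtuple f))) => // B mB.
(* Coordinates outside the image of [f] get the full space, whose factor is 1. *)
pose B' j := if [pick i | f i == j] is Some i then B i else setT.
rewrite lawE (_ : _ @^-1` _ = box B'); last first.
  apply/seteqP; split => z /= h i.
    rewrite /B'; case: pickP => // k /eqP <-.
    by have := h k; rewrite tnth_mktuple.
  rewrite tnth_mktuple; have := h (f i); rewrite /B'.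
  by case: pickP => [k /eqP/finj ->//|/(_ i)]; rewrite eqxx.
rewrite iid_box; last by move=> j; rewrite /B'; case: pickP.
rewrite (bigID (fun j => j \in codom f))/= [X in (_ * X)%E]big1 ?mule1; last first.
  move=> j jf; rewrite /B'; case: pickP => [k /eqP fk|_]; last exact: probability_setT.
  by move: jf; rewrite -fk codom_f.
transitivity (\prod_(j in [set f i | i in 'I_m]%SET) mu (B' j))%E.
  apply: eq_bigl => j; apply/idP/idP => [/codomP[i ->]|/imsetP[i _ ->]].
    exact: imset_f.
  exact: codom_f.
rewrite big_imset/=; last by move=> ? ? _ _; exact: finj.
apply: eq_big => // i _; rewrite /B'.
by case: pickP => [k /eqP/finj ->//|/(_ i)]; rewrite eqxx.
Qed.

End iid_law.

(** * Substitutions for Lebesgue measure, and measures with a density *)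

Section lebesgue_substitution.
Context {R : realType}.
Local Notation leb := (@lebesgue_measure R).
Implicit Types f : R -> \bar R.

Lemma integral_lebesgue_shift (a : R) f :
  measurable_fun [set: R] f -> (forall x, 0 <= f x)%E ->
  (\int[leb]_x f (x + a)%R = \int[leb]_x f x)%E.
Proof.
move=> mf f0.
pose h : measurableTypeR R -> measurableTypeR R := fun x => x + a.
have mh : measurable_fun setT h by exact: measurable_funD.
transitivity (\int[pushforward leb (mfun_of mh)]_x f x)%E.
  by rewrite ge0_integral_pushforward.
apply: eq_measure_integral => A mA _; apply/esym/lebesgue_measure_unique => //.
move=> _ [[u v]] /= _ <-; rewrite /pushforward.
rewrite (_ : _ @^-1` _ = `](u - a), (v - a)]%classic); last first.
  by apply/seteqP; split => x /=; rewrite !in_itv/= ltrBlDr lerBrDr.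
rewrite !lebesgue_measure_itv/= !lte_fin ltrD2r.
by congr (if _ then _ else _); congr EFin; ring.
Qed.

Lemma integral_lebesgue_opp f :
  measurable_fun [set: R] f -> (forall x, 0 <= f x)%E ->
  (\int[leb]_x f (- x)%R = \int[leb]_x f x)%E.
Proof.
move=> mf f0.
pose h : measurableTypeR R -> measurableTypeR R := -%R.
have mh : measurable_fun setT h by exact: oppr_measurable.
transitivity (\int[pushforward leb (mfun_of mh)]_x f x)%E.
  by rewrite ge0_integral_pushforward.
by apply: eq_measure_integral => A mA _; exact: lebesgue_measureN.
Qed.

Lemma integral_lebesgue_scale (k : R) f : k != 0 ->
  measurable_fun [set: R] f -> (forall x, 0 <= f x)%E ->
  (`|k|%:E * \int[leb]_x f (k * x)%R = \int[leb]_x f x)%E.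
Proof.
wlog k0 : k f / 0 < k => [wl k0 mf f0|_ mf f0].
  case: (ltgtP k 0) (k0) => // [kN|kP] _; last exact: wl.
  have mfN : measurable_fun [set: R] (f \o -%R).
    by apply: measurableT_comp => //; exact: oppr_measurable.
  have := @wl (- k) (f \o -%R); rewrite oppr_gt0 oppr_eq0 => /(_ kN k0 mfN).
  move=> /(_ (fun x => f0 (- x))).
  rewrite (integral_lebesgue_opp mf f0) normrN => <-; congr (_ * _)%E.
  by apply: eq_integral => x _ /=; rewrite mulNr opprK.
pose h : measurableTypeR R -> measurableTypeR R := fun x => k * x.
have mh : measurable_fun setT h by exact: measurable_funM.
have kge0 : 0 <= k := ltW k0.
rewrite gtr0_norm//.
transitivity (k%:E * \int[pushforward leb (mfun_of mh)]_x f x)%E.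
  by rewrite ge0_integral_pushforward.
rewrite -[k]/(NngNum kge0)%:num -ge0_integral_mscale//.
apply: eq_measure_integral => A mA _; apply/esym/lebesgue_measure_unique => //.
move=> _ [[u v]] /= _ <-; rewrite /mscale/= /pushforward.
rewrite (_ : _ @^-1` _ = `](u / k), (v / k)]%classic); last first.
  by apply/seteqP; split => x /=; rewrite !in_itv/= ltr_pdivrMr// ler_pdivlMr// ![_ * k]mulrC.
rewrite !lebesgue_measure_itv/= !lte_fin ltr_pM2r ?invr_gt0//.
case: ifP => _; last by rewrite mule0.
by rewrite -EFinM; congr EFin; field; rewrite gt_eqF.
Qed.

End lebesgue_substitution.

Section integral_density.
Context d (T : measurableType d) (R : realType).
Context (mu nu : {measure set T -> \bar R}) (g : T -> R).
Hypotheses (mg : measurable_fun [set: T] g) (g0 : forall x, 0 <= g x).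
Context (nuE : forall A, measurable A -> (nu A = \int[mu]_(x in A) (g x)%:E)%E).

Import HBNNSimple.

Let integral_density_nnsfun (h : {nnsfun T >-> R}) :
  (\int[nu]_x (h x)%:E = \int[mu]_x ((h x)%:E * (g x)%:E))%E.
Proof.
under [LHS]eq_integral do rewrite fimfunE -fsumEFin//.
rewrite [LHS]ge0_integral_fsum//; last 2 first.
  - by move=> r; exact/measurable_EFinP/measurableT_comp.
  - by move=> n x _; rewrite EFinM nnfun_muleindic_ge0.
under [RHS]eq_integral.
  move=> x xD; rewrite fimfunE -fsumEFin// muleC ge0_mule_fsumr; last first.
    by move=> r; rewrite EFinM nnfun_muleindic_ge0.
  over.
rewrite [RHS]ge0_integral_fsum//; last 2 first.
  - move=> r; apply: emeasurable_funM; first exact/measurable_EFinP.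
    by apply/measurable_EFinP/measurableT_comp.
  - move=> n x _; rewrite EFinM mule_ge0//; last by rewrite nnfun_muleindic_ge0.
    by rewrite lee_fin.
apply: eq_fsbigr => r _; rewrite integralZl_indic_nnsfun// integral_indic// setIT.
(* The scalar leaves the integral only when nonnegative; a negative r has empty preimage because h
   is nonnegative. *)
have [r0|r0] := ltP r 0.
  rewrite preimage_nnfun0// measure0 mule0 integral0_eq// => x _.
  by rewrite indic0 mulr0 mule0.
have mgr : measurable_fun setT ((EFin \o g) \_ (h @^-1` [set r])).
  apply/(measurable_restrictT _ _).1 => //.
  exact/measurable_EFinP/measurable_funTS.
have gr0 x : (0 <= ((EFin \o g) \_ (h @^-1` [set r])) x)%E.
  by rewrite patchE; case: ifP => // _; rewrite lee_fin.
rewrite nuE// integral_mkcond -ge0_integralZl//.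
apply: eq_integral => x _; rewrite patchE indicE.
by case: ifP => _; rewrite ?mulr1 ?mulr0 ?mule0// muleC.
Qed.

(** Approximation by simple functions, with monotone convergence on both sides. *)
Lemma integral_density (f : T -> \bar R) :
  measurable_fun [set: T] f -> (forall x, 0 <= f x)%E ->
  (\int[nu]_x f x = \int[mu]_x (f x * (g x)%:E))%E.
Proof.
move=> mf f0; pose f_ := nnsfun_approx measurableT mf.
have f_cvg x : EFin (f_ n x) @[n --> \oo] --> f x by exact: cvg_nnsfun_approx.
transitivity (lim (\int[nu]_x (f_ n x)%:E @[n --> \oo])%E).
  rewrite -monotone_convergence//=.
  - by apply: eq_integral => x _; apply/esym/cvg_lim.
  - by move=> n; exact/measurable_EFinP/measurable_funTS.
  - by move=> n ? _; rewrite lee_fin.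
  - by move=> ? _ ? ? mn; rewrite lee_fin; exact/lefP/nd_nnsfun_approx.
transitivity (lim (\int[mu]_x ((f_ n x)%:E * (g x)%:E) @[n --> \oo])%E).
  by apply: congr_lim; apply/funext => n; exact: integral_density_nnsfun.
rewrite -monotone_convergence//=.
- apply: eq_integral => x _; apply/cvg_lim => //.
  by apply: cvgeZr => //.
- move=> n; apply: emeasurable_funM; exact/measurable_EFinP.
- by move=> n x _; rewrite mule_ge0// lee_fin.
- move=> x _ m n mn; rewrite lee_pmul// ?lee_fin//.
  exact/lefP/nd_nnsfun_approx.
Qed.

End integral_density.

(** * Squared modulus and measurability of complex functions *)

Section complex_measurability.
Context {R : realType}.
Local Notation CM := (measurableTypeR R * measurableTypeR R)%type.

(** A polynomial in the real and imaginary parts, which avoids square roots in measurability proofs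
    and in [ring] identities. *)
Definition nsq (z : R[i]) : R := complex.Re z ^+ 2 + complex.Im z ^+ 2.

Lemma nsq_ge0 z : 0 <= nsq z.
Proof. by rewrite addr_ge0 ?sqr_ge0. Qed.

Lemma cabs_sqr (z : R[i]) : cabs z ^+ 2 = nsq z.
Proof. by case: z => a b; rewrite /cabs /nsq /= sqr_sqrtr// addr_ge0 ?sqr_ge0. Qed.

Lemma cabs_nsq (z : R[i]) : cabs z = Num.sqrt (nsq z).
Proof. by case: z. Qed.

Lemma nsqM (z w : R[i]) : nsq (z * w) = nsq z * nsq w.
Proof. by case: z w => [a b] [c d]; rewrite /nsq /=; ring. Qed.

Lemma nsq_conj (z : R[i]) : nsq z^* = nsq z.
Proof. by case: z => a b; rewrite /nsq /= sqrrN. Qed.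

Lemma nsqN (z : R[i]) : nsq (- z) = nsq z.
Proof. by case: z => a b; rewrite /nsq /= !sqrrN. Qed.

Lemma nsq0 : nsq 0 = 0.
Proof. by rewrite /nsq /= expr0n addr0. Qed.

Lemma nsq1 : nsq 1 = 1.
Proof. by rewrite /nsq /= expr0n expr1n addr0. Qed.

Lemma nsq_real (x : R) : nsq x%:C = x ^+ 2.
Proof. by rewrite /nsq /= expr0n addr0. Qed.

Lemma nsq_eq0 z : (nsq z == 0) = (z == 0).
Proof.
by case: z => a b; rewrite /nsq eq_complex /= paddr_eq0 ?sqr_ge0// !sqrf_eq0.
Qed.

Lemma mulcJ (z : R[i]) : z * z^* = (nsq z)%:C.
Proof. by case: z => a b; rewrite /nsq; apply/eqP; rewrite eq_complex /=; apply/andP; split; apply/eqP; ring. Qed.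

Lemma c2rK : cancel (@c2r R) (@r2c R). Proof. by case. Qed.
Lemma r2cK : cancel (@r2c R) (@c2r R). Proof. by case. Qed.

Definition cmeas d (T : measurableType d) (F : T -> R[i]) : Prop :=
  measurable_fun [set: T] (fun x => complex.Re (F x)) /\
  measurable_fun [set: T] (fun x => complex.Im (F x)).

Section cmeas.
Context d (T : measurableType d).
Implicit Types F G : T -> R[i].

Lemma cmeas_cst c : cmeas (fun _ : T => c).
Proof. by split; exact: measurable_cst. Qed.

Lemma cmeasD F G : cmeas F -> cmeas G -> cmeas (fun x => F x + G x).
Proof.
move=> [F1 F2] [G1 G2]; split.
  under eq_fun do rewrite raddfD/=; exact: measurable_funD.
under eq_fun do rewrite raddfD/=; exact: measurable_funD.
Qed.

Lemma cmeasM F G : cmeas F -> cmeas G -> cmeas (fun x => F x * G x).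
Proof.
move=> [F1 F2] [G1 G2]; split.
  rewrite (_ : (fun x => _) = (fun x => complex.Re (F x) * complex.Re (G x)
     - complex.Im (F x) * complex.Im (G x))).
    by apply: measurable_funB; exact: measurable_funM.
  by apply/funext => x; case: (F x) (G x) => [a b] [u v].
rewrite (_ : (fun x => _) = (fun x => complex.Re (F x) * complex.Im (G x)
   + complex.Im (F x) * complex.Re (G x))).
  by apply: measurable_funD; exact: measurable_funM.
by apply/funext => x; case: (F x) (G x) => [a b] [u v].
Qed.

Lemma cmeas_sum (I : Type) (s : seq I) (P : pred I) (F : I -> T -> R[i]) :
  (forall i, cmeas (F i)) -> cmeas (fun x => \sum_(i <- s | P i) F i x).
Proof.
move=> mF; elim: s => [|i s IH].
  by under [fun x => _]eq_fun do rewrite big_nil; exact: cmeas_cst.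
under [fun x => _]eq_fun do rewrite big_cons.
by case: (P i) => //; exact: cmeasD.
Qed.

Lemma cmeas_prod (I : Type) (s : seq I) (P : pred I) (F : I -> T -> R[i]) :
  (forall i, cmeas (F i)) -> cmeas (fun x => \prod_(i <- s | P i) F i x).
Proof.
move=> mF; elim: s => [|i s IH].
  by under [fun x => _]eq_fun do rewrite big_nil; exact: cmeas_cst.
under [fun x => _]eq_fun do rewrite big_cons.
by case: (P i) => //; exact: cmeasM.
Qed.

Lemma measurable_nsq F : cmeas F -> measurable_fun [set: T] (fun x => nsq (F x)).
Proof.
by move=> [F1 F2]; apply: measurable_funD; exact: measurable_funX.
Qed.

Lemma measurable_c2r F : cmeas F -> measurable_fun [set: T] (fun x => c2r (F x) : CM).
Proof.
move=> [F1 F2].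
exact: (@measurable_fun_pair _ _ _ T (measurableTypeR R) (measurableTypeR R)).
Qed.

Lemma cmeas_r2c (f : T -> CM) : measurable_fun [set: T] f -> cmeas (fun x => r2c (f x)).
Proof.
move=> mf; split.
  exact: (measurableT_comp (measurable_fst : measurable_fun [set: CM] fst) mf).
exact: (measurableT_comp (measurable_snd : measurable_fun [set: CM] snd) mf).
Qed.

End cmeas.

Lemma cmeas_comp d d' (T : measurableType d) (T' : measurableType d')
    (F : T' -> R[i]) (f : T -> T') :
  cmeas F -> measurable_fun [set: T] f -> cmeas (fun x => F (f x)).
Proof.
move=> [F1 F2] mf; split.
  exact: (measurableT_comp F1 mf).
exact: (measurableT_comp F2 mf).
Qed.

Lemma cmeas_det d (T : measurableType d) n (F : T -> 'M[R[i]]_n) :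
  (forall i j, cmeas (fun x => F x i j)) -> cmeas (fun x => \det (F x)).
Proof.
move=> mF; apply: cmeas_sum => s; apply: cmeasM; first exact: cmeas_cst.
by apply: cmeas_prod.
Qed.

Lemma cmeas_mulmx d (T : measurableType d) m n p (F : T -> 'M[R[i]]_(m, n))
    (G : T -> 'M[R[i]]_(n, p)) :
  (forall i j, cmeas (fun x => F x i j)) -> (forall i j, cmeas (fun x => G x i j)) ->
  forall i j, cmeas (fun x => (F x *m G x) i j).
Proof.
move=> mF mG i j; under [fun x => _]eq_fun do rewrite mxE.
by apply: cmeas_sum => k; exact: cmeasM.
Qed.

End complex_measurability.

(** * The standard complex Gaussian law and its density *)

Section complex_gaussian.
Context {R : realType}.
Local Notation CM := (measurableTypeR R * measurableTypeR R)%type.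
Local Notation leb := (@lebesgue_measure R).
Local Notation leb2 := (leb \x leb)%E.

(** The measure [cgauss] again, typed as a probability so that [iid] accepts it. *)
Definition cgm : probability CM R :=
  (normal_prob 0 (Num.sqrt 2^-1) \x normal_prob 0 (Num.sqrt 2^-1))%E.


Definition cpdf (z : R[i]) : R := pi^-1 * expR (- nsq z).

Lemma normal_pdf_half (x : R) :
  normal_pdf 0 (Num.sqrt 2^-1) x = (Num.sqrt pi)^-1 * expR (- x ^+ 2).
Proof.
rewrite normal_pdfE ?sqrtr_eq0 -?ltNge ?invr_gt0//.
rewrite /normal_peak /normal_fun subr0 sqr_sqrtr ?invr_ge0//.
have half2 : 2^-1 *+ 2 = 1 :> R by rewrite -(mulr_natr 2^-1) mulVf.
by rewrite half2 divr1 -mulrnAl half2 mul1r.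
Qed.

Lemma integral_normal_half (f : R -> \bar R) :
  measurable_fun [set: R] f -> (forall x, 0 <= f x)%E ->
  (\int[normal_prob 0 (Num.sqrt 2^-1)]_x f x =
   \int[leb]_x (f x * ((Num.sqrt pi)^-1 * expR (- x ^+ 2))%:E))%E.
Proof.
move=> mf f0; rewrite (@integral_density _ _ _ leb _ (normal_pdf 0 (Num.sqrt 2^-1)))//.
- by apply: eq_integral => x _; rewrite normal_pdf_half.
- exact: measurable_normal_pdf.
- by move=> x; exact: normal_pdf_ge0.
Qed.

Lemma measurable_r2c_nsq : measurable_fun [set: CM] (fun p : CM => nsq (r2c p)).
Proof. by apply: measurable_nsq; exact: cmeas_r2c. Qed.

Lemma measurable_cpdf : measurable_fun [set: CM] (fun p : CM => cpdf (r2c p)).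
Proof.
apply: measurable_funM => //; apply: measurableT_comp => //.
by apply: measurableT_comp => //; exact: measurable_r2c_nsq.
Qed.

Lemma integral_cgm (f : CM -> \bar R) :
  measurable_fun [set: CM] f -> (forall x, 0 <= f x)%E ->
  (\int[cgm]_p f p = \int[leb2]_p (f p * (cpdf (r2c p))%:E))%E.
Proof.
move=> mf f0.
have pdf0 (x : R) : 0 <= (Num.sqrt pi)^-1 * expR (- x ^+ 2).
  by rewrite mulr_ge0// ?expR_ge0// invr_ge0 sqrtr_ge0.
have mpdf : measurable_fun [set: R] (fun x : R => (Num.sqrt pi)^-1 * expR (- x ^+ 2)).
  by apply: measurable_funM => //; do 2 apply: measurableT_comp => //.
rewrite fubini_tonelli1// integral_normal_half; last 2 first.
- exact: measurable_fun_fubini_tonelli_F.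
- by move=> x; apply: integral_ge0.
rewrite fubini_tonelli1; last 2 first.
- by apply: emeasurable_funM => //; apply/measurable_EFinP; exact: measurable_cpdf.
- by move=> z; rewrite mule_ge0// lee_fin mulr_ge0 ?expR_ge0// invr_ge0 pi_ge0.
apply: eq_integral => x _; rewrite /fubini_F integral_normal_half//; last first.
  by apply: measurableT_comp => //; exact: pair1_measurable.
rewrite -ge0_integralZr//; last 2 first.
- apply: emeasurable_funM; last exact/measurable_EFinP.
  by apply: measurableT_comp => //; exact: pair1_measurable.
- by move=> y _; rewrite mule_ge0.
apply: eq_integral => y _; rewrite -muleA -EFinM; congr (_ * _%:E)%E.
rewrite /cpdf /nsq /= opprD expRD.
have -> : pi^-1 = (Num.sqrt pi)^-1 * (Num.sqrt pi)^-1 :> R.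
  by rewrite -invfM -expr2 sqr_sqrtr ?pi_ge0.
by ring.
Qed.

End complex_gaussian.

(** * Invariance under SU(2) *)

Section su2.
Context {R : realType}.
Local Notation CM := (measurableTypeR R * measurableTypeR R)%type.
Local Notation leb := (@lebesgue_measure R).

Definition leb2 : set CM -> \bar R := (leb \x leb)%E.
HB.instance Definition _ := Measure.on leb2.

Fact leb2_sigma_finite : sigma_finite setT leb2.
Proof.
have /sigma_finiteP[F [TF ndF Foo]] := sigma_finiteT leb.
exists (fun n => F n `*` F n).
  rewrite -setXTT TF predeqE => -[x y]; split.
    move=> [/= [n _ Fnx] [k _ Gky]]; exists (maxn n k) => //; split.
    - by move: x Fnx; exact/subsetPset/ndF/leq_maxl.
    - by move: y Gky; exact/subsetPset/ndF/leq_maxr.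
  by move=> [n _ []/= ? ?]; split; exists n.
move=> k; have [mF Fk] := Foo k.
split; first exact: measurableX.
rewrite /leb2 product_measure1E// lte_mul_pinfty// ge0_fin_numE//.
Qed.

HB.instance Definition _ := Measure_isSigmaFinite.Build _ _ _ leb2 leb2_sigma_finite.

Lemma integral_leb2_shift (a : R[i]) (f : CM -> \bar R) :
  measurable_fun [set: CM] f -> (forall x, 0 <= f x)%E ->
  (\int[leb2]_p f (c2r (r2c p + a)%R) = \int[leb2]_p f p)%E.
Proof.
move=> mf f0.
have mfa : measurable_fun [set: CM] (fun p : CM => f (c2r (r2c p + a))).
  apply: (measurableT_comp mf); apply: measurable_c2r.
  by apply: cmeasD; [exact: cmeas_r2c|exact: cmeas_cst].
rewrite /leb2 !fubini_tonelli1//.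
have mF := @measurable_fun_fubini_tonelli_F _ _ _ _ R leb f mf f0.
rewrite -(integral_lebesgue_shift (complex.Re a) mF); last first.
  by move=> x; exact: integral_ge0.
apply: eq_integral => x _; rewrite /fubini_F.
rewrite -(@integral_lebesgue_shift _ (complex.Im a) (fun y => f (_, y)))//.
  apply: eq_integral => y _; congr f.
  by case: a {mfa} => u v.
by apply: (measurableT_comp mf); exact: pair1_measurable.
Qed.

Let mpair (F G : CM * CM -> R[i]) : cmeas F -> cmeas G ->
  measurable_fun [set: CM * CM] (fun p => (c2r (F p) : CM, c2r (G p) : CM)).
Proof.
by move=> mF mG; apply: measurable_fun_pair; exact: measurable_c2r.
Qed.

Let cm1 : cmeas (fun p : CM * CM => r2c p.1).
Proof. by apply: cmeas_r2c. Qed.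
Let cm2 : cmeas (fun p : CM * CM => r2c p.2).
Proof. by apply: cmeas_r2c. Qed.

Let shear1 (a : R[i]) (F : CM * CM -> \bar R) :
  measurable_fun [set: CM * CM] F -> (forall x, 0 <= F x)%E ->
  (\int[leb2 \x leb2]_p F (c2r (r2c p.1 + a * r2c p.2)%R, p.2) =
   \int[leb2 \x leb2]_p F p)%E.
Proof.
move=> mF F0.
rewrite [LHS]fubini_tonelli2//; last first.
  apply: (measurableT_comp mF).
  apply: measurable_fun_pair; last exact: measurable_snd.
  apply: measurable_c2r; apply: cmeasD => //; apply: cmeasM => //; exact: cmeas_cst.
rewrite [RHS](fubini_tonelli2 _ mF F0).
apply: eq_integral => w _; rewrite /fubini_G /=.
rewrite (@integral_leb2_shift _ (fun z => F (z, w)))//.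
by apply: (measurableT_comp mF); exact: pair2_measurable.
Qed.

Let shear2 (a : R[i]) (F : CM * CM -> \bar R) :
  measurable_fun [set: CM * CM] F -> (forall x, 0 <= F x)%E ->
  (\int[leb2 \x leb2]_p F (p.1, c2r (r2c p.2 + a * r2c p.1)%R) =
   \int[leb2 \x leb2]_p F p)%E.
Proof.
move=> mF F0.
rewrite [LHS]fubini_tonelli1//; last first.
  apply: (measurableT_comp mF).
  apply: measurable_fun_pair; first exact: measurable_fst.
  apply: measurable_c2r; apply: cmeasD => //; apply: cmeasM => //; exact: cmeas_cst.
rewrite [RHS](fubini_tonelli1 _ mF F0).
apply: eq_integral => z _; rewrite /fubini_F /=.
rewrite (@integral_leb2_shift _ (fun w => F (z, w)))//.
by apply: (measurableT_comp mF); exact: pair1_measurable.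
Qed.

(* The matrix of SU(2) is a product of three shears. *)
Lemma integral_leb2_su2 (a b : R[i]) (F : CM * CM -> \bar R) :
  nsq a + nsq b = 1 -> b != 0 ->
  measurable_fun [set: CM * CM] F -> (forall x, 0 <= F x)%E ->
  (\int[leb2 \x leb2]_p F (c2r (a * r2c p.1 + b * r2c p.2)%R,
                           c2r (- b^* * r2c p.1 + a^* * r2c p.2)%R) =
   \int[leb2 \x leb2]_p F p)%E.
Proof.
move=> ab b0 mF F0.
have cb0 : b^* != 0 by rewrite conjc_eq0.
have abE : a * a^* + b * b^* = 1 by rewrite !mulcJ -rmorphD/= ab.
(* In the product of the upper shear [al], the lower shear -b^* and the upper shear [c], the
   diagonal entries 1 - al b^* and 1 - c b^* must be a and a^*. This fixes [al] and [c]; the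
   remaining corner is b by |a|^2 + |b|^2 = 1. *)
pose al := (1 - a) / b^*; pose c := (1 - a^*) / b^*.
have mF1 : measurable_fun [set: CM * CM]
    (fun p => F (c2r (r2c p.1 + al * r2c p.2), p.2)).
  apply: (measurableT_comp mF).
  apply: measurable_fun_pair; last exact: measurable_snd.
  apply: measurable_c2r; apply: cmeasD => //; apply: cmeasM => //; exact: cmeas_cst.
pose F2 := fun p : CM * CM => let q := (p.1, c2r (r2c p.2 + (- b^*) * r2c p.1)) in
  F (c2r (r2c q.1 + al * r2c q.2), q.2).
have mF2 : measurable_fun [set: CM * CM] F2.
  apply: (measurableT_comp mF1).
  apply: measurable_fun_pair; first exact: measurable_fst.
  apply: measurable_c2r; apply: cmeasD => //; apply: cmeasM => //; exact: cmeas_cst.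
rewrite -(shear1 al mF F0) -(shear2 (- b^*) mF1)//.
rewrite -(shear1 c mF2); last by move=> p; exact: F0.
apply: eq_integral => -[z w] _.
have bE : b = (1 - a * a^*) / b^* by rewrite -abE addrC addKr mulfK.
rewrite /F2 /= !c2rK /al /c {al c mF1 F2 mF2}.
congr (F (c2r _, c2r _)).
  rewrite {1}bE; move: (b^*) (a^*) cb0 => b' a' b'0.
  by rewrite !(mulrDl, mulrDr, mulrBl, mulrBr) !mulrA; field.
by move: (b^*) (a^*) cb0 => b' a' b'0; field.
Qed.

(** The joint density of two independent copies depends on |z|^2 + |w|^2 only, which the matrix
    preserves. *)
Lemma integral_cgm_su2 (a b : R[i]) (F : CM * CM -> \bar R) :
  nsq a + nsq b = 1 -> b != 0 ->
  measurable_fun [set: CM * CM] F -> (forall x, 0 <= F x)%E ->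
  (\int[cgm \x cgm]_p F (c2r (a * r2c p.1 + b * r2c p.2)%R,
                         c2r (- b^* * r2c p.1 + a^* * r2c p.2)%R) =
   \int[cgm \x cgm]_p F p)%E.
Proof.
have key G : measurable_fun [set: CM * CM] G -> (forall x, 0 <= G x)%E ->
    (\int[cgm \x cgm]_p G p =
     \int[leb2 \x leb2]_p (G p * (cpdf (r2c p.1) * cpdf (r2c p.2))%R%:E))%E.
  move=> mG G0.
  have pdf0 (z : R[i]) : 0 <= cpdf z by rewrite mulr_ge0 ?expR_ge0// invr_ge0 pi_ge0.
  have m1 : measurable_fun [set: CM * CM] (fun p => (cpdf (r2c p.1))%:E).
    apply/measurable_EFinP.
    exact: (measurableT_comp measurable_cpdf).
  have m2 : measurable_fun [set: CM * CM] (fun p => (cpdf (r2c p.2))%:E).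
    apply/measurable_EFinP.
    exact: (measurableT_comp measurable_cpdf).
  have mGm : measurable_fun [set: CM * CM]
      (fun p => G p * (cpdf (r2c p.1) * cpdf (r2c p.2))%:E)%E.
    under [fun p => _]eq_fun do rewrite EFinM.
    by apply: emeasurable_funM => //; exact: emeasurable_funM.
  rewrite [LHS]fubini_tonelli1// [RHS]fubini_tonelli1//; last first.
    by move=> p; rewrite mule_ge0// lee_fin mulr_ge0.
  rewrite integral_cgm -/leb2; last 2 first.
  - exact: measurable_fun_fubini_tonelli_F.
  - by move=> x; exact: integral_ge0.
  apply: eq_integral => z _; rewrite /fubini_F integral_cgm//; last first.
    by apply: (measurableT_comp mG); exact: pair1_measurable.
  rewrite -ge0_integralZr//.
  - by apply: eq_integral => w _; rewrite -muleA -EFinM mulrC.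
  - apply: emeasurable_funM; first by apply: (measurableT_comp mG); exact: pair1_measurable.
    by apply/measurable_EFinP; exact: measurable_cpdf.
  - by move=> w _; rewrite mule_ge0// lee_fin.
  - by rewrite lee_fin.
move=> ab b0 mF F0.
have mFg : measurable_fun [set: CM * CM] (fun p : CM * CM =>
    F (c2r (a * r2c p.1 + b * r2c p.2), c2r (- b^* * r2c p.1 + a^* * r2c p.2))).
  apply: (measurableT_comp mF); apply: mpair.
    by apply: cmeasD; apply: cmeasM => //; exact: cmeas_cst.
  by apply: cmeasD; apply: cmeasM => //; exact: cmeas_cst.
have pdf0 (z : R[i]) : 0 <= cpdf z by rewrite mulr_ge0 ?expR_ge0// invr_ge0 pi_ge0.
rewrite !key// -[RHS](integral_leb2_su2 ab b0); last 2 first.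
- apply: emeasurable_funM => //; apply/measurable_EFinP; apply: measurable_funM.
    exact: (measurableT_comp measurable_cpdf).
  exact: (measurableT_comp measurable_cpdf).
- by move=> p; rewrite mule_ge0// lee_fin mulr_ge0.
apply: eq_integral => -[z w] _; congr (_ * _%:E)%E.
rewrite /cpdf !c2rK /=; rewrite mulrACA -expRD -opprD [RHS]mulrACA -expRD -opprD.
congr (_ * expR (- _)).
have -> : nsq (r2c z) + nsq (r2c w) = (nsq a + nsq b) * (nsq (r2c z) + nsq (r2c w)).
  by rewrite ab mul1r.
case: a b {ab b0 mFg} => [a1 a2] [b1 b2]; case: z w => [z1 z2] [w1 w2].
by rewrite /nsq /=; ring.
Qed.

End su2.

(** * Radial tail and Laplace transform of the complex Gaussian *)

Section gaussian_tail.
Context {R : realType}.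
Local Notation CM := (measurableTypeR R * measurableTypeR R)%type.
Local Notation leb := (@lebesgue_measure R).

Let half_tail (b : R) : 0 <= b ->
  (\int[leb]_(s in `[b, +oo[) (s * expR (- s ^+ 2))%:E = (expR (- b ^+ 2) / 2)%:E)%E.
Proof.
move=> b0.
have df (x : R) : is_derive x 1 (fun s : R => - (expR (- s ^+ 2) / 2)) (x * expR (- x ^+ 2)).
  apply: is_derive_eq.
  by rewrite /GRing.scale /=; field.
rewrite (@ge0_continuous_FTC2y _ _ (fun s => - (expR (- s ^+ 2) / 2)) _ 0).
- by rewrite -EFinN opprK add0e.
- by move=> x bx; rewrite mulr_ge0 ?expR_ge0// (le_trans b0).
- apply: continuous_subspaceT => x.
  apply: cvgM; first exact: cvg_id.
  exact: continuous_gauss_fun.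
- rewrite -oppr0; apply: cvgN; rewrite -(mul0r 2^-1); apply: cvgMl.
  exact: cvg_gauss_fun.
- by move=> x _; apply: ex_derive.
- apply: cvg_at_right_filter; apply: cvgN; apply: cvgMl.
  exact: continuous_gauss_fun.
- by move=> x _; rewrite derive1E; apply: derive_val.
Qed.

Let tail_fun (a s : R) : R := `|s| * ((a <= s ^+ 2)%R%:R * expR (- s ^+ 2)).

Let measurable_ge (T := R) (d := default_measure_display) (a : R) d1 (S : measurableType d1) (f : S -> R) :
  measurable_fun [set: S] f -> measurable_fun [set: S] (fun s => (a <= f s)%R%:R : R).
Proof.
move=> mf; apply: (@measurableT_comp _ _ _ _ _ _ (fun b : bool => b%:R : R)).
  by [].
by apply: measurable_fun_ler => //.
Qed.

Let measurable_tail_fun a : measurable_fun [set: R] (tail_fun a).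
Proof.
apply: measurable_funM; first exact: normr_measurable.
apply: measurable_funM; last exact: measurable_gauss_fun.
by apply: measurable_ge.
Qed.

Let integral_tail_fun (a : R) : 0 <= a ->
  (\int[leb]_s (tail_fun a s)%:E = (expR (- a))%:E)%E.
Proof.
move=> a0; pose b := Num.sqrt a.
have b0 : 0 <= b by exact: sqrtr_ge0.
pose p (s : R) : R := (b <= s)%R%:R * (s * expR (- s ^+ 2)).
have p0 s : 0 <= p s.
  rewrite /p; case: (boolP (b <= s)) => bs; last by rewrite mul0r.
  by rewrite mul1r mulr_ge0 ?expR_ge0// (le_trans b0).
have mp : measurable_fun [set: R] p.
  apply: measurable_funM; first exact: (@measurable_ge b).
  by apply: measurable_funM => //; exact: measurable_gauss_fun.
(* For a = 0 both indicators hold at s = 0; the factor s makes the overlap vanish. *)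
have tailE s : tail_fun a s = p s + p (- s).
  rewrite /tail_fun /p sqrrN -[a in (a <= _)](sqr_sqrtr a0) -/b.
  case: (leP 0 s) => s0.
    rewrite ger0_norm// ler_sqr// lerNr.
    case: (b <= s); rewrite ?mul0r ?mul1r ?mulr0 ?add0r.
      case: (boolP (s <= - b)) => [sb|_]; last by rewrite mul0r addr0.
      have -> : s = 0 by apply/eqP; rewrite eq_le s0 (le_trans sb)// oppr_le0.
      by rewrite oppr0 !mul0r mulr0 addr0.
    case: (boolP (s <= - b)) => [sb|_]; last by rewrite mul0r.
    have -> : s = 0 by apply/eqP; rewrite eq_le s0 (le_trans sb)// oppr_le0.
    by rewrite oppr0 !mul0r mulr0.
  have -> : (b <= s) = false by apply/negbTE; rewrite -ltNge (lt_le_trans s0).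
  have -> : (b ^+ 2 <= s ^+ 2) = (b <= - s).
    by rewrite -[s ^+ 2]sqrrN ler_sqr// nnegrE oppr_ge0 ltW.
  by rewrite ltr0_norm// mul0r add0r; ring.
transitivity (\int[leb]_s ((p s)%:E + (p (- s)%R)%:E))%E.
  by apply: eq_integral => s _; rewrite tailE EFinD.
rewrite ge0_integralD//; last 4 first.
- by move=> s _; rewrite lee_fin.
- exact/measurable_EFinP.
- by move=> s _; rewrite lee_fin.
- by apply/measurable_EFinP; apply: measurableT_comp => //; exact: oppr_measurable.
rewrite (integral_lebesgue_opp (f := EFin \o p)); last 2 first.
- exact/measurable_EFinP.
- by move=> s; rewrite /= lee_fin.
have -> : (\int[leb]_s (p s)%:E = (expR (- b ^+ 2) / 2)%:E)%E.
  rewrite -half_tail// [RHS]integral_mkcond; apply: eq_integral => s _.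
  rewrite patchE /p; case: ifPn => [|].
    by rewrite inE/= in_itv/= andbT => ->; rewrite mul1r.
  by rewrite notin_setE/= in_itv/= andbT => /negP/negbTE ->; rewrite mul0r.
by rewrite -EFinD sqr_sqrtr//; congr EFin; field.
Qed.

(** The substitution y = x v replaces polar coordinates. The integrand becomes |x| h(x^2 (1 + v^2)),
    whose integral in x is explicit, and a constant C remains, the integral of 1 / (1 + v^2). Its
    value is not computed: the case a = 0 has probability 1 and forces C = pi. *)
Lemma cgm_tail (a : R) : 0 <= a -> cgm [set p | a <= nsq (r2c p)] = (expR (- a))%:E.
Proof.
have mS b : measurable [set p : CM | b <= nsq (r2c p)].
  rewrite (_ : [set p | _] = (fun p : CM => nsq (r2c p)) @^-1` `[b, +oo[%classic).
    by rewrite -[X in measurable X]setTI; exact: measurable_r2c_nsq.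
  by apply/seteqP; split => p /=; rewrite in_itv/= andbT.
pose C := (\int[leb]_v ((1 + v ^+ 2)^-1)%:E)%E.
have key b : 0 <= b -> cgm [set p | b <= nsq (r2c p)] = ((expR (- b) / pi)%:E * C)%E.
  move=> b0; rewrite -integral_prob_setT// integral_cgm//; last first.
    by apply/measurable_EFinP; exact: measurable_indic.
  pose h (q : R) : R := (b <= q)%R%:R * (pi^-1 * expR (- q)).
  have h0 q : 0 <= h q.
    by rewrite mulr_ge0 ?ler0n// mulr_ge0 ?expR_ge0// invr_ge0 pi_ge0.
  have mh : measurable_fun [set: R] h.
    apply: measurable_funM; first exact: (@measurable_ge b).
    by apply: measurable_funM => //; apply: measurableT_comp => //.
  transitivity (\int[leb \x leb]_p (h (p.1 ^+ 2 + p.2 ^+ 2))%:E)%E.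
    apply: eq_integral => p _; rewrite -EFinM /h indicE mem_setE /cpdf.
    by congr EFin; congr (_%:R * _).
  have msq : measurable_fun [set: CM] (fun p : CM => (h (p.1 ^+ 2 + p.2 ^+ 2))%:E).
    apply/measurable_EFinP; apply: (measurableT_comp mh).
    by apply: measurable_funD; apply: measurable_funX.
  rewrite fubini_tonelli1//; last by move=> p; rewrite lee_fin.
  pose H (x v : R) : R := `|x| * h (x ^+ 2 * (1 + v ^+ 2)).
  have H0 x v : 0 <= H x v by rewrite mulr_ge0.
  have mH : measurable_fun [set: CM] (fun p : CM => (H p.1 p.2)%:E).
    apply/measurable_EFinP; apply: measurable_funM; first exact: measurableT_comp.
    apply: (measurableT_comp mh); apply: measurable_funM; first exact: measurable_funX.
    by apply: measurable_funD => //; exact: measurable_funX.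
  transitivity (\int[leb]_x \int[leb]_v (H x v)%:E)%E.
    apply: ge0_ae_eq_integral => //.
    - apply: (@measurable_fun_fubini_tonelli_F _ _ _ _ R leb) => // p.
      by rewrite lee_fin.
    - apply: (@measurable_fun_fubini_tonelli_F _ _ _ _ R leb (fun p => (H p.1 p.2)%:E)) => // p.
      by rewrite lee_fin.
    - by move=> x _; apply: integral_ge0 => y _; rewrite lee_fin.
    - by move=> x _; apply: integral_ge0 => y _; rewrite lee_fin.
    (* The substitution needs x nonzero; the exception is a null set. *)
    exists [set 0]; split => //; first exact: lebesgue_measure_set1.
    move=> x /= xN; apply: contrapT => x0; apply: xN => _; rewrite /fubini_F /=.
    have {}x0 : x != 0 by apply/eqP.
    rewrite -(integral_lebesgue_scale x0); last 2 first.
    - apply/measurable_EFinP; apply: (measurableT_comp mh).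
      by apply: measurable_funD => //; exact: measurable_funX.
    - by move=> y; rewrite lee_fin.
    rewrite -ge0_integralZl//; last 2 first.
    - apply/measurable_EFinP; apply: (measurableT_comp mh).
      by apply: measurable_funD => //; apply: measurable_funX; exact: measurable_funM.
    - by move=> y _; rewrite lee_fin.
    apply: eq_integral => v _; rewrite -EFinM /H; congr (_ * h _)%:E.
    by rewrite exprMn mulrDr mulr1.
  transitivity (\int[leb]_v \int[leb]_x (H x v)%:E)%E.
    apply: (fubini_tonelli (m1 := leb) (m2 := leb) (fun p : CM => (H p.1 p.2)%:E)) => // p.
    by rewrite lee_fin.
  rewrite /C -ge0_integralZl//; last 3 first.
  - apply/measurable_EFinP; apply: continuous_measurable_fun => v.
    apply: cvgV; first by rewrite gt_eqF// ltr_pwDl// sqr_ge0.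
    by apply: cvgD; [exact: cvg_cst|exact: exprn_continuous].
  - by move=> v _; rewrite lee_fin invr_ge0 addr_ge0// sqr_ge0.
  - by rewrite lee_fin divr_ge0 ?expR_ge0 ?pi_ge0.
  apply: eq_integral => v _ /=.
  have v1 : 0 < 1 + v ^+ 2 by rewrite ltr_pwDl// sqr_ge0.
  pose k := Num.sqrt (1 + v ^+ 2).
  have k0 : 0 < k by rewrite sqrtr_gt0.
  have k2 : k ^+ 2 = 1 + v ^+ 2 by rewrite sqr_sqrtr// ltW.
  (* Rescaling x by k, where k^2 = 1 + v^2, leaves the one-dimensional tail. One factor 1/k appears
     here and one in the change of variable, together 1 / (1 + v^2). *)
  transitivity (\int[leb]_x ((k * pi)^-1%:E * (tail_fun b (k * x))%:E))%E.
    apply: eq_integral => x _; rewrite -EFinM; congr EFin.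
    rewrite /H /tail_fun /h -k2 normrM (gtr0_norm k0) exprMn [x ^+ 2 * _]mulrC.
    have pi0 : pi != 0 :> R by rewrite gt_eqF ?pi_gt0.
    have kn0 := lt0r_neq0 k0.
    move: (pi : R) pi0 (expR _) => p p0 e; case: (b <= _) => /=; last by rewrite !(mul0r, mulr0).
    by field; rewrite p0 kn0.
  rewrite ge0_integralZl//; last 3 first.
  - apply/measurable_EFinP; apply: (measurableT_comp (measurable_tail_fun b)).
    exact: measurable_funM.
  - by move=> x _; rewrite lee_fin /tail_fun mulr_ge0// mulr_ge0 ?ler0n ?expR_ge0.
  - by rewrite lee_fin invr_ge0 mulr_ge0 ?pi_ge0 ?ltW.
  have := @integral_lebesgue_scale R k (EFin \o tail_fun b) (lt0r_neq0 k0).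
  rewrite integral_tail_fun// => /(_ _ _)/esym IE.
  rewrite (_ : (\int[leb]_x _)%E = (k^-1 * expR (- b))%:E); last first.
    rewrite EFinM IE; last 2 first.
    - exact/measurable_EFinP.
    - by move=> x; rewrite lee_fin /tail_fun mulr_ge0// mulr_ge0 ?ler0n ?expR_ge0.
    by rewrite muleA -EFinM gtr0_norm// mulVf ?gt_eqF// mul1e.
  rewrite -!EFinM -k2; congr EFin.
  have pi0 : pi != 0 :> R by rewrite gt_eqF ?pi_gt0.
  have kn0 := lt0r_neq0 k0.
  by move: (pi : R) pi0 (expR _) => p p0 e; field; rewrite p0 kn0.
move=> a0; have := key 0 (lexx 0).
rewrite (_ : [set p | _] = setT) ?probability_setT; last first.
  by apply/seteqP; split => // p _ /=; exact: nsq_ge0.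
rewrite oppr0 expR0 => C1; rewrite key//.
by rewrite -[pi^-1]div1r EFinM -muleA -C1 mule1.
Qed.

Let laplace1 (c : R) : -1 < c ->
  (\int[normal_prob 0 (Num.sqrt 2^-1)]_x (expR (- c * x ^+ 2))%:E =
   ((Num.sqrt (1 + c))^-1)%:E)%E.
Proof.
move=> c1; have c0 : 0 < 1 + c by rewrite -ltrBlDl sub0r.
(* The exponential times the density is a multiple of a normal density whose standard deviation
   satisfies 2 s^2 = 1 / (1 + c). *)
pose s : R := Num.sqrt (2 * (1 + c))^-1.
have s0 : s != 0 by rewrite sqrtr_eq0 -ltNge invr_gt0 mulr_gt0.
have s2 : s ^+ 2 *+ 2 = (1 + c)^-1.
  rewrite sqr_sqrtr ?invr_ge0 ?mulr_ge0 ?ltW// -[LHS]mulr_natr.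
  by field; rewrite gt_eqF.
rewrite integral_normal_half//; last first.
  by apply/measurable_EFinP; apply: measurableT_comp => //; exact: measurable_funM.
transitivity (\int[leb]_x (((Num.sqrt (1 + c))^-1)%:E * (normal_pdf 0 s x)%:E))%E.
  apply: eq_integral => x _; rewrite -!EFinM; congr EFin.
  rewrite normal_pdfE// /normal_peak /normal_fun subr0 s2 -mulrnAl s2.
  rewrite sqrtrM ?invr_ge0 ?ltW// sqrtrV ?ltW//.
  have k0 : Num.sqrt (1 + c) != 0 by rewrite sqrtr_eq0 -ltNge.
  rewrite mulrCA -expRD invfM (invrK (Num.sqrt (1 + c))) -[in RHS]mulrA mulKf//.
  by congr (_ * expR _); rewrite invrK; ring.
rewrite ge0_integralZl//.
- by rewrite integral_normal_pdf mule1.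
- by apply/measurable_EFinP; exact: measurable_normal_pdf.
- by move=> x _; rewrite lee_fin normal_pdf_ge0.
Qed.

Lemma cgm_laplace (c : R) : -1 < c ->
  (\int[cgm]_p (expR (- c * nsq (r2c p)))%:E = ((1 + c)^-1)%:E)%E.
Proof.
move=> c1; have c0 : 0 < 1 + c by rewrite -ltrBlDl sub0r.
have m1 : measurable_fun [set: R] (fun x : R => (expR (- c * x ^+ 2))%:E).
  by apply/measurable_EFinP; apply: measurableT_comp => //; exact: measurable_funM.
rewrite fubini_tonelli1//; last first.
  apply/measurable_EFinP; apply: measurableT_comp => //.
  by apply: measurable_funM => //; exact: measurable_r2c_nsq.
transitivity (\int[normal_prob 0 (Num.sqrt 2^-1)]_x
    ((expR (- c * x ^+ 2))%:E * ((Num.sqrt (1 + c))^-1)%:E))%E.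
  apply: eq_integral => x _; rewrite /fubini_F /=.
  rewrite -(laplace1 c1) -ge0_integralZl//.
  by apply: eq_integral => y _; rewrite -EFinM -expRD /nsq /= mulrDr.
rewrite ge0_integralZr// laplace1// -EFinM -invfM -expr2 sqr_sqrtr// ltW//.
Qed.

End gaussian_tail.

(** * Unitary maps preserving the law of a Gaussian vector *)

Section rotation.
Context {R : realType}.
Local Notation CM := (measurableTypeR R * measurableTypeR R)%type.
Local Notation C := R[i].

Definition cvec m (z : m.-tuple CM) : 'cV[C]_m := \col_i r2c (tnth z i).

Definition act m (q : 'M[C]_m) (z : m.-tuple CM) : m.-tuple CM :=
  [tuple c2r ((q *m cvec z) i 0) | i < m].

Lemma cmeas_cvec m i j : cmeas (fun z : m.-tuple CM => cvec z i j).
Proof.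
under [fun z => _]eq_fun do rewrite mxE; apply: cmeas_r2c.
exact: measurable_tnth.
Qed.

Lemma cvec_act m (q : 'M[C]_m) z : cvec (act q z) = q *m cvec z.
Proof. by apply/colP => i; rewrite mxE tnth_mktuple c2rK. Qed.

Lemma cvec_inj m : injective (@cvec m).
Proof.
move=> y z yz; apply: eq_from_tnth => i.
by apply: (can_inj (@r2cK R)); have := congr1 (fun v : 'cV_m => v i 0) yz; rewrite !mxE.
Qed.

Lemma measurable_act m (q : 'M[C]_m) : measurable_fun [set: m.-tuple CM] (act q).
Proof.
apply/measurable_fun_tnthP => i /=.
rewrite (_ : _ \o _ = fun z => c2r ((q *m cvec z) i 0)); last first.
  by apply/funext => z /=; rewrite tnth_mktuple.
apply: measurable_c2r; apply: cmeas_mulmx => [k l|]; first exact: cmeas_cst.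
exact: cmeas_cvec.
Qed.

Definition gauss_invariant m (q : 'M[C]_m) : Prop :=
  forall F : m.-tuple CM -> \bar R,
    measurable_fun [set: m.-tuple CM] F -> (forall z, 0 <= F z)%E ->
    (\int[iid cgm m]_z F (act q z) = \int[iid cgm m]_z F z)%E.

Lemma gauss_invariantM m (q1 q2 : 'M[C]_m) :
  gauss_invariant q1 -> gauss_invariant q2 -> gauss_invariant (q1 *m q2).
Proof.
move=> i1 i2 F mF F0; apply: etrans; last exact: (i1 F mF F0).
apply: etrans; last first.
  apply: (i2 (F \o act q1)) => [|z]; last exact: F0.
  exact: (measurableT_comp mF (measurable_act q1)).
apply: eq_integral => z _ /=; congr F; apply: cvec_inj.
by rewrite !cvec_act mulmxA.
Qed.

Lemma cvec_cons m (x : CM) (z : m.-tuple CM) :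
  cvec [tuple of x :: z] = col_mx (r2c x)%:M (cvec z) :> 'cV_(1 + m).
Proof.
apply/colP => i; rewrite -(splitK i); case: (fintype.split i) => j /=.
  by rewrite col_mxEu !mxE ord1 /=; congr r2c.
rewrite col_mxEd !mxE; congr r2c.
rewrite (_ : rshift 1 j = lift ord0 j) ?tnthS//; exact: val_inj.
Qed.

Lemma cvec_cons2 m (x y : CM) (z : m.-tuple CM) :
  cvec [tuple of x :: [tuple of y :: z]] =
  (col_mx (col_mx (r2c x)%:M (r2c y)%:M) (cvec z) : 'cV[C]_((1 + 1) + m)).
Proof.
apply/(@colP _ (1 + 1 + m)) => i; rewrite -(splitK i).
case: (fintype.split i) => j; rewrite /unsplit.
  rewrite [RHS]col_mxEu -(splitK j); case: (fintype.split j) => k; rewrite /unsplit.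
    by rewrite [RHS]col_mxEu !mxE ord1 /=; congr r2c.
  by rewrite [RHS]col_mxEd !mxE ord1 /=; congr r2c.
rewrite [RHS]col_mxEd !mxE; congr r2c.
have -> : rshift (1 + 1) j = lift ord0 (lift ord0 j) :> 'I_m.+2 by exact: val_inj.
by rewrite !tnthS.
Qed.

Lemma gauss_invariant_block1 m (q : 'M[C]_m) : gauss_invariant q ->
  gauss_invariant (block_mx 1%:M 0 0 q : 'M[C]_(1 + m)).
Proof.
move=> iq F mF F0.
have mFa := measurableT_comp mF (measurable_act (block_mx 1%:M 0 0 q)).
apply: (etrans (iidS_integral cgm mFa (fun=> F0 _))).
apply: (etrans _ (esym (iidS_integral cgm mF F0))).
apply: eq_integral => x _.
apply: etrans; last first.
  apply: (iq (fun z => F [tuple of x :: z])) => [|z]; last exact: F0.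
  by apply: (measurableT_comp mF); exact: measurable_cons.
apply: eq_integral => z _; congr F; apply: cvec_inj.
rewrite cvec_act !cvec_cons cvec_act.
rewrite -[LHS]/(block_mx 1%:M 0 0 q *m col_mx (r2c x)%:M (cvec z)).
by rewrite mul_block_col !mul1mx !mul0mx addr0 add0r.
Qed.

Definition su2 (a b : C) : 'M[C]_(1 + 1) :=
  block_mx a%:M b%:M (- b^*)%:M a^*%:M.

Lemma gauss_invariant_su2 m (a b : C) : nsq a + nsq b = 1 -> b != 0 ->
  gauss_invariant (block_mx (su2 a b) 0 0 1%:M : 'M[C]_((1 + 1) + m)).
Proof.
move=> ab b0 F mF F0.
pose Q : 'M[C]_m.+2 := block_mx (su2 a b) 0 0 1%:M.
have mFa := measurableT_comp mF (measurable_act Q).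
(* Groups the first two coordinates into one integral over pairs, where SU(2) invariance applies. *)
have key G : measurable_fun [set: m.+2.-tuple CM] G -> (forall z, 0 <= G z)%E ->
   (\int[iid cgm m.+2]_z G z =
    \int[iid cgm m]_z \int[cgm \x cgm]_p G [tuple of p.1 :: [tuple of p.2 :: z]])%E.
  move=> mG G0; rewrite iidS_integral//.
  transitivity (\int[cgm]_x \int[cgm]_y \int[iid cgm m]_z
     G [tuple of x :: [tuple of y :: z]])%E.
    apply: eq_integral => x _; rewrite iidS_integral//.
    by apply: (measurableT_comp mG); exact: measurable_cons.
  have mG3 : measurable_fun [set: (CM * CM) * m.-tuple CM]
      (fun p => G [tuple of p.1.1 :: [tuple of p.1.2 :: p.2]]).
    apply: (measurableT_comp mG); apply: measurable_cons.
      exact: measurableT_comp.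
    by apply: measurable_cons => //; exact: measurableT_comp.
  transitivity (\int[cgm \x cgm]_p \int[iid cgm m]_z
     G [tuple of p.1 :: [tuple of p.2 :: z]])%E.
    apply/esym; apply: (fubini_tonelli1 (m1 := cgm) (m2 := cgm)
      (fun p => \int[iid cgm m]_z G [tuple of p.1 :: [tuple of p.2 :: z]])%E).
    - exact: (@measurable_fun_fubini_tonelli_F _ _ _ _ R (iid cgm m) _ mG3 (fun=> G0 _)).
    - by move=> p; exact: integral_ge0.
  exact: (fubini_tonelli (m1 := (cgm \x cgm)%E : probability (CM * CM)%type R) (m2 := iid cgm m) (fun p : (CM * CM) * m.-tuple CM =>
     G [tuple of p.1.1 :: [tuple of p.1.2 :: p.2]]) mG3 (fun=> G0 _)).
apply: (etrans (key _ mFa (fun=> F0 _))); apply: (etrans _ (esym (key _ mF F0))).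
apply: eq_integral => z _.
apply: etrans; last first.
  apply: (integral_cgm_su2 (F := fun p => F [tuple of p.1 :: [tuple of p.2 :: z]]) ab b0).
    apply: (measurableT_comp mF); apply: measurable_cons => //.
    by apply: measurable_cons.
  by move=> p; exact: F0.
apply: eq_integral => p _; congr F; apply: cvec_inj.
rewrite cvec_act !cvec_cons2 !c2rK mul_block_col !mul0mx mul1mx addr0 add0r.
congr (col_mx _ _); rewrite mul_block_col !mul_scalar_mx !scale_scalar_mx.
by rewrite -!raddfD.
Qed.

Lemma block_unitary m1 m2 (A : 'M[C]_m1) (B : 'M[C]_m2) :
  A \is unitarymx -> B \is unitarymx ->
  (block_mx A 0 0 B : 'M[C]_(m1 + m2)) \is unitarymx.
Proof.
move=> /unitarymxP uA /unitarymxP uB; apply/unitarymxP.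
rewrite tr_block_mx map_block_mx mulmx_block !trmx0 !map_mx0 !mulmx0 !mul0mx uA uB.
by rewrite !addr0 add0r -scalar_mx_block.
Qed.

Lemma su2_unitary (a b : C) : nsq a + nsq b = 1 -> su2 a b \is unitarymx.
Proof.
move=> ab; apply/unitarymxP.
have abE : a * a^* + b * b^* = 1 by rewrite !mulcJ -rmorphD/= ab.
have scE (z w : C) : w = z^* -> (z%:M : 'M[C]_1)^t* = w%:M.
  by move=> ->; apply/matrixP => i j; rewrite !mxE !ord1 eqxx !mulr1n.
have -> : (su2 a b)^t* = block_mx (a^*)%:M (- b)%:M (b^*)%:M a%:M.
  rewrite /su2 tr_block_mx map_block_mx (scE a a^*)// (scE b b^*)//.
  rewrite (scE (- b^*) (- b)); last first.
    by case: (b) => u v; apply/eqP; rewrite eq_complex /= opprK !eqxx.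
  by rewrite (scE a^* a) ?conjCK.
rewrite mulmx_block -!scalar_mxM -!raddfD abE.
rewrite (_ : a * - b + b * a = 0); last by ring.
rewrite (_ : - b^* * a^* + a^* * b^* = 0); last by ring.
rewrite (_ : - b^* * - b + a^* * a = 1); last by rewrite -abE; ring.
by rewrite raddf0 -scalar_mx_block.
Qed.

(** One invariant unitary per vector is enough, so Givens rotations suffice: induction brings the
    tail of [h] to a multiple of its first basis vector, and an SU(2) matrix on the first two
    coordinates removes the entry that is left. *)
Lemma rotation m (h : 'cV[C]_m.+1) : exists (q : 'M[C]_m.+1) (c : C),
  [/\ q \is unitarymx, q *m h = c *: delta_mx 0 0,
      nsq c = \sum_i nsq (h i 0) & gauss_invariant q].
Proof.
elim: m h => [|m IH] h.
  exists 1%:M, (h 0 0); split.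
  - by apply/unitarymxP; rewrite mul1mx trmx1 map_mx1.
  - by rewrite mul1mx; apply/colP => i; rewrite !mxE !ord1 eqxx mulr1.
  - by rewrite big_ord1.
  - move=> F mF F0; apply: eq_integral => z _; congr F.
    by apply: cvec_inj; rewrite cvec_act mul1mx.
have [q' [c' [uq' qh' nc' iq']]] := IH (dsubmx (h : 'cV_(1 + m.+1))).
pose Q1 : 'M[C]_(1 + m.+1) := block_mx 1%:M 0 0 q'.
have uQ1 : (Q1 : 'M[C]_m.+2) \is unitarymx.
  apply: (@block_unitary 1 m.+1 1%:M q') => //; apply/unitarymxP.
  by rewrite mul1mx trmx1 map_mx1.
have iQ1 : @gauss_invariant m.+2 Q1 by exact: (@gauss_invariant_block1 m.+1 q' iq').
pose h0 := h 0 0.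
have Q1h : Q1 *m (h : 'cV_(1 + m.+1)) = col_mx h0%:M (c' *: delta_mx 0 0).
  rewrite -[h in LHS](@vsubmxK _ 1 m.+1 1) /Q1 mul_block_col !mul0mx mul1mx addr0 add0r qh'.
  congr (col_mx _ _); apply/matrixP => i j; rewrite !mxE !ord1 eqxx mulr1n.
  by congr (h _ _); exact: val_inj.
have sumh : \sum_i nsq (h i 0) = nsq h0 + nsq c'.
  rewrite big_ord_recl nc'; congr (_ + _); apply: eq_bigr => i _.
  by rewrite mxE; congr (nsq (h _ _)); exact: val_inj.
(* The shears behind [su2] divide by the conjugate of b, so b must be nonzero; with a zero tail no
   second rotation is made. *)
have [c'0|c'0] := eqVneq c' 0.
  exists Q1, h0; split => //.
    rewrite [LHS]Q1h c'0 scale0r; apply/(@colP _ (1 + m.+1)) => i; rewrite -(splitK i).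
    case: (fintype.split i) => j; rewrite /unsplit.
      by rewrite [LHS]col_mxEu !mxE ord1 eqxx mulr1.
    by rewrite [LHS]col_mxEd !mxE mulr0.
  by rewrite sumh c'0 nsq0 addr0.
pose N := Num.sqrt (nsq h0 + nsq c').
have N0 : 0 < nsq h0 + nsq c'.
  by rewrite ltr_wpDl ?nsq_ge0// lt0r nsq_ge0 nsq_eq0 c'0.
have Ngt0 : 0 < N by rewrite sqrtr_gt0.
have NC0 : N%:C != 0 by rewrite eq_complex /= negb_and gt_eqF.
(* The row (a, b) is the normalised conjugate of (h0, c'): it pairs with (h0, c') to N, and the
   second row of [su2] annihilates that vector. *)
pose a := h0^* / N%:C; pose b := c'^* / N%:C.
have nV : nsq (N%:C^-1) = (nsq h0 + nsq c')^-1.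
  by rewrite -fmorphV nsq_real exprVn sqr_sqrtr// ltW.
have ab : nsq a + nsq b = 1.
  by rewrite !nsqM !nsq_conj nV -mulrDl mulfV// gt_eqF.
have b0 : b != 0 by rewrite mulf_neq0 ?conjc_eq0// invr_eq0.
pose Q2 : 'M[C]_((1 + 1) + m) := block_mx (su2 a b) 0 0 1%:M.
have uQ2 : (Q2 : 'M[C]_m.+2) \is unitarymx.
  apply: (@block_unitary (1 + 1) m (su2 a b) 1%:M); first exact: su2_unitary.
  by apply/unitarymxP; rewrite mul1mx trmx1 map_mx1.
have iQ2 : @gauss_invariant m.+2 Q2 by exact: (@gauss_invariant_su2 m a b ab b0).
exists ((Q2 : 'M[C]_m.+2) *m (Q1 : 'M[C]_m.+2)), N%:C; split.
- exact: (@mul_unitarymx _ m.+2 m.+2 m.+2 _ _ uQ2 uQ1).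
- have Q1hE : Q1 *m h = (col_mx (col_mx h0%:M c'%:M) 0 : 'cV[C]_(1 + 1 + m)).
    rewrite [LHS]Q1h.
    apply/(@colP _ (1 + 1 + m)) => i; rewrite -(splitK i).
    case: (fintype.split i) => j; rewrite /unsplit.
      rewrite [RHS]col_mxEu -(splitK j).
      case: (fintype.split j) => k; rewrite /unsplit.
        rewrite [RHS]col_mxEu.
        have -> : lshift m (lshift 1 k) = lshift m.+1 k :> 'I_m.+2 by exact: val_inj.
        by rewrite [LHS]col_mxEu.
      rewrite [RHS]col_mxEd.
      have -> : lshift m (rshift 1 k) = rshift 1 (0 : 'I_m.+1) :> 'I_m.+2.
        by apply: val_inj; rewrite ord1.
      by rewrite [LHS]col_mxEd !mxE ord1 !eqxx mulr1.
    rewrite [RHS]col_mxEd.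
    have -> : rshift (1 + 1) j = rshift 1 (lift ord0 j) :> 'I_m.+2 by exact: val_inj.
    by rewrite [LHS]col_mxEd !mxE mulr0.
  rewrite -mulmxA Q1hE [LHS](@mul_block_col _ (1 + 1) m (1 + 1) m 1) !mul0mx mul1mx addr0 add0r [su2 a b *m _]mul_block_col.
  rewrite !mul_scalar_mx !scale_scalar_mx -!raddfD /=.
  have -> : a * h0 + b * c' = N%:C.
    rewrite /a /b ![_ / _ * _]mulrAC -mulrDl ![_^* * _]mulrC !mulcJ -rmorphD/=.
    by rewrite -[X in X%:C](sqr_sqrtr (ltW N0)) -/N rmorphXn/= expr2 mulfK.
  have -> : - b^* * h0 + a^* * c' = 0.
    rewrite /a /b !rmorphM !fmorphV /= !conjCK.
    by rewrite mulNr ![_ / _ * _]mulrAC [c' * _]mulrC addNr.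
  apply/(@colP _ (1 + 1 + m)) => i; rewrite -(splitK i).
  case: (fintype.split i) => j; rewrite /unsplit.
    rewrite [LHS]col_mxEu -(splitK j); case: (fintype.split j) => k; rewrite /unsplit.
      by rewrite [LHS]col_mxEu !mxE !ord1 !eqxx mulr1.
    by rewrite [LHS]col_mxEd !mxE !ord1 mul0rn mulr0.
  by rewrite [LHS]col_mxEd !mxE mulr0.
- by rewrite nsq_real sqr_sqrtr ?sumh// ltW.
- exact: (@gauss_invariantM m.+2 _ _ iQ2 iQ1).
Qed.

End rotation.

(** * Squared Euclidean norm *)

Section vector_norm.
Context {R : realType}.
Local Notation C := R[i].

Definition nrm2 m (v : 'cV[C]_m) : R := \sum_(i < m) nsq (v i 0).

Lemma nrm2_ge0 m (v : 'cV[C]_m) : 0 <= nrm2 v.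
Proof. by apply: sumr_ge0 => i _; exact: nsq_ge0. Qed.

Lemma nrm2E m (v : 'cV[C]_m) : (v^t* *m v) 0 0 = (nrm2 v)%:C.
Proof.
rewrite mxE rmorph_sum; apply: eq_bigr => i _.
by rewrite !mxE mulrC mulcJ.
Qed.

Lemma nrm2_l2norm m (v : 'cV[C]_m) : l2norm v = Num.sqrt (nrm2 v).
Proof. by congr Num.sqrt; apply: eq_bigr => i _; rewrite cabs_sqr. Qed.

Lemma l2norm_sqr m (v : 'cV[C]_m) : l2norm v ^+ 2 = nrm2 v.
Proof. by rewrite nrm2_l2norm sqr_sqrtr// nrm2_ge0. Qed.

Lemma mulmx_conjtr m n p (A : 'M[C]_(m, n)) (B : 'M[C]_(n, p)) :
  (A *m B)^t* = B^t* *m A^t*.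
Proof. by rewrite trmx_mul map_mxM. Qed.

Lemma nrm2_isometry m n (Q : 'M[C]_(m, n)) (v : 'cV[C]_n) :
  Q^t* *m Q = 1%:M -> nrm2 (Q *m v) = nrm2 v.
Proof.
move=> QQ; apply: (@complexI R); rewrite -!nrm2E mulmx_conjtr.
by rewrite -mulmxA (mulmxA (Q^t*)) QQ mul1mx.
Qed.

Lemma unitary_conjtr_mul m (Q : 'M[C]_m) : Q \is unitarymx -> Q^t* *m Q = 1%:M.
Proof. by move=> /unitarymxP QQ; apply: mulmx1C. Qed.

Lemma nrm2_unitary m (Q : 'M[C]_m) (v : 'cV[C]_m) :
  Q \is unitarymx -> nrm2 (Q *m v) = nrm2 v.
Proof. by move=> uQ; exact/nrm2_isometry/unitary_conjtr_mul. Qed.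

Lemma nrm2_eq0 m (v : 'cV[C]_m) : (nrm2 v == 0) = (v == 0).
Proof.
rewrite psumr_eq0; last by move=> i _; exact: nsq_ge0.
apply/allP/eqP => [h|-> i _]; last by rewrite mxE nsq0 eqxx.
apply/colP => i; rewrite mxE; apply/eqP; rewrite -nsq_eq0.
by have := h i; rewrite mem_index_enum => /(_ isT).
Qed.

Lemma nrm2_gt0 m (v : 'cV[C]_m) : (0 < nrm2 v) = (v != 0).
Proof. by rewrite lt0r nrm2_ge0 nrm2_eq0 andbT. Qed.

Lemma nrm2_conj m (v : 'cV[C]_m) : nrm2 (map_mx Num.conj v) = nrm2 v.
Proof. by apply: eq_bigr => i _; rewrite mxE nsq_conj. Qed.

Lemma nrm2Z m (c : C) (v : 'cV[C]_m) : nrm2 (c *: v) = nsq c * nrm2 v.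
Proof. by rewrite mulr_sumr; apply: eq_bigr => i _; rewrite mxE nsqM. Qed.

End vector_norm.

(** * Linear forms in Gaussian vectors *)

Lemma indicb (T : Type) (R : pzRingType) (P : pred T) x :
  \1_[set x | P x] x = (P x)%:R :> R.
Proof. by rewrite indicE mem_setE. Qed.

Lemma integral_cst_prob d (T : measurableType d) (R : realType) (P : probability T R)
  (c : \bar R) : (\int[P]_x c = c)%E.
Proof. by rewrite integral_cst// [X in (_ * X)%E]probability_setT mule1. Qed.

Section linear_forms.
Context {R : realType}.
Local Notation CM := (measurableTypeR R * measurableTypeR R)%type.
Local Notation C := R[i].

(** Bilinear, with no conjugation of [h]: the form in which a determinant depends on one of its
    columns. *)
Definition dotc m (h : 'cV[C]_m) (z : m.-tuple CM) : C := \sum_i h i 0 * r2c (tnth z i).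

Lemma cmeas_dotc m (h : 'cV[C]_m) : cmeas (dotc h).
Proof.
apply: cmeas_sum => i; apply: cmeasM; first exact: cmeas_cst.
by apply: cmeas_r2c; exact: measurable_tnth.
Qed.

Lemma dotcE m (h : 'cV[C]_m) z : dotc h z = (h^T *m cvec z) 0 0.
Proof. by rewrite mxE; apply: eq_bigr => i _; rewrite !mxE. Qed.

Lemma dotc_rotation_lin m (h : 'cV[C]_m.+1) : exists (q : 'M[C]_m.+1) (c : C),
  [/\ q \is unitarymx, gauss_invariant q, nsq c = nrm2 h &
     forall z, dotc h z = c * r2c (tnth (act q z) ord0)].
Proof.
(* The conjugate of [h] is rotated because h^T is the adjoint of that conjugate. *)
have [q [c [uq qh nc iq]]] := rotation (map_mx Num.conj h).
exists q, c^*; split => //; first by rewrite nsq_conj nc -[RHS]nrm2_conj.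
move=> z.
have hE : h^T = c^* *: ((delta_mx 0 0 : 'cV[C]_m.+1)^t* *m q).
  have -> : h^T = (map_mx Num.conj h)^t*.
    by apply/matrixP => i j; rewrite !mxE conjCK.
  have -> : map_mx Num.conj h = q^t* *m (c *: delta_mx 0 0).
    by rewrite -qh mulmxA unitary_conjtr_mul// mul1mx.
  rewrite mulmx_conjtr trmxCK scalemxAl; congr (_ *m _).
  by apply/matrixP => i j; rewrite !mxE rmorphM.
rewrite dotcE hE -scalemxAl mxE; congr (_ * _).
rewrite -mulmxA -cvec_act mxE big_ord_recl big1 ?addr0.
  by rewrite !mxE !eqxx conjC1 mul1r.
by move=> i _; rewrite !mxE /= conjC0 mul0r.
Qed.

Lemma dotc_rotation m (h : 'cV[C]_m.+1) : exists q : 'M[C]_m.+1,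
  [/\ q \is unitarymx, gauss_invariant q &
     forall z, nsq (dotc h z) = nrm2 h * nsq (r2c (tnth (act q z) ord0))].
Proof.
have [q [c [uq iq nc hq]]] := dotc_rotation_lin h; exists q; split => // z.
by rewrite hq nsqM nc.
Qed.

Lemma tnth_cons0 (T : Type) m (x : T) (z : m.-tuple T) : tnth [tuple of x :: z] ord0 = x.
Proof. by []. Qed.

Lemma integral_dotc m (h : 'cV[C]_m) (f : R -> \bar R) :
  measurable_fun [set: R] f -> (forall x, 0 <= f x)%E ->
  (\int[iid cgm m]_z f (nsq (dotc h z)) = \int[cgm]_p f (nrm2 h * nsq (r2c p))%R)%E.
Proof.
move=> mf f0; case: m h => [|m] h.
  rewrite /nrm2 big_ord0; under eq_integral do rewrite /dotc big_ord0 nsq0.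
  under [RHS]eq_integral do rewrite mul0r.
  by rewrite !integral_cst_prob.
have [q [uq iq hq]] := dotc_rotation h.
under eq_integral do rewrite hq.
have mF : measurable_fun [set: m.+1.-tuple CM]
    (fun z => f (nrm2 h * nsq (r2c (tnth z ord0)))).
  apply: (measurableT_comp mf); apply: measurable_funM => //.
  by apply: measurable_nsq; apply: cmeas_r2c; exact: measurable_tnth.
rewrite (iq (fun z => f (nrm2 h * nsq (r2c (tnth z ord0)))))//.
rewrite (iidS_integral cgm mF)//; apply: eq_integral => p _.
by apply: (etrans _ (integral_cst_prob (iid cgm m) _)); exact: eq_integral.
Qed.

(** Unlike [integral_dotc], this keeps the complex value and not only its modulus, as needed when
    several such forms are combined linearly. *)
Lemma integral_dotc_lin m (h : 'cV[C]_m) : exists2 c : C, nsq c = nrm2 h &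
  forall F : CM -> \bar R, measurable_fun [set: CM] F -> (forall x, 0 <= F x)%E ->
  (\int[iid cgm m]_z F (c2r (dotc h z)) = \int[cgm]_p F (c2r (c * r2c p)%R))%E.
Proof.
case: m h => [|m] h.
  exists 0; first by rewrite nsq0 /nrm2 big_ord0.
  move=> F mF F0; under eq_integral do rewrite /dotc big_ord0.
  under [RHS]eq_integral do rewrite mul0r.
  by rewrite !integral_cst_prob.
have [q [c [uq iq nc hq]]] := dotc_rotation_lin h; exists c => // F mF F0.
under eq_integral do rewrite hq.
have mFc : measurable_fun [set: m.+1.-tuple CM]
    (fun z => F (c2r (c * r2c (tnth z ord0)))).
  apply: (measurableT_comp mF); apply: measurable_c2r; apply: cmeasM.
    exact: cmeas_cst.
  by apply: cmeas_r2c; exact: measurable_tnth.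
rewrite (iq (fun z => F (c2r (c * r2c (tnth z ord0)))))//.
rewrite (iidS_integral cgm mFc)//; apply: eq_integral => p _.
by apply: (etrans _ (integral_cst_prob (iid cgm m) _)); exact: eq_integral.
Qed.

Lemma cgm_ball (rho : R) : 0 <= rho -> (cgm [set p | nsq (r2c p) < rho]%R <= rho%:E)%E.
Proof.
move=> rho0; rewrite (_ : [set p | _] = ~` [set p | rho <= nsq (r2c p)]); last first.
  by apply/seteqP; split => p /=; rewrite ltNge => /negP.
rewrite probability_setC; last first.
  rewrite (_ : [set p | _] = (fun p : CM => nsq (r2c p)) @^-1` `[rho, +oo[%classic).
    by rewrite -[X in measurable X]setTI; exact: measurable_r2c_nsq.
  by apply/seteqP; split => p /=; rewrite in_itv/= andbT.
rewrite cgm_tail// -EFinB lee_fin lerBlDl -lerBlDr.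
by rewrite (le_trans _ (expR_ge1Dx _))// addrC.
Qed.

Lemma measurable_dotc_lt m (h : 'cV[C]_m) (a : R) :
  measurable [set z | nsq (dotc h z) < a].
Proof.
rewrite (_ : [set z | _] = (fun z => nsq (dotc h z)) @^-1` `]-oo, a[%classic).
  rewrite -[X in measurable X]setTI; apply: measurable_nsq => //; exact: cmeas_dotc.
by apply/seteqP; split => p /=; rewrite in_itv.
Qed.

(** The bound 1 - exp(-rho) <= rho, rescaled. The strict inequality makes the event empty when [h]
    is zero, so the bound is uniform in [h]. *)
Lemma dotc_ball m (h : 'cV[C]_m) (rho : R) : 0 <= rho ->
  (iid cgm m [set z | nsq (dotc h z) < rho * nrm2 h]%R <= rho%:E)%E.
Proof.
move=> rho0.
rewrite -integral_prob_setT; last exact: measurable_dotc_lt.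
have mf : measurable_fun [set: R] (fun x : R => (\1_[set x | x < rho * nrm2 h] x : R)%:E).
  apply/measurable_EFinP; apply: measurable_indic.
  have -> : [set x : R | x < rho * nrm2 h] = `]-oo, (rho * nrm2 h)[%classic.
    by apply/seteqP; split => p /=; rewrite in_itv.
  exact: measurable_itv.
rewrite (_ : (\int[_]_x _)%E =
  (\int[iid cgm m]_z (\1_[set x | x < rho * nrm2 h] (nsq (dotc h z)))%:E)%E)//.
rewrite (integral_dotc h mf); last by move=> x; rewrite lee_fin.
apply: (le_trans _ (cgm_ball rho0)).
have mS : measurable [set p : CM | nsq (r2c p) < rho].
  rewrite (_ : [set p | _] = (fun p : CM => nsq (r2c p)) @^-1` `]-oo, rho[%classic).
    by rewrite -[X in measurable X]setTI; exact: measurable_r2c_nsq.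
  by apply/seteqP; split => p /=; rewrite in_itv.
rewrite -integral_prob_setT//; apply: ge0_le_integral => //.
- apply: (measurableT_comp mf); apply: measurable_funM => //; exact: measurable_r2c_nsq.
- by apply/measurable_EFinP; exact: measurable_indic.
move=> p _; rewrite lee_fin !indicb ler_nat.
have [h0|h0] := eqVneq (nrm2 h) 0; first by rewrite h0 !(mulr0, mul0r) ltxx.
by rewrite [rho * _]mulrC ltr_pM2l// lt0r h0 nrm2_ge0.
Qed.

Lemma dotc_eq0 m (h : 'cV[C]_m) : h != 0 ->
  iid cgm m [set z | dotc h z = 0] = 0%E.
Proof.
move=> h0; apply/eqP; rewrite eq_le measure_ge0 andbT.
apply/lee_addgt0Pr => e e0; rewrite add0e.
apply: le_trans (dotc_ball h (ltW e0)); apply: le_measure; rewrite ?inE.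
- rewrite (_ : [set z | _] = (fun z => nsq (dotc h z)) @^-1` [set 0]).
    rewrite -[X in measurable X]setTI; apply: measurable_nsq => //; exact: cmeas_dotc.
  by apply/seteqP; split => z /= => [->|/eqP]; rewrite ?nsq0// nsq_eq0 => /eqP.
- exact: measurable_dotc_lt.
- by move=> z /= ->; rewrite nsq0 mulr_gt0// nrm2_gt0.
Qed.

Lemma iid_laplace m (c : R) : -1 < c ->
  (\int[iid cgm m]_z (expR (- c * nrm2 (cvec z)))%:E = ((1 + c)^-1 ^+ m)%:E)%E.
Proof.
move=> c1; have c0 : 0 < 1 + c by rewrite -ltrBlDl sub0r.
have mE n : measurable_fun [set: n.-tuple CM] (fun z => (expR (- c * nrm2 (cvec z)))%:E).
  apply/measurable_EFinP; apply: measurableT_comp => //; apply: measurable_funM => //.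
  by apply: measurable_sum => i; apply: measurable_nsq; exact: cmeas_cvec.
elim: m => [|m IH].
  apply: (etrans _ (integral_cst_prob (iid cgm 0) _)); apply: eq_integral => z _.
  by rewrite /nrm2 big_ord0 mulr0 expR0 expr0.
rewrite (iidS_integral cgm (mE _)); last by move=> z; rewrite lee_fin expR_ge0.
transitivity (\int[cgm]_p ((expR (- c * nsq (r2c p)))%:E * ((1 + c)^-1 ^+ m)%:E))%E.
  apply: eq_integral => p _; rewrite -IH -ge0_integralZl//.
    apply: eq_integral => z _; rewrite -EFinM -expRD -mulrDr; congr (expR (_ * _))%:E.
    rewrite /nrm2 big_ord_recl !mxE /=; congr (_ + _).
    by apply: eq_bigr => i _; rewrite !mxE tnthS.
  exact: mE.
rewrite ge0_integralZr//.
- by rewrite cgm_laplace// exprS.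
- apply/measurable_EFinP; apply: measurableT_comp => //; apply: measurable_funM => //.
  exact: measurable_r2c_nsq.
- by rewrite lee_fin exprn_ge0// invr_ge0 ltW.
Qed.

(** With [h] rotated to the first axis the event reads |z_0|^2 >= c s, where s is the squared norm
    of the other m coordinates and c = b / (1 - b). Given these, its probability is exp(-c s), and
    the Laplace transform averages this to (1 + c)^-m = (1 - b)^m. *)
Lemma dotc_sphere m (h : 'cV[C]_m.+1) (b : R) : 0 <= b -> b < 1 ->
  (((1 - b) ^+ m)%:E <=
   iid cgm m.+1 [set z | b * nrm2 h * nrm2 (cvec z) <= nsq (dotc h z)]%R)%E.
Proof.
move=> b0 b1.
have b10 : 0 < 1 - b by rewrite subr_gt0.
pose c := b / (1 - b).
have cge0 : 0 <= c by rewrite divr_ge0// ltW.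
have [q [uq iq hq]] := dotc_rotation h.
pose S := [set z : m.+1.-tuple CM | b * nrm2 (cvec z) <= nsq (r2c (tnth z ord0))].
have mdiff d (T : measurableType d) (f g : T -> R) : measurable_fun [set: T] f ->
    measurable_fun [set: T] g -> measurable [set z | f z <= g z].
  move=> mf mg; rewrite -[X in measurable X]setTI.
  have := measurable_fun_ler mf mg => /(_ measurableT [set true]).
  rewrite (_ : _ @^-1` _ = [set z | f z <= g z]); first by apply.
  by apply/seteqP; split.
have mn n : measurable_fun [set: n.-tuple CM] (fun z => nrm2 (cvec z)).
  by apply: measurable_sum => i; apply: measurable_nsq; exact: cmeas_cvec.
have m0 n (i : 'I_n) : measurable_fun [set: n.-tuple CM] (fun z => nsq (r2c (tnth z i))).
  by apply: measurable_nsq; apply: cmeas_r2c; exact: measurable_tnth.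
have mbn : measurable_fun [set: m.+1.-tuple CM] (fun z => b * nrm2 (cvec z)).
  by apply: measurable_funM => //; exact: mn.
have mbhn : measurable_fun [set: m.+1.-tuple CM] (fun z => b * nrm2 h * nrm2 (cvec z)).
  by apply: measurable_funM => //; exact: mn.
have mS : measurable S by apply: mdiff => //; exact: m0.
have mI : measurable_fun [set: m.+1.-tuple CM] (fun z => (\1_S z : R)%:E).
  by apply/measurable_EFinP; exact: measurable_indic.
apply: (@le_trans _ _ (iid cgm m.+1 S)); last first.
  rewrite -(@integral_prob_setT _ _ _ _ S)//.
  rewrite -(iq (fun z => (\1_S z)%:E))//.
  rewrite -integral_prob_setT; last first.
    apply: mdiff => //.
    by apply: measurable_nsq; exact: cmeas_dotc.
  apply: ge0_le_integral => //.
  - exact: (measurableT_comp mI (measurable_act q)).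
  - apply/measurable_EFinP; apply: measurable_indic; apply: mdiff => //.
    by apply: measurable_nsq; exact: cmeas_dotc.
  move=> z _; rewrite lee_fin /S !indicb ler_nat.
  case: (boolP (_ <= _)) => //; rewrite cvec_act nrm2_unitary// => le1.
  by rewrite hq mulrAC mulrC ler_wpM2l ?nrm2_ge0.
rewrite -(@integral_prob_setT _ _ _ _ S)// (iidS_integral2 cgm mI)//.
have -> : ((1 - b) ^+ m)%:E = (\int[iid cgm m]_z (expR (- c * nrm2 (cvec z)))%:E)%E.
  rewrite iid_laplace; last by rewrite (lt_le_trans _ cge0)// ltrN10.
  congr (_ ^+ _)%:E; rewrite /c; field.
  by rewrite gt_eqF//= subrK oner_eq0.
rewrite le_eqVlt; apply/orP; left; apply/eqP; apply: eq_integral => z _.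
transitivity (cgm [set p | c * nrm2 (cvec z) <= nsq (r2c p)]).
  by rewrite cgm_tail ?mulNr// mulr_ge0// nrm2_ge0.
rewrite -integral_prob_setT; last by apply: mdiff => //; exact: measurable_r2c_nsq.
apply: eq_integral => p _; rewrite /S !indicb; congr (_%:R)%:E.
rewrite tnth_cons0 /nrm2 big_ord_recl !mxE tnth_cons0.
have -> : \sum_(i < m) nsq (cvec [tuple of p :: z] (lift ord0 i) 0) = nrm2 (cvec z).
  by apply: eq_bigr => i _; rewrite !mxE tnthS.
rewrite /c mulrAC ler_pdivrMr// [b * (_ + _)]mulrDr -lerBrDl.
by congr (_ <= _); ring.
Qed.

(** From 1 + q/100 <= exp(q/100) and the Laplace transform at -1/100, the second moment E satisfies
    1 + E/100 <= 100/99. *)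
Lemma integral_nsq_le : (\int[cgm]_p (nsq (r2c p))%:E <= ((100 : R) / 99)%:E)%E.
Proof.
have m1 : measurable_fun [set: CM] (fun p => (nsq (r2c p))%:E).
  by apply/measurable_EFinP; exact: measurable_r2c_nsq.
have h : (\int[cgm]_p (1 + (100^-1)%R%:E * (nsq (r2c p))%:E) <= ((100 : R) / 99)%:E)%E.
  have -> : ((100 : R) / 99)%:E = (\int[cgm]_p (expR (- (- 100^-1) * nsq (r2c p)))%:E)%E.
    rewrite cgm_laplace; last by lra.
    by congr EFin; field.
  apply: ge0_le_integral => //.
  - by move=> p _; rewrite adde_ge0// mule_ge0// lee_fin// nsq_ge0.
  - apply: emeasurable_funD => //; exact: emeasurable_funM.
  - apply/measurable_EFinP; apply: measurableT_comp => //.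
    by apply: measurable_funM => //; exact: measurable_r2c_nsq.
  - by move=> p _; rewrite -EFinM -EFinD lee_fin opprK expR_ge1Dx.
rewrite ge0_integralD// in h; last 2 first.
- by move=> p _; rewrite mule_ge0// lee_fin// nsq_ge0.
- exact: emeasurable_funM.
rewrite integral_cst_prob ge0_integralZl// in h; last first.
- by move=> p _; rewrite lee_fin nsq_ge0.
move: h; case: (integral _ _ _) => [x| |].
- by rewrite -EFinM -EFinD !lee_fin; lra.
- by rewrite mulry gtr0_sg// mul1e.
- by rewrite leNye.
Qed.

End linear_forms.

(** * Matrices with independent entries, as tuples of tuples *)

Section nested_iid.
Context d (T : measurableType d) (R : realType).

Definition box2 m n (B : 'I_m -> 'I_n -> set T) : set (m.-tuple (n.-tuple T)) :=
  [set z | forall j i, B j i (tnth (tnth z j) i)].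

Definition boxes n : set (set (n.-tuple T)) :=
  [set A | exists2 B : 'I_n -> set T, (forall i, measurable (B i)) & A = box B].

Lemma measurable_boxes n : @measurable _ (n.-tuple T) = <<s @boxes n >>.
Proof.
apply/seteqP; split; last first.
  apply: smallest_sub; first exact: sigma_algebra_measurable.
  by move=> _ [B mB ->]; exact: measurable_box.
apply: smallest_sub; first exact: smallest_sigma_algebra.
rewrite -bigcup_seq => A [i _ [B mB <-]]; rewrite setTI.
apply: sub_sigma_algebra; exists (fun j => if j == i then B else setT).
  by move=> j; case: ifP.
apply/seteqP; split => z /=; first by move=> Bz j; case: eqP => // ->.
by move=> /(_ i); rewrite eqxx.
Qed.

Lemma iid2_unique (mu : probability T R) m n
    (nu : probability (m.-tuple (n.-tuple T)) R) :
  (forall B : 'I_m -> 'I_n -> set T, (forall j i, measurable (B j i)) ->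
     nu (box2 B) = \prod_(j < m) \prod_(i < n) mu (B j i))%E ->
  forall A, measurable A -> nu A = iid (iid mu n) m A.
Proof.
move=> nuE; apply: (iid_unique (G := @boxes n)).
- exact: measurable_boxes.
- move=> _ _ [B mB ->] [B' mB' ->]; exists (fun i => B i `&` B' i).
    by move=> i; exact: measurableI.
  apply/seteqP; split => z /=; first by move=> [h h'] i; split.
  by move=> h; split => i; case: (h i).
- by exists (fun=> setT) => //; apply/seteqP; split.
move=> A Abox.
have /choice[B BA] : forall j, exists B : 'I_n -> set T,
    (forall i, measurable (B i)) /\ A j = box B.
  by move=> j; have [B mB AB] := Abox j; exists B.
have mB j i : measurable (B j i) by have [] := BA j.
transitivity (nu (box2 B)).
  congr (nu _); apply/seteqP; split => z /= h j.
    by move=> i; have := h j; rewrite (BA j).2; exact.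
  by rewrite (BA j).2; exact: h.
rewrite nuE//; apply: eq_bigr => j _.
by rewrite (BA j).2; apply/esym/iid_box.
Qed.

Lemma iid2_box (mu : probability T R) m n (B : 'I_m -> 'I_n -> set T) :
  (forall j i, measurable (B j i)) ->
  (iid (iid mu n) m (box2 B) = \prod_(j < m) \prod_(i < n) mu (B j i))%E.
Proof.
move=> mB; transitivity (iid (iid mu n) m (box (fun j => box (B j)))) => //.
rewrite iid_box; last by move=> j; exact: measurable_box.
by apply: eq_bigr => j _; exact: iid_box.
Qed.

Definition tr_tuple m n (z : m.-tuple (n.-tuple T)) : n.-tuple (m.-tuple T) :=
  [tuple [tuple tnth (tnth z j) i | j < m] | i < n].

Lemma measurable_tr_tuple m n : measurable_fun [set: m.-tuple (n.-tuple T)] (@tr_tuple m n).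
Proof.
apply/measurable_fun_tnthP => i; apply/measurable_fun_tnthP => j /=.
rewrite (_ : _ \o _ = (fun x : n.-tuple T => tnth x i) \o (@tnth _ (n.-tuple T) ^~ j)).
  by apply: measurableT_comp; exact: measurable_tnth.
by apply/funext => z /=; rewrite !tnth_mktuple.
Qed.

(** The product over rows and columns can be taken in either order; this lets a rotation act on rows
    although the tuple lists columns. *)
Lemma iid_tr (mu : probability T R) m n A : measurable A ->
  iid (iid mu n) m (@tr_tuple m n @^-1` A) = iid (iid mu m) n A.
Proof.
move=> mA.
apply: (@iid2_unique mu n m (law (iid (iid mu n) m) (@measurable_tr_tuple m n))) => // B mB.
rewrite exchange_big -(@iid2_box mu m n (fun j i => B i j))//.
congr (iid (iid mu n) m _).
apply/seteqP; split => z /= h i j.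
  by have := h j i; rewrite !tnth_mktuple.
by rewrite !tnth_mktuple; exact: h.
Qed.

End nested_iid.

Section two_sided.
Context d d' (T : measurableType d) (W : measurableType d') (R : realType).

(** The scheme of both tail bounds. [S] is a test with random data w: a bad z passes it with
    probability at least c, while for fixed w few z pass it, and Tonelli compares the two counts. *)
Lemma two_sided (P : probability T R) (Q : probability W R) (S : set (T * W))
    (B : set T) (c : R) : measurable S -> measurable B -> 0 <= c ->
  (forall z, B z -> (c%:E <= Q (xsection S z))%E) ->
  (c%:E * P B <= \int[Q]_w P (ysection S w))%E.
Proof.
move=> mS mB c0 BS.
have mI : measurable_fun [set: T * W] (fun p => (\1_S p : R)%:E).
  by apply/measurable_EFinP; exact: measurable_indic.
have -> : (\int[Q]_w P (ysection S w) = \int[Q]_w \int[P]_z (\1_S (z, w))%:E)%E.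
  apply: eq_integral => w _; rewrite -integral_prob_setT; last exact: measurable_ysection.
  by apply: eq_integral => z _; rewrite !indicE mem_ysection.
rewrite -(fubini_tonelli (m1 := P) (m2 := Q) _ mI); last by move=> p; rewrite lee_fin.
rewrite -integral_prob_setT// -ge0_integralZl//; last first.
  by apply/measurable_EFinP; exact: measurable_indic.
apply: ge0_le_integral => //.
- by move=> z _; rewrite mule_ge0// lee_fin.
- apply: emeasurable_funM => //; apply/measurable_EFinP; exact: measurable_indic.
- exact: (@measurable_fun_fubini_tonelli_F _ _ _ _ R Q _ mI (fun=> _)).
move=> z _; rewrite indicE; case: (boolP (z \in B)) => [|_]; last first.
  by rewrite mule0; apply: integral_ge0 => w _; rewrite lee_fin.
rewrite inE mule1 => /BS; congr (_ <= _)%E.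
rewrite -integral_prob_setT; last exact: measurable_xsection.
by apply: eq_integral => w _; rewrite !indicE mem_xsection.
Qed.

End two_sided.

(** * Measurability through rational test vectors *)

Section rational_density.
Context {R : realType}.
Local Notation C := R[i].

Lemma rat_cvg (x : R) : exists q : nat -> rat, ratr (q k) @[k --> \oo] --> x.
Proof.
have /choice[q qE] : forall k : nat, exists q : rat, x < ratr q < x + k.+1%:R^-1.
  move=> k; have [|q] := @rat_in_itvoo R x (x + k.+1%:R^-1); first by rewrite ltrDl invr_gt0.
  by rewrite in_itv /= => h; exists q.
exists q; apply: (@squeeze_cvgr _ _ _ _ (cst x) (fun k => x + k.+1%:R^-1)).
- by near=> k; have /andP[/ltW -> /ltW ->] := qE k.
- exact: cvg_cst.
- rewrite -[X in _ --> X]addr0; apply: cvgD; first exact: cvg_cst.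
  exact: cvg_harmonic.
Unshelve. all: by end_near. Qed.

Definition ccvg (z : nat -> C) (l : C) : Prop :=
  (complex.Re (z k) @[k --> \oo] --> complex.Re l) /\
  (complex.Im (z k) @[k --> \oo] --> complex.Im l).

Lemma ccvgD z w l m : ccvg z l -> ccvg w m -> ccvg (fun k => z k + w k) (l + m).
Proof.
move=> [z1 z2] [w1 w2]; split; under eq_fun do rewrite raddfD/=; rewrite raddfD/=; exact: cvgD.
Qed.

Lemma ccvgM z w l m : ccvg z l -> ccvg w m -> ccvg (fun k => z k * w k) (l * m).
Proof.
move=> [z1 z2] [w1 w2]; split.
  rewrite (_ : (fun k => _) = (fun k => complex.Re (z k) * complex.Re (w k)
     - complex.Im (z k) * complex.Im (w k))); last first.
    by apply/funext => k; case: (z k) (w k) => [a b] [u v].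
  rewrite (_ : complex.Re _ = complex.Re l * complex.Re m - complex.Im l * complex.Im m).
    by apply: cvgB; exact: cvgM.
  by case: (l) (m) => [a b] [u v].
rewrite (_ : (fun k => _) = (fun k => complex.Re (z k) * complex.Im (w k)
   + complex.Im (z k) * complex.Re (w k))); last first.
  by apply/funext => k; case: (z k) (w k) => [a b] [u v].
rewrite (_ : complex.Im _ = complex.Re l * complex.Im m + complex.Im l * complex.Re m).
  by apply: cvgD; exact: cvgM.
by case: (l) (m) => [a b] [u v].
Qed.

Lemma ccvg_cst c : ccvg (fun=> c) c.
Proof. by split; exact: cvg_cst. Qed.

Lemma ccvg_sum (I : Type) (s : seq I) (z : I -> nat -> C) (l : I -> C) :
  (forall i, ccvg (z i) (l i)) ->
  ccvg (fun k => \sum_(i <- s) z i k) (\sum_(i <- s) l i).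
Proof.
move=> zl; elim: s => [|i s IH].
  by rewrite big_nil; under [fun k => _]eq_fun do rewrite big_nil; exact: ccvg_cst.
rewrite big_cons; under [fun k => _]eq_fun do rewrite big_cons; exact: ccvgD.
Qed.

Lemma ccvg_nsq z l : ccvg z l -> nsq (z k) @[k --> \oo] --> nsq l.
Proof.
move=> [z1 z2]; apply: cvgD.
  by rewrite expr2; under eq_fun do rewrite expr2; exact: cvgM.
by rewrite expr2; under eq_fun do rewrite expr2; exact: cvgM.
Qed.

Lemma cvg_sumr (I : Type) (s : seq I) (f : I -> nat -> R) (l : I -> R) :
  (forall i, f i k @[k --> \oo] --> l i) ->
  \sum_(i <- s) f i k @[k --> \oo] --> \sum_(i <- s) l i.
Proof.
move=> fl; elim: s => [|i s IH].
  by rewrite big_nil; under eq_fun do rewrite big_nil; exact: cvg_cst.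
rewrite big_cons; under eq_fun do rewrite big_cons; exact: cvgD.
Qed.

Definition rvec m (q : 'cV[rat * rat]_m) : 'cV[C]_m :=
  map_mx (fun p => ratr p.1 +i* ratr p.2) q.

(* With a strict inequality between squared norms, v can be taken rational, which
   makes the event measurable. *)
Definition violated m n (a b : R) (M : 'M[C]_(m, n)) : Prop :=
  exists v : 'cV[C]_n, a * nrm2 (M *m v) + b * nrm2 v < 0.

(** Rational vectors converge to v coordinatewise and the expression is continuous, so nonnegativity
    on all of them would pass to the limit. *)
Lemma violated_rat m n (a b : R) (M : 'M[C]_(m, n)) : violated a b M ->
  exists q, a * nrm2 (M *m rvec q) + b * nrm2 (rvec q) < 0.
Proof.
move=> [v vlt]; apply: contrapT => /forallNP nq.
have /choice[q1 q1E] : forall i, exists q : nat -> rat,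
    ratr (q k) @[k --> \oo] --> complex.Re (v i 0) by move=> i; exact: rat_cvg.
have /choice[q2 q2E] : forall i, exists q : nat -> rat,
    ratr (q k) @[k --> \oo] --> complex.Im (v i 0) by move=> i; exact: rat_cvg.
pose q k : 'cV[rat * rat]_n := \col_i (q1 i k, q2 i k).
have qv i : ccvg (fun k => rvec (q k) i 0) (v i 0).
  by split; under eq_fun do rewrite !mxE /=; [exact: q1E|exact: q2E].
have qMv i : ccvg (fun k => (M *m rvec (q k)) i 0) ((M *m v) i 0).
  rewrite mxE; under [fun k => _]eq_fun do rewrite mxE.
  by apply: ccvg_sum => j; apply: ccvgM => //; exact: ccvg_cst.
have : (a * nrm2 (M *m rvec (q k)) + b * nrm2 (rvec (q k))) @[k --> \oo] -->
    a * nrm2 (M *m v) + b * nrm2 v.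
  by apply: cvgD; apply: cvgMr; apply: cvg_sumr => i; exact: ccvg_nsq.
move=> cv; move: vlt; rewrite ltNge -(cvg_lim _ cv)//; apply/negP; rewrite negbK.
apply: limr_ge; first by apply/cvg_ex; eexists; exact: cv.
by apply: nearW => k; rewrite leNgt; apply/negP; exact: nq.
Qed.

Lemma measurable_violated d (T : measurableType d) m n (a b : R)
    (F : T -> 'M[C]_(m, n)) : (forall i j, cmeas (fun x => F x i j)) ->
  measurable [set x | violated a b (F x)].
Proof.
move=> mF.
have -> : [set x | violated a b (F x)] =
   \bigcup_(q in [set: 'cV[rat * rat]_n])
     [set x | a * nrm2 (F x *m rvec q) + b * nrm2 (rvec q) < 0].
  apply/seteqP; split => x /=; first by move=> /violated_rat[q qE]; exists q.
  by move=> [q _ qE]; exists (rvec q).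
apply: countable_bigcupT_measurable; first exact: countableP.
move=> q; rewrite (_ : [set x | _] =
    (fun x => a * nrm2 (F x *m rvec q) + b * nrm2 (rvec q)) @^-1` `]-oo, 0[%classic).
  rewrite -[X in measurable X]setTI.
  apply: (_ : measurable_fun [set: T] _) => //; apply: measurable_funD => //.
  apply: measurable_funM => //; apply: measurable_sum => i; apply: measurable_nsq.
  by apply: cmeas_mulmx => // k l; exact: cmeas_cst.
by apply/seteqP; split => x /=; rewrite in_itv.
Qed.

End rational_density.

(** * Spectral decomposition of the Gram matrix *)

Section spectral_gram.
Context {R : realType}.
Local Notation C := R[i].

(** The squared singular values, in the unsorted order of the spectral decomposition; the adjoints
    of the rows of [gram_mx] are the matching right singular vectors. *)
Definition gram_diag m n (A : 'M[C]_(m, n)) (i : 'I_n) : R :=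
  complex.Re (spectral_diag (A^t* *m A) 0 i).

Definition gram_mx m n (A : 'M[C]_(m, n)) : 'M[C]_n := spectralmx (A^t* *m A).

Lemma gram_unitary m n (A : 'M[C]_(m, n)) : gram_mx A \is unitarymx.
Proof. exact: spectral_unitarymx. Qed.

Lemma gram_decomp m n (A : 'M[C]_(m, n)) :
  A^t* *m A = (gram_mx A)^t* *m diag_mx (spectral_diag (A^t* *m A)) *m gram_mx A.
Proof.
rewrite -(invmx_unitary (gram_unitary A)); apply/orthomx_spectralP/normalmxP.
by rewrite mulmx_conjtr trmxCK.
Qed.

Let nrm2_gram m n (A : 'M[C]_(m, n)) (v : 'cV[C]_n) : (nrm2 (A *m v))%:C =
  \sum_i spectral_diag (A^t* *m A) 0 i * (nsq ((gram_mx A *m v) i 0))%:C.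
Proof.
rewrite -nrm2E mulmx_conjtr -mulmxA (mulmxA (A^t*)) [in LHS]gram_decomp.
rewrite -!mulmxA mulmxA -mulmx_conjtr; move: (gram_mx A *m v) => w.
rewrite mxE; apply: eq_bigr => i _.
by rewrite mul_diag_mx !mxE -mulcJ mulrCA; congr (_ * _); rewrite mulrC.
Qed.

(** An eigenvalue is the squared norm of the image of its unit eigenvector, hence real and
    nonnegative. *)
Let spectral_diagE m n (A : 'M[C]_(m, n)) i :
  spectral_diag (A^t* *m A) 0 i = (nrm2 (A *m ((gram_mx A)^t* *m delta_mx i 0)))%:C.
Proof.
rewrite nrm2_gram mulmxA (unitarymxP (gram_unitary A)) mul1mx (bigD1 i)//= big1.
  by rewrite mxE !eqxx nsq1 mulr1 addr0.
by move=> j ji; rewrite mxE (negPf ji) nsq0 mulr0.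
Qed.

Lemma gram_diag_ge0 m n (A : 'M[C]_(m, n)) i : 0 <= gram_diag A i.
Proof. by rewrite /gram_diag spectral_diagE nrm2_ge0. Qed.

Lemma gram_diagE m n (A : 'M[C]_(m, n)) i :
  (gram_diag A i)%:C = spectral_diag (A^t* *m A) 0 i.
Proof. by rewrite /gram_diag spectral_diagE. Qed.

Lemma nrm2_mulmx_gram m n (A : 'M[C]_(m, n)) (v : 'cV[C]_n) :
  nrm2 (A *m v) = \sum_i gram_diag A i * nsq ((gram_mx A *m v) i 0).
Proof.
apply: (@complexI R); rewrite nrm2_gram rmorph_sum; apply: eq_bigr => i _.
by rewrite rmorphM/=; congr (_ * _); rewrite /gram_diag spectral_diagE.
Qed.

Lemma nrm2_gram_mx m n (A : 'M[C]_(m, n)) (v : 'cV[C]_n) :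
  nrm2 v = \sum_i nsq ((gram_mx A *m v) i 0).
Proof. by rewrite -[RHS]/(nrm2 _) nrm2_unitary// gram_unitary. Qed.

Lemma cauchy_schwarz m (a b : 'cV[C]_m) :
  nsq (\sum_i a i 0 * b i 0) <= nrm2 a * nrm2 b.
Proof.
have [->|a0] := eqVneq a 0.
  rewrite big1 ?nsq0; first by rewrite mulr_ge0// nrm2_ge0.
  by move=> i _; rewrite mxE mul0r.
have N0 : 0 < nrm2 a by rewrite nrm2_gt0.
pose s := \sum_i a i 0 * b i 0.
(* Up to the scale |a|^2, the part of [b] orthogonal to the conjugate of [a]; its squared norm is
   |a|^2 times the gap in the inequality. *)
pose w : 'cV[C]_m := (nrm2 a)%:C *: b - s *: map_mx Num.conj a.
suff wE : nrm2 w = nrm2 a * (nrm2 a * nrm2 b - nsq s).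
  by have := nrm2_ge0 w; rewrite wE pmulr_rge0// subr_ge0.
apply: (@complexI R); rewrite -nrm2E mxE.
under eq_bigr do rewrite !mxE rmorphB !rmorphM /= conjCK.
have -> : Num.conj (nrm2 a)%:C = (nrm2 a)%:C by exact: conjc_real.
transitivity (\sum_i ((nrm2 a)%:C * (nrm2 a)%:C * (b i 0 * (b i 0)^*)
   - (nrm2 a)%:C * s * ((a i 0)^* * (b i 0)^*)
   - (nrm2 a)%:C * s^* * (a i 0 * b i 0) + s * s^* * (a i 0 * (a i 0)^*))).
  by apply: eq_bigr => i _; ring.
rewrite !big_split /= !sumrN -!mulr_sumr -/s.
have -> : \sum_i (a i 0)^* * (b i 0)^* = s^*.
  by rewrite rmorph_sum; apply: eq_bigr => i _; rewrite rmorphM.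
have -> : \sum_i b i 0 * (b i 0)^* = (nrm2 b)%:C.
  by rewrite rmorph_sum; apply: eq_bigr => i _; rewrite mulcJ.
have -> : \sum_i a i 0 * (a i 0)^* = (nrm2 a)%:C.
  by rewrite rmorph_sum; apply: eq_bigr => i _; rewrite mulcJ.
rewrite !rmorphM rmorphB rmorphM /= -mulcJ; ring.
Qed.

End spectral_gram.

(** * Upper tail of the norm of a Gaussian matrix *)

Section norm_tail.
Context {R : realType}.
Local Notation CM := (measurableTypeR R * measurableTypeR R)%type.
Local Notation C := R[i].

(** The outer tuple lists columns, so prepending an entry adds a first column. *)
Definition gmat m n (z : m.-tuple (n.-tuple CM)) : 'M[C]_(n, m) :=
  \matrix_(i, j) r2c (tnth (tnth z j) i).

Lemma cmeas_gmat m n i j : cmeas (fun z : m.-tuple (n.-tuple CM) => gmat z i j).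
Proof.
under [fun z => _]eq_fun do rewrite mxE; apply: cmeas_r2c.
apply: (measurableT_comp (@measurable_tnth _ CM n i)).
exact: (@measurable_tnth _ (n.-tuple CM) m j).
Qed.

Lemma measurable_le_fun d (T : measurableType d) (f g : T -> R) :
  measurable_fun [set: T] f -> measurable_fun [set: T] g ->
  measurable [set z | f z <= g z].
Proof.
move=> mf mg; rewrite -[X in measurable X]setTI.
have := measurable_fun_ler mf mg => /(_ measurableT [set true]).
rewrite (_ : _ @^-1` _ = [set z | f z <= g z]); first by apply.
by apply/seteqP; split.
Qed.

Lemma measurable_nrm2 d (T : measurableType d) m (F : T -> 'cV[C]_m) :
  (forall i, cmeas (fun x => F x i 0)) -> measurable_fun [set: T] (fun x => nrm2 (F x)).
Proof. by move=> mF; apply: measurable_sum => i; exact: measurable_nsq. Qed.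

Definition bil m n (u : 'cV[C]_n) (v : 'cV[C]_m) (z : m.-tuple (n.-tuple CM)) : C :=
  \sum_j v j 0 * dotc u (tnth z j).

Lemma bilE m n (u : 'cV[C]_n) (v : 'cV[C]_m) (z : m.-tuple (n.-tuple CM)) :
  bil u v z = \sum_i u i 0 * (gmat z *m v) i 0.
Proof.
rewrite /bil; under eq_bigr do rewrite mulr_sumr.
rewrite exchange_big; apply: eq_bigr => i _.
rewrite mxE mulr_sumr; apply: eq_bigr => j _.
by rewrite !mxE mulrCA [r2c _ * _]mulrC.
Qed.

(** Up to one constant of modulus |u|, the entries of u^T G are again independent standard
    Gaussians, and u^T G v is that constant times the form [dotc v] in them. *)
Lemma bil_tail m n (u : 'cV[C]_n) (v : 'cV[C]_m) (a : R) : u != 0 -> v != 0 -> 0 <= a ->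
  iid (iid cgm n) m [set z | a * (nrm2 u * nrm2 v) <= nsq (bil u v z)] = (expR (- a))%:E.
Proof.
move=> u0 v0 a0.
have [c nc hc] := integral_dotc_lin u.
have c0 : c != 0 by rewrite -nsq_eq0 nc nrm2_eq0.
pose phi (x : n.-tuple CM) : CM := c2r (c^-1 * dotc u x).
have mphi : measurable_fun [set: n.-tuple CM] phi.
  by apply: measurable_c2r; apply: cmeasM; [exact: cmeas_cst|exact: cmeas_dotc].
have lawphi B : measurable B -> iid cgm n (phi @^-1` B) = cgm B.
  move=> mB; rewrite -[LHS]integral_prob_setT; last first.
    by rewrite -[X in measurable X]setTI; exact: mphi.
  have mF : measurable_fun [set: CM] (fun p : CM => (\1_B (c2r (c^-1 * r2c p) : CM) : R)%:E).
    apply/measurable_EFinP.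
    apply: (measurableT_comp (measurable_indic _)) => //.
    by apply: measurable_c2r; apply: cmeasM; [exact: cmeas_cst|exact: cmeas_r2c].
  rewrite -[RHS]integral_prob_setT//.
  transitivity (\int[iid cgm n]_z (\1_B (c2r (c^-1 * r2c (c2r (dotc u z)))%R : CM))%:E)%E.
    by apply: eq_integral => z _; rewrite c2rK.
  rewrite (hc _ mF)//; apply: eq_integral => p _.
  by rewrite c2rK mulKf// r2cK.
pose A := [set w : m.-tuple CM | a * nrm2 v <= nsq (dotc v w)].
have mA : measurable A.
  apply: measurable_le_fun => //; apply: measurable_nsq; exact: cmeas_dotc.
transitivity (iid (iid cgm n) m (@map_tuple m _ _ phi @^-1` A)).
  congr (iid _ m _); apply/seteqP.
  have bilE' z : bil u v z = c * dotc v (map_tuple phi z).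
    rewrite /bil /dotc mulr_sumr; apply: eq_bigr => j _.
    by rewrite tnth_map c2rK mulrCA [c * _]mulrA mulfV// mul1r.
  have nu0 : 0 < nrm2 u by rewrite nrm2_gt0.
  by split => z; rewrite /A /= bilE' nsqM nc mulrCA ler_pM2l.
rewrite (iid_map mphi lawphi)//.
rewrite -integral_prob_setT//.
have mf : measurable_fun [set: R] (fun x : R => (\1_[set x | a * nrm2 v <= x] x : R)%:E).
  apply/measurable_EFinP; apply: measurable_indic.
  by apply: measurable_le_fun.
rewrite (_ : (\int[_]_x _)%E =
  (\int[iid cgm m]_z (\1_[set x | a * nrm2 v <= x] (nsq (dotc v z)))%:E)%E)//.
rewrite (integral_dotc v mf); last by move=> x; rewrite lee_fin.
rewrite -cgm_tail// -integral_prob_setT; last first.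
  by apply: measurable_le_fun => //; exact: measurable_r2c_nsq.
have nv0 : 0 < nrm2 v by rewrite nrm2_gt0.
by apply: eq_integral => p _; rewrite !indicb mulrC ler_pM2l.
Qed.

Lemma cvec_null n : iid (@cgm R) n.+1 [set u | cvec u = 0] = 0%E.
Proof.
pose h : 'cV[C]_n.+1 := const_mx 1.
have h0 : h != 0.
  by apply/eqP => /colP /(_ 0); rewrite !mxE => /eqP; rewrite oner_eq0.
apply/eqP; rewrite eq_le measure_ge0 andbT -(dotc_eq0 h0).
apply: le_measure; rewrite ?inE.
- rewrite (_ : [set u | _] = [set u | nrm2 (cvec u) <= 0]).
    by apply: measurable_le_fun => //; apply: measurable_nrm2 => i; exact: cmeas_cvec.
  apply/seteqP; split => u /=; first by move=> ->; rewrite le_eqVlt nrm2_eq0 eqxx.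
  by rewrite le_eqVlt ltNge nrm2_ge0 orbF nrm2_eq0 => /eqP.
- rewrite (_ : [set u | _] = [set u | nsq (dotc h u) <= 0]).
    by apply: measurable_le_fun => //; apply: measurable_nsq; exact: cmeas_dotc.
  apply/seteqP; split => u /=; first by move=> ->; rewrite nsq0.
  by rewrite le_eqVlt ltNge nsq_ge0 orbF nsq_eq0 => /eqP.
by move=> u /= u0; rewrite dotcE u0 mulmx0 mxE.
Qed.

(* For fixed u, v the number u^T G v / (|u| |v|) is a standard complex Gaussian,
   so it exceeds b sqrt L with probability exp(- b^2 L); but when |G|^2 > L this
   happens with probability at least (1-b)^(2n) over independent Gaussian u, v. *)
Lemma norm_tail n (L b : R) : 0 <= b -> b < 1 -> 0 <= L ->
  ((((1 - b) ^+ n) ^+ 2)%:E *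
   iid (iid cgm n.+1) n.+1 [set z | violated (-1) L (gmat z)] <=
   (expR (- (b ^+ 2 * L)))%:E)%E.
Proof.
move=> b0 b1 L0.
pose N := n.+1; pose P := iid (iid (@cgm R) N) N.
pose Q : probability (N.-tuple CM * N.-tuple CM)%type R := (iid cgm N \x iid cgm N)%E.
pose S := [set p : N.-tuple (N.-tuple CM) * (N.-tuple CM * N.-tuple CM) |
  b ^+ 2 * L * (nrm2 (cvec p.2.2) * nrm2 (cvec p.2.1)) <=
  nsq (bil (cvec p.2.2) (cvec p.2.1) p.1)].
have mS : measurable S.
  apply: measurable_le_fun.
    apply: measurable_funM => //; apply: measurable_funM.
      apply: measurable_nrm2 => i; apply: (cmeas_comp (cmeas_cvec i 0)).
      exact: (measurableT_comp measurable_snd measurable_snd).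
    apply: measurable_nrm2 => i; apply: (cmeas_comp (cmeas_cvec i 0)).
    exact: (measurableT_comp measurable_fst measurable_snd).
  apply: measurable_nsq.
  under [fun z => _]eq_fun do rewrite bilE.
  apply: cmeas_sum => i; apply: cmeasM.
    apply: (cmeas_comp (cmeas_cvec i 0)).
    exact: (measurableT_comp measurable_snd measurable_snd).
  apply: cmeas_mulmx => [k l|k l].
    by apply: (cmeas_comp (cmeas_gmat k l)).
  apply: (cmeas_comp (cmeas_cvec k l)).
  exact: (measurableT_comp measurable_fst measurable_snd).
have mB : measurable [set z : N.-tuple (N.-tuple CM) | violated (-1) L (gmat z)].
  by apply: measurable_violated => i j; exact: cmeas_gmat.
have b10 : 0 <= 1 - b by rewrite subr_ge0 ltW.
have lower z : violated (-1) L (gmat z) ->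
    ((((1 - b) ^+ n) ^+ 2)%:E <= Q (xsection S z))%E.
  move=> [v0 v0E].
  pose G := gmat z.
  have [i iL] : exists i, L < gram_diag G i.
    apply: contrapT => /forallNP h; move: v0E.
    rewrite mulN1r addrC subr_lt0 ltNge => /negP; apply.
    rewrite nrm2_mulmx_gram (nrm2_gram_mx G) mulr_sumr; apply: ler_sum => i _.
    by rewrite ler_wpM2r ?nsq_ge0// leNgt; apply/negP; exact: h.
  (* The singular direction of an eigenvalue above L: h^T w is coordinate i of w in the spectral
     basis. *)
  pose h : 'cV[C]_N := (row i (gram_mx G))^T.
  have nh : nrm2 h = 1.
    have /matrixP/(_ i i) := unitarymxP (gram_unitary G).
    rewrite mxE [RHS]mxE eqxx => h1; apply: (@complexI R); rewrite -[RHS]h1 rmorph_sum.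
    by apply: eq_bigr => j _; rewrite !mxE mulcJ.
  have hE w : nsq (dotc h w) = nsq ((gram_mx G *m cvec w) i 0).
    by rewrite dotcE trmxK -row_mul mxE.
  have GL w : L * nsq (dotc h w) <= nrm2 (G *m cvec w).
    rewrite nrm2_mulmx_gram (bigD1 i)//= hE; apply: ler_wpDr.
      by apply: sumr_ge0 => j _; rewrite mulr_ge0 ?gram_diag_ge0 ?nsq_ge0.
    by rewrite ler_wpM2r ?nsq_ge0// ltW.
  have mX := measurable_xsection z mS.
  rewrite -integral_prob_setT//.
  have mI : measurable_fun [set: N.-tuple CM * N.-tuple CM]
      (fun p => (\1_(xsection S z) p : R)%:E).
    by apply/measurable_EFinP; exact: measurable_indic.
  rewrite (fubini_tonelli1 (m1 := iid cgm N) (m2 := iid cgm N) _ mI)//.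
  (* For v aligned with [h] in this sense, |G v|^2 >= b L |v|^2; a vector u aligned with G v then
     gives |u^T G v|^2 >= b^2 L |u|^2 |v|^2. Each alignment has probability at least (1 - b)^n. *)
  pose D := [set v : N.-tuple CM | b * nrm2 h * nrm2 (cvec v) <= nsq (dotc h v)].
  have mD : measurable D.
    apply: measurable_le_fun.
      by apply: measurable_funM => //; apply: measurable_nrm2 => k; exact: cmeas_cvec.
    by apply: measurable_nsq; exact: cmeas_dotc.
  apply: (@le_trans _ _ (\int[iid cgm N]_v (((1 - b) ^+ n)%:E * (\1_D v)%:E))%E).
    rewrite ge0_integralZl//; last 2 first.
    - by apply/measurable_EFinP; exact: measurable_indic.
    - by rewrite lee_fin exprn_ge0.
    rewrite integral_prob_setT// expr2 EFinM lee_wpmul2l ?lee_fin ?exprn_ge0//.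
    exact: dotc_sphere.
  apply: ge0_le_integral => //.
  - by move=> v _; rewrite mule_ge0// lee_fin// exprn_ge0.
  - by apply: emeasurable_funM => //; apply/measurable_EFinP; exact: measurable_indic.
  - exact: (@measurable_fun_fubini_tonelli_F _ _ _ _ R (iid cgm N) _ mI (fun=> _)).
  move=> v _; rewrite indicE; case: (boolP (v \in D)) => [|_]; last first.
    by rewrite mule0; apply: integral_ge0 => u _; rewrite lee_fin.
  rewrite inE /D /= nh mulr1 mule1 => vD.
  apply: (le_trans (@dotc_sphere _ n (G *m cvec v) b b0 b1)).
  rewrite -integral_prob_setT; last first.
    apply: measurable_le_fun.
      by apply: measurable_funM => //; apply: measurable_nrm2 => k; exact: cmeas_cvec.
    by apply: measurable_nsq; exact: cmeas_dotc.
  apply: ge0_le_integral => //.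
  - apply/measurable_EFinP; apply: measurable_indic; apply: measurable_le_fun.
      by apply: measurable_funM => //; apply: measurable_nrm2 => k; exact: cmeas_cvec.
    by apply: measurable_nsq; exact: cmeas_dotc.
  - by apply: (measurableT_comp mI); exact: pair1_measurable.
  move=> u _; rewrite lee_fin indicb indicE mem_xsection /S mem_setE /= ler_nat.
  case: (boolP (_ <= nsq (dotc _ u))) => // hu; rewrite lt0b unfold_in /=.
  have -> : bil (cvec u) (cvec v) z = dotc (G *m cvec v) u.
    by rewrite bilE; apply: eq_bigr => k _; rewrite !mxE mulrC.
  apply: le_trans hu; rewrite expr2 -!mulrA ler_wpM2l//.
  rewrite [nrm2 (cvec u) * _]mulrC !mulrA ler_wpM2r ?nrm2_ge0//.
  by apply: le_trans (GL v); rewrite [b * L]mulrC -mulrA ler_wpM2l.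
apply: (le_trans (@two_sided _ _ _ _ _ P Q S _ _ mS mB (sqr_ge0 _) lower)).
apply: (@le_trans _ _ (\int[Q]_w (expR (- (b ^+ 2 * L)))%:E)%E); last first.
  by rewrite integral_cst_prob.
(* When u or v is zero, the test [S] holds for every z and [bil_tail] does not apply; such pairs
   form a null set. *)
pose Z := [set u : N.-tuple CM | cvec u = 0].
have mZ : measurable Z.
  rewrite (_ : Z = [set u | nrm2 (cvec u) <= 0]).
    by apply: measurable_le_fun => //; apply: measurable_nrm2 => i; exact: cmeas_cvec.
  apply/seteqP; split => u /=; first by rewrite /Z /= => ->; rewrite le_eqVlt nrm2_eq0 eqxx.
  by rewrite le_eqVlt ltNge nrm2_ge0 orbF nrm2_eq0 => /eqP.
have QZ : Q (Z `*` setT `|` setT `*` Z) = 0%E.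
  apply/eqP; rewrite eq_le measure_ge0 andbT.
  have mZ1 := measurableX mZ (@measurableT _ (N.-tuple CM)).
  have mZ2 := measurableX (@measurableT _ (N.-tuple CM)) mZ.
  apply: (le_trans (measureU2 _ mZ1 mZ2)).
  have Z0 : iid (@cgm R) N Z = 0%E by exact: cvec_null.
  have e1 : Q (Z `*` setT) = 0%E.
    by rewrite [LHS]product_measure1E// [X in (X * _)%E]Z0 mul0e.
  have e2 : Q (setT `*` Z) = 0%E.
    by rewrite [LHS]product_measure1E// [X in (_ * X)%E]Z0 mule0.
  by rewrite [X in (X + _)%E]e1 [X in (_ + X)%E]e2 adde0.
apply: (@ae_ge0_le_integral _ _ _ Q setT).
- exact: measurableT.
- by move=> w _; exact: measure_ge0.
- exact: measurable_fun_ysection.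
- by move=> w _; rewrite lee_fin expR_ge0.
- exact: measurable_cst.
exists (Z `*` setT `|` setT `*` Z); split => //.
  by apply: measurableU; exact: measurableX.
move=> w /= wN; apply: contrapT => /not_orP[/not_andP w1 /not_andP w2]; apply: wN => _.
have {}w1 : cvec w.1 != 0 by apply/eqP => w10; case: w1.
have {}w2 : cvec w.2 != 0 by apply/eqP => w20; case: w2.
have := @bil_tail N N (cvec w.2) (cvec w.1) (b ^+ 2 * L) w2 w1.
rewrite mulr_ge0 ?sqr_ge0// => /(_ isT) <-.
rewrite le_eqVlt; apply/orP; left; apply/eqP; congr (iid _ N _).
by apply/seteqP; split => z; rewrite /= /ysection /= inE.
Qed.

End norm_tail.

(** * Lower tail of the smallest singular value *)

Section smallest_singular_value.
Context {R : realType}.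
Local Notation CM := (measurableTypeR R * measurableTypeR R)%type.
Local Notation C := R[i].

Lemma nrm2_tr_unitary m n (W : 'M[C]_(m, n)) (v : 'cV[C]_m) :
  W \is unitarymx -> nrm2 (W^T *m v) = nrm2 v.
Proof.
move=> /unitarymxP WW; apply: nrm2_isometry.
have -> : (W^T)^t* *m W^T = (W *m W^t*)^T.
  by rewrite trmx_mul map_trmx trmxK.
by rewrite WW trmx1.
Qed.

Lemma row'_unitary m n (W : 'M[C]_(m.+1, n)) i :
  W \is unitarymx -> row' i W \is unitarymx.
Proof.
move=> /unitarymxP WW; apply/unitarymxP/matrixP => k l.
have /matrixP/(_ (lift i k) (lift i l)) := WW.
rewrite !mxE (inj_eq lift_inj) => <-.
by apply: eq_bigr => j _; rewrite !mxE.
Qed.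

Lemma nsq_det_unitary m (Q : 'M[C]_m) : Q \is unitarymx -> nsq (\det Q) = 1.
Proof.
move=> /unitarymxP QQ; apply: (@complexI R).
have := congr1 determinant QQ; rewrite det_mulmx det1 det_map_mx det_tr => h.
by rewrite -mulcJ.
Qed.

Lemma measurable_eq0 d (T : measurableType d) (f : T -> C) :
  cmeas f -> measurable [set x | f x = 0].
Proof.
move=> mf; rewrite (_ : [set x | _] = [set x | nsq (f x) <= 0]).
  by apply: measurable_le_fun => //; exact: measurable_nsq.
apply/seteqP; split => x /=; first by move=> ->; rewrite nsq0.
by rewrite le_eqVlt ltNge nsq_ge0 orbF nsq_eq0 => /eqP.
Qed.

Lemma measurable_dotc0 m (h : 'cV[C]_m) : measurable [set z | dotc h z = 0].
Proof. by apply: measurable_eq0; exact: cmeas_dotc. Qed.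

Lemma measurable_lt_fun d (T : measurableType d) (f g : T -> R) :
  measurable_fun [set: T] f -> measurable_fun [set: T] g ->
  measurable [set z | f z < g z].
Proof.
move=> mf mg; rewrite (_ : [set z | _] = ~` [set z | g z <= f z]).
  by apply: measurableC; exact: measurable_le_fun.
by apply/seteqP; split => z /=; rewrite ltNge => /negP.
Qed.

Lemma measurable_integral_cons d (T : measurableType d) (mu : probability T R) m
    (f : m.+1.-tuple T -> \bar R) :
  measurable_fun [set: m.+1.-tuple T] f -> (forall z, 0 <= f z)%E ->
  measurable_fun [set: m.-tuple T] (fun z => \int[mu]_x f [tuple of x :: z])%E.
Proof.
move=> mf f0.
have mg := measurableT_comp mf (@measurable_fun_cons_pair _ T m).
have := @measurable_fun_fubini_tonelli_G _ _ _ _ R mu _ mg (fun x => f0 _).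
by [].
Qed.

Section fixed_rows.
Context (n : nat).

(** The cofactors of the first column, computed from the other columns alone; [+ 0] is the column
    index in the sign of [cofactor]. *)
Definition cofv m (W : 'M[C]_(m.+1, n)) (z : m.-tuple (n.-tuple CM)) : 'cV[C]_m.+1 :=
  \col_i ((-1) ^+ (i + 0) * \det (row' i (W *m gmat z))).

Lemma col'_gmat m (W : 'M[C]_(m.+1, n)) x (z : m.-tuple (n.-tuple CM)) :
  col' 0 (W *m gmat [tuple of x :: z]) = W *m gmat z.
Proof.
apply/matrixP => i j; rewrite !mxE; apply: eq_bigr => k _.
by rewrite !mxE tnthS.
Qed.

Lemma cofactor_gmat m (W : 'M[C]_(m.+1, n)) x (z : m.-tuple (n.-tuple CM)) i :
  cofactor (W *m gmat [tuple of x :: z]) i 0 = cofv W z i 0.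
Proof. by rewrite /cofactor col'_gmat mxE. Qed.

(** Expansion along the first column: given the others, the determinant is a linear form in a
    Gaussian vector. *)
Lemma det_gmat_cons m (W : 'M[C]_(m.+1, n)) x (z : m.-tuple (n.-tuple CM)) :
  \det (W *m gmat [tuple of x :: z]) = dotc (W^T *m cofv W z) x.
Proof.
rewrite (expand_det_col _ 0) dotcE trmx_mul trmxK -mulmxA mxE.
apply: eq_bigr => i _; rewrite cofactor_gmat mulrC [(cofv W z)^T 0 i]mxE.
congr (_ * _); rewrite [LHS]mxE [RHS]mxE.
by apply: eq_bigr => j _; rewrite !mxE.
Qed.

Lemma adj_gmat_cons m (W : 'M[C]_(m.+1, n)) x (z : m.-tuple (n.-tuple CM)) c :
  (\adj (W *m gmat [tuple of x :: z]))^T *m (c *: delta_mx 0 0) = c *: cofv W z.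
Proof.
rewrite -scalemxAr; congr (_ *: _); apply/colP => i.
by rewrite -colE !mxE cofactor_gmat mxE.
Qed.

Lemma cmeas_Wgmat m k (W : 'M[C]_(k, n)) i j :
  cmeas (fun z : m.-tuple (n.-tuple CM) => (W *m gmat z) i j).
Proof. by apply: cmeas_mulmx => [a b|a b]; [exact: cmeas_cst|exact: cmeas_gmat]. Qed.

Lemma cmeas_det_gmat m (W : 'M[C]_(m, n)) :
  cmeas (fun z : m.-tuple (n.-tuple CM) => \det (W *m gmat z)).
Proof. by apply: cmeas_det => i j; exact: cmeas_Wgmat. Qed.

Lemma measurable_det0 m (W : 'M[C]_(m, n)) :
  measurable [set z : m.-tuple (n.-tuple CM) | \det (W *m gmat z) = 0].
Proof. by apply: measurable_eq0; exact: cmeas_det_gmat. Qed.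

(** By induction the minor without the first row of W and the first column is almost surely nonzero;
    the determinant is then a nonzero linear form in the first column. *)
Lemma det_null m (W : 'M[C]_(m, n)) : W \is unitarymx ->
  iid (iid (@cgm R) n) m [set z | \det (W *m gmat z) = 0] = 0%E.
Proof.
elim: m W => [|m IH] W uW.
  rewrite (_ : [set z | _] = set0) ?measure0//.
  by apply/seteqP; split => // z /=; rewrite det_mx00 => /eqP; rewrite oner_eq0.
have mS := measurable_det0 W.
rewrite -[LHS]integral_prob_setT//.
have mI : measurable_fun [set: m.+1.-tuple (n.-tuple CM)]
    (fun z => (\1_[set z | \det (W *m gmat z) = 0] z : R)%:E).
  by apply/measurable_EFinP; exact: measurable_indic.
rewrite (iidS_integral2 (iid cgm n) mI)//.
pose W' := row' 0 W.
pose D := [set z : m.-tuple (n.-tuple CM) | \det (W' *m gmat z) = 0].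
have mD : measurable D by exact: measurable_det0.
apply/eqP; rewrite eq_le; apply/andP; split; last first.
  by apply: integral_ge0 => z _; apply: integral_ge0 => x _; rewrite lee_fin.
rewrite -(IH W' (row'_unitary 0 uW)) -[leRHS]integral_prob_setT//.
apply: ge0_le_integral => //.
- by move=> z _; apply: integral_ge0 => x _; rewrite lee_fin.
- by apply: (@measurable_integral_cons _ _ (iid cgm n) _ _ mI) => z; rewrite lee_fin.
- by apply/measurable_EFinP; exact: measurable_indic.
move=> z _.
have inner (A : set (n.-tuple CM)) : A = [set x | dotc (W^T *m cofv W z) x = 0] ->
    (\int[iid cgm n]_x (\1_[set z | \det (W *m gmat z) = 0] [tuple of x :: z])%:E =
     iid cgm n A)%E.
  move=> ->; rewrite -[RHS]integral_prob_setT.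
    apply: eq_integral => x _; rewrite !indicE; congr ((nat_of_bool _)%:R)%:E.
    by apply/idP/idP; rewrite !inE /= det_gmat_cons.
  exact: measurable_dotc0.
rewrite (inner _ erefl) indicE -/D; case: (boolP (z \in D)) => [_|].
  by apply: probability_le1; exact: measurable_dotc0.
rewrite notin_setE /D /= => /eqP zD; rewrite dotc_eq0//.
rewrite -nrm2_gt0 nrm2_tr_unitary// nrm2_gt0; apply: contra zD => /eqP/colP/(_ 0).
rewrite !mxE addn0 expr0 mul1r => d0; apply/eqP; rewrite -[RHS]d0; congr (\det _).
by apply/matrixP => i j; rewrite !mxE; apply: eq_bigr => k _; rewrite !mxE.
Qed.

(** Applies [q] to every row of the matrix; as tuples list columns, this takes two
    transpositions. *)
Definition mix m (q : 'M[C]_m) (z : m.-tuple (n.-tuple CM)) : m.-tuple (n.-tuple CM) :=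
  tr_tuple (map_tuple (act q) (tr_tuple z)).

Lemma gmat_mix m (q : 'M[C]_m) z : gmat (mix q z) = gmat z *m q^T.
Proof.
apply/matrixP => i j; rewrite !mxE !tnth_mktuple tnth_map /act tnth_mktuple c2rK.
by rewrite mxE; apply: eq_bigr => k _; rewrite !mxE !tnth_mktuple mulrC.
Qed.

Lemma law_act m (q : 'M[C]_m) B : gauss_invariant q -> measurable B ->
  iid cgm m (act q @^-1` B) = iid cgm m B.
Proof.
move=> iq mB; rewrite -[LHS]integral_prob_setT; last first.
  by rewrite -[X in measurable X]setTI; exact: measurable_act.
rewrite -[RHS]integral_prob_setT//.
rewrite -(iq (fun z => (\1_B z)%:E))//.
by apply/measurable_EFinP; exact: measurable_indic.
Qed.

Lemma law_mix m (q : 'M[C]_m) A : gauss_invariant q -> measurable A ->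
  iid (iid cgm n) m (mix q @^-1` A) = iid (iid cgm n) m A.
Proof.
move=> iq mA.
have mtr1 : measurable (@tr_tuple _ CM n m @^-1` A).
  by rewrite -[X in measurable X]setTI; exact: measurable_tr_tuple.
have mtr2 : measurable (@map_tuple n _ _ (act q) @^-1` (@tr_tuple _ CM n m @^-1` A)).
  rewrite -[X in measurable X]setTI; apply: measurable_map_tuple => //.
  exact: measurable_act.
rewrite -[RHS](iid_tr cgm)//.
rewrite -(iid_map (mu := iid cgm m) (nu := iid cgm m) (measurable_act q)) //; last first.
  by move=> B mB; exact: law_act.
by rewrite -(iid_tr cgm mtr2).
Qed.

(** Follows from T q adj(T q) = det(T q) by cancelling det T; this is why [small_event] asks for a
    nonzero determinant. *)
Lemma unit_adj_mix m (T q : 'M[C]_m) : \det T != 0 -> 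
  q *m \adj (T *m q) = \det q *: \adj T.
Proof.
move=> dT; apply: (@scalerI _ _ (\det T)) => //.
transitivity (\adj T *m (T *m q *m \adj (T *m q))).
  by rewrite -mul_scalar_mx -mul_adj_mx !mulmxA.
by rewrite mul_mx_adj mul_mx_scalar det_mulmx scalerA.
Qed.

(** With T for [W *m gmat z] invertible and t2 > 0, the second condition says that |T^-T h|^2
    exceeds 1 / t2. Written with det and adj it is polynomial, hence measurable, and open to
    cofactor expansion. *)
Definition small_event m (W : 'M[C]_(m, n)) (t2 : R) (h : 'cV[C]_m) :
    set (m.-tuple (n.-tuple CM)) :=
  [set z | \det (W *m gmat z) <> 0 /\
     nsq (\det (W *m gmat z)) < t2 * nrm2 ((\adj (W *m gmat z))^T *m h)].

Lemma cmeas_adj d (T : measurableType d) m (F : T -> 'M[C]_m) :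
  (forall i j, cmeas (fun x => F x i j)) -> forall i j, cmeas (fun x => (\adj (F x)) i j).
Proof.
move=> mF i j; under [fun x => _]eq_fun do rewrite mxE.
apply: cmeasM; first exact: cmeas_cst.
apply: cmeas_det => k l; under [fun x => _]eq_fun do rewrite !mxE.
exact: mF.
Qed.

Lemma measurable_small_event m (W : 'M[C]_(m, n)) t2 h :
  measurable (small_event W t2 h).
Proof.
apply: measurableI; first by apply: measurableC; exact: measurable_det0.
apply: measurable_lt_fun.
  by apply: measurable_nsq; exact: cmeas_det_gmat.
apply: measurable_funM => //; apply: measurable_nrm2 => i.
apply: cmeas_mulmx => [a b|a b]; last exact: cmeas_cst.
under [fun x => _]eq_fun do rewrite mxE.
by apply: cmeas_adj => k l; exact: cmeas_Wgmat.
Qed.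

(** Both sides involve the same cofactors, so [dotc_ball] applies conditionally on all columns but
    the first. *)
Lemma small_event_e0 m (W : 'M[C]_(m.+1, n)) (t2 : R) (c : C) : 0 <= t2 ->
  W \is unitarymx ->
  (iid (iid cgm n) m.+1 (small_event W t2 (c *: delta_mx 0%R 0%R)) <= (t2 * nsq c)%:E)%E.
Proof.
move=> t20 uW; have mS := measurable_small_event W t2 (c *: delta_mx 0 0).
rewrite -[leLHS]integral_prob_setT//.
have mI : measurable_fun [set: m.+1.-tuple (n.-tuple CM)]
    (fun z => (\1_(small_event W t2 (c *: delta_mx 0 0)) z : R)%:E).
  by apply/measurable_EFinP; exact: measurable_indic.
rewrite (iidS_integral2 (iid cgm n) mI)//.
rewrite -[leRHS](integral_cst_prob (iid (iid cgm n) m)).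
apply: ge0_le_integral => //.
- by move=> z _; apply: integral_ge0 => x _; rewrite lee_fin.
- by apply: (@measurable_integral_cons _ _ (iid cgm n) _ _ mI) => z; rewrite lee_fin.
move=> z _.
apply: (le_trans _ (dotc_ball (W^T *m cofv W z) (mulr_ge0 t20 (nsq_ge0 c)))).
rewrite -integral_prob_setT; last exact: measurable_dotc_lt.
apply: ge0_le_integral => //.
- apply: (measurableT_comp mI); exact: measurable_cons.
- by apply/measurable_EFinP; apply: measurable_indic; exact: measurable_dotc_lt.
move=> x _; rewrite lee_fin indicb indicE ler_nat.
case: (boolP (_ \in _)) => //; rewrite inE => -[_].
by rewrite adj_gmat_cons det_gmat_cons nrm2Z nrm2_tr_unitary// mulrA lt0b => ->.
Qed.

(** Mixing by the rotation of [h] preserves the law, keeps the modulus of det T and turns [h] into a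
    multiple of the first basis vector. *)
Lemma small_event_le m (W : 'M[C]_(m, n)) (t2 : R) (h : 'cV[C]_m) : 0 <= t2 ->
  W \is unitarymx ->
  (iid (iid cgm n) m (small_event W t2 h) <= (t2 * nrm2 h)%:E)%E.
Proof.
move=> t20; case: m W h => [|m] W h uW.
  rewrite (_ : small_event W t2 h = set0).
    by rewrite measure0 lee_fin mulr_ge0// nrm2_ge0.
  apply/seteqP; split => // z -[_] /=.
  by rewrite /nrm2 big_ord0 mulr0 ltNge nsq_ge0.
have [q [c [uq qh nc iq]]] := rotation h.
rewrite -[nrm2 h]nc; apply: (le_trans _ (small_event_e0 c t20 uW)).
rewrite -[leRHS](law_mix iq); last exact: measurable_small_event.
apply: le_measure; rewrite ?inE.
- exact: measurable_small_event.
- have mmix : measurable_fun [set: m.+1.-tuple (n.-tuple CM)] (mix q).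
    apply: (measurableT_comp (@measurable_tr_tuple _ CM n m.+1)).
    apply: (measurableT_comp (measurable_map_tuple (measurable_act q))).
    exact: measurable_tr_tuple.
  rewrite -[X in measurable X]setTI; apply: mmix => //.
  exact: measurable_small_event.
move=> z [/= /eqP dT lt]; rewrite /small_event /= gmat_mix mulmxA.
set T := W *m gmat z in dT lt *.
have dq : nsq (\det q^T) = 1 by rewrite det_tr nsq_det_unitary.
have dq0 : \det q^T != 0 by rewrite -nsq_eq0 dq oner_eq0.
split; first by apply/eqP; rewrite det_mulmx mulf_neq0.
rewrite det_mulmx nsqM dq mulr1 -qh mulmxA -[q in _ *m q *m h]trmxK -trmx_mul.
by rewrite (unit_adj_mix _ dT) linearZ -scalemxAl nrm2Z dq mul1r.
Qed.

Lemma integral_nrm2_le m : (\int[iid (@cgm R) m]_h (nrm2 (cvec h))%:E <= ((100 : R) / 99 * m%:R)%:E)%E.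
Proof.
under eq_integral do rewrite -sumEFin.
have mc i : measurable_fun [set: m.-tuple CM] (fun h => (nsq (cvec h i 0))%:E : \bar R).
  by apply/measurable_EFinP; apply: measurable_nsq; exact: cmeas_cvec.
rewrite ge0_integral_sum//; last by move=> i z _; rewrite lee_fin nsq_ge0.
rewrite mulr_natr -[X in _ *+ X](card_ord m) -sumr_const -sumEFin.
apply: lee_sum => i _; apply: (le_trans _ (@integral_nsq_le R)).
pose e : 'cV[C]_m := delta_mx i 0.
have eE z : dotc e z = cvec z i 0.
  rewrite dotcE (_ : e^T = delta_mx 0 i); last by rewrite trmx_delta.
  by rewrite -rowE mxE.
have ne : nrm2 e = 1.
  rewrite /nrm2 (bigD1 i)//= big1 ?addr0; first by rewrite mxE !eqxx nsq1.
  by move=> j ji; rewrite mxE (negPf ji) nsq0.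
under eq_integral do rewrite -eE.
(* [integral_dotc] wants a function nonnegative on the whole line; the truncation is the identity on
   squared moduli. *)
pose f (x : R) : \bar R := (Num.max x 0)%:E.
have mf : measurable_fun [set: R] f.
  by apply/measurable_EFinP; apply: measurable_maxr.
have f0 x : (0 <= f x)%E by rewrite lee_fin le_max lexx orbT.
have fE x : 0 <= x -> f x = x%:E by move=> x0; rewrite /f max_l.
under eq_integral do rewrite -fE ?nsq_ge0//.
rewrite integral_dotc//.
by under eq_integral do rewrite ne mul1r fE ?nsq_ge0//.
Qed.

(* Test against an independent Gaussian vector h: writing T for the random square
   matrix, |T v|^2 < t2 |v|^2 and |v^T h| >= |v|, the latter of probability 1/e,
   force |det T|^2 < t2 |adj(T)^T h|^2 by Cauchy-Schwarz. After rotating h to a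
   multiple of e_0, adj(T)^T h is |h| times the first column of cofactors, and
   det T is the product of that column with an independent Gaussian column. *)
Lemma min_tail m (W : 'M[C]_(m, n)) (t2 : R) : 0 <= t2 -> W \is unitarymx ->
  (iid (iid (@cgm R) n) m [set z | violated 1 (- t2) (W *m gmat z)] <=
   (3 * (100 / 99) * m%:R * t2)%:E)%E.
Proof.
move=> t20 uW; pose P := iid (iid (@cgm R) n) m; pose Q := iid (@cgm R) m.
pose B := [set z : m.-tuple (n.-tuple CM) | violated 1 (- t2) (W *m gmat z)].
pose D := [set z : m.-tuple (n.-tuple CM) | \det (W *m gmat z) = 0].
have mD : measurable D by exact: measurable_det0.
have mB : measurable B by apply: measurable_violated => i j; exact: cmeas_Wgmat.
pose S := [set p : m.-tuple (n.-tuple CM) * m.-tuple CM |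
   small_event W t2 (cvec p.2) p.1].
have mS : measurable S.
  have cW k l : cmeas (fun p : m.-tuple (n.-tuple CM) * m.-tuple CM => (W *m gmat p.1) k l).
    exact: (cmeas_comp (cmeas_Wgmat W k l) measurable_fst).
  apply: measurableI.
    by apply: measurableC; apply: measurable_eq0; exact: cmeas_det.
  apply: measurable_lt_fun; first by apply: measurable_nsq; exact: cmeas_det.
  apply: measurable_funM => //; apply: measurable_nrm2 => i.
  apply: cmeas_mulmx => [a b|a b].
    under [fun x => _]eq_fun do rewrite mxE.
    exact: cmeas_adj.
  exact: (cmeas_comp (cmeas_cvec a b) measurable_snd).
have lower z : (B `\` D) z -> ((3^-1)%:E <= Q (xsection S z))%E.
  move=> [[v vE] /eqP dT].
  set T := W *m gmat z in vE dT.
  have v0 : v != 0.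
    by apply: contraTneq vE => ->; rewrite mulmx0 /nrm2 !big1 ?mulr0 ?addr0 ?ltxx// => i _; rewrite mxE nsq0.
  have nv0 : 0 < nrm2 v by rewrite nrm2_gt0.
  apply: (@le_trans _ _ (Q [set h | nrm2 v <= nsq (dotc v h)])).
    have mf : measurable_fun [set: R] (fun x : R => (\1_[set x | nrm2 v <= x] x : R)%:E).
      apply/measurable_EFinP; apply: measurable_indic.
      by apply: measurable_le_fun.
    rewrite -integral_prob_setT; last first.
      by apply: measurable_le_fun => //; apply: measurable_nsq; exact: cmeas_dotc.
    rewrite (_ : (\int[_]_x _)%E =
      (\int[iid cgm m]_z (\1_[set x | nrm2 v <= x] (nsq (dotc v z)))%:E)%E)//.
    rewrite (integral_dotc v mf); last by move=> x; rewrite lee_fin.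
    rewrite (_ : (\int[_]_x _)%E = (expR (- 1))%:E); last first.
      rewrite -cgm_tail// -integral_prob_setT; last first.
        by apply: measurable_le_fun => //; exact: measurable_r2c_nsq.
      by apply: eq_integral => p _; rewrite !indicb -[X in X <= _]mulr1 ler_pM2l.
    (* 1/3 <= (5/6)^6 <= exp(-1), the second step because 1 - 1/6 <= exp(-1/6). *)
    rewrite lee_fin; apply: (@le_trans _ _ ((1 - 6^-1) ^+ 6)); first by lra.
    have -> : expR (- 1) = expR (- 6^-1) ^+ 6 :> R.
      by rewrite -expRM_natl; congr expR; field.
    rewrite lerXn2r ?nnegrE ?expR_ge0//; first by lra.
    exact: expR_ge1Dx.
  apply: le_measure; rewrite ?inE.
  - by apply: measurable_le_fun => //; apply: measurable_nsq; exact: cmeas_dotc.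
  - exact: measurable_xsection.
  move=> h /= hv; rewrite /xsection /= inE; split => /=; first exact/eqP.
  rewrite -/T; set a := (\adj T)^T *m cvec h.
  (* Since adj(T) T = det T, the pairing of adj(T)^T h with T v collapses to det T times v^T h. *)
  have cs := cauchy_schwarz a (T *m v).
  have aE : \sum_i a i 0 * (T *m v) i 0 = \det T * dotc v h.
    transitivity ((a^T *m (T *m v)) 0 0).
      by rewrite [RHS]mxE; apply: eq_bigr => i _; rewrite [a^T _ _]mxE.
    rewrite /a trmx_mul trmxK mulmxA -(mulmxA _ (\adj T)) mul_adj_mx mul_mx_scalar -scalemxAl mxE.
    by congr (_ * _); rewrite /dotc mxE; apply: eq_bigr => i _; rewrite !mxE mulrC.
  rewrite aE nsqM in cs.
  have dT0 : 0 < nsq (\det T) by rewrite lt0r nsq_ge0 nsq_eq0 dT.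
  have {}vE : nrm2 (T *m v) < t2 * nrm2 v by rewrite -subr_lt0 -mulNr -[nrm2 _]mul1r.
  have h1 : nsq (\det T) * nrm2 v <= nrm2 a * nrm2 (T *m v).
    by apply: le_trans cs; rewrite ler_wpM2l// ltW.
  have a0 : 0 < nrm2 a.
    rewrite lt0r nrm2_ge0 andbT; apply/eqP => a0; move: h1.
    by rewrite a0 mul0r leNgt mulr_gt0.
  rewrite -(ltr_pM2r nv0); apply: (le_lt_trans h1).
  by rewrite mulrAC [ltRHS]mulrC ltr_pM2l.
(* [small_event] excludes singular matrices, which form a null set. *)
have BD : (P B <= P (B `\` D))%E.
  have PD : P D = 0%E by exact: det_null.
  apply: (@le_trans _ _ (P (B `\` D `|` D))).
    apply: le_measure; rewrite ?inE//; first by apply: measurableU => //; exact: measurableD.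
    by move=> z Bz; case: (pselect (D z)) => ?; [right|left].
  apply: (le_trans (measureU2 _ _ mD)); first exact: measurableD.
  by rewrite [X in (_ + X)%E]PD adde0.
have up := @two_sided _ _ _ _ _ P Q S (B `\` D) (3^-1) mS (measurableD mB mD) _ lower.
have {}up : ((3^-1)%:E * P (B `\` D) <= (t2 * (100 / 99 * m%:R))%:E)%E.
  apply: le_trans (up _) _; first by rewrite invr_ge0.
  (* For fixed h the test has probability at most t2 |h|^2; averaging over h brings in the second
     moment. *)
  apply: (@le_trans _ _ (\int[Q]_h (t2%:E * (nrm2 (cvec h))%:E))%E).
    apply: ge0_le_integral => //.
    - exact: measurable_fun_ysection.
    - apply: emeasurable_funM => //; apply/measurable_EFinP.
      by apply: measurable_nrm2 => i; exact: cmeas_cvec.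
    move=> h _; rewrite -EFinM; apply: (le_trans _ (small_event_le (cvec h) t20 uW)).
    apply: le_measure; rewrite ?inE; [exact: measurable_ysection|exact: measurable_small_event|].
    by move=> z; rewrite /ysection /= inE.
  rewrite ge0_integralZl//; last 2 first.
  - by apply/measurable_EFinP; apply: measurable_nrm2 => i; exact: cmeas_cvec.
  - by move=> h _; rewrite lee_fin nrm2_ge0.
  by rewrite EFinM lee_wpmul2l ?lee_fin// integral_nrm2_le.
apply: (le_trans BD).
rewrite -[leLHS]mul1e (_ : 1%E = (3 * 3^-1)%:E); last by rewrite mulfV.
rewrite EFinM -muleA (_ : 3 * (100 / 99) * m%:R * t2 = 3 * (t2 * (100 / 99 * m%:R))); last by ring.
by rewrite EFinM lee_wpmul2l// lee_fin.
Qed.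

End fixed_rows.

End smallest_singular_value.

(** * Operator norm and bounds on test vectors *)

Section operator_norm.
Context {R : realType}.
Local Notation C := R[i].

Lemma l2norm_ge0 m (v : 'cV[C]_m) : 0 <= l2norm v.
Proof. exact: sqrtr_ge0. Qed.

Lemma l2norm_eq0 m (v : 'cV[C]_m) : (l2norm v == 0) = (v == 0).
Proof. by rewrite -sqrf_eq0 l2norm_sqr nrm2_eq0. Qed.

Lemma l2normZ m (c : C) (v : 'cV[C]_m) : l2norm (c *: v) = cabs c * l2norm v.
Proof.
by rewrite !nrm2_l2norm nrm2Z sqrtrM ?nsq_ge0// -cabs_sqr sqrtr_sqr ger0_norm// cabs_nsq sqrtr_ge0.
Qed.

Lemma l2normN m (v : 'cV[C]_m) : l2norm (- v) = l2norm v.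
Proof.
by rewrite !nrm2_l2norm; congr Num.sqrt; apply: eq_bigr => i _; rewrite mxE nsqN.
Qed.

Lemma l2normD m (u v : 'cV[C]_m) : l2norm (u + v) <= l2norm u + l2norm v.
Proof.
rewrite -(@ler_pXn2r _ 2)// ?nnegrE ?addr_ge0 ?l2norm_ge0//.
pose s := \sum_i u i 0 * (map_mx Num.conj v) i 0.
have -> : l2norm (u + v) ^+ 2 = nrm2 u + nrm2 v + complex.Re s *+ 2.
  rewrite l2norm_sqr /nrm2 -big_split raddf_sum -sumrMnl -big_split /=.
  apply: eq_bigr => i _; rewrite !mxE.
  by case: (u i 0) (v i 0) => [a b] [c e]; rewrite /nsq /= ; ring.
have hs : complex.Re s <= l2norm u * l2norm v.
  apply: (le_trans (ler_norm _)); rewrite -sqrtr_sqr !nrm2_l2norm -sqrtrM ?nrm2_ge0//.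
  rewrite ler_wsqrtr//; apply: (@le_trans _ _ (nsq s)).
    by rewrite /nsq lerDl sqr_ge0.
  by rewrite -(nrm2_conj v); exact: cauchy_schwarz.
rewrite sqrrD !l2norm_sqr addrAC lerD2r lerD2l.
by rewrite lerMn2r hs orbT.
Qed.

(** Norm bounds in pointwise form, which add and multiply without going through the supremum. *)
Definition bounded_by m n (k : R) (M : 'M[C]_(m, n)) : Prop :=
  forall v : 'cV[C]_n, l2norm (M *m v) <= k * l2norm v.

Lemma bounded_byD m n k l (M N : 'M[C]_(m, n)) :
  bounded_by k M -> bounded_by l N -> bounded_by (k + l) (M + N).
Proof.
move=> Mk Nl v; rewrite mulmxDl mulrDl.
by apply: (le_trans (l2normD _ _)); exact: lerD.
Qed.

Lemma bounded_byN m n k (M : 'M[C]_(m, n)) : bounded_by k M -> bounded_by k (- M).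
Proof. by move=> Mk v; rewrite mulNmx l2normN. Qed.

Lemma bounded_byB m n k l (M N : 'M[C]_(m, n)) :
  bounded_by k M -> bounded_by l N -> bounded_by (k + l) (M - N).
Proof. by move=> Mk Nl; apply: bounded_byD => //; exact: bounded_byN. Qed.

Lemma bounded_byM m n p k l (M : 'M[C]_(m, n)) (N : 'M[C]_(n, p)) : 0 <= k ->
  bounded_by k M -> bounded_by l N -> bounded_by (k * l) (M *m N).
Proof.
move=> k0 Mk Nl v; rewrite -mulmxA; apply: (le_trans (Mk _)).
by rewrite -mulrA ler_wpM2l.
Qed.

Lemma bounded_byW m n k l (M : 'M[C]_(m, n)) : k <= l ->
  bounded_by k M -> bounded_by l M.
Proof.
by move=> kl Mk v; apply: (le_trans (Mk v)); rewrite ler_wpM2r// l2norm_ge0.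
Qed.

Lemma bounded_isometry m n (M : 'M[C]_(m, n)) : M^t* *m M = 1%:M -> bounded_by 1 M.
Proof. by move=> MM v; rewrite mul1r !nrm2_l2norm nrm2_isometry. Qed.

Lemma opnorm_le m n k (M : 'M[C]_(m, n)) : 0 <= k -> bounded_by k M -> opnorm M <= k.
Proof.
move=> k0 Mk; apply: ge_sup.
  by exists (l2norm (M *m 0)), 0 => //=; rewrite /l2norm big1 ?sqrtr0// => i _; rewrite mxE cabs_sqr nsq0.
move=> _ [v /= v1 <-]; apply: (le_trans (Mk v)).
by rewrite -[leRHS]mulr1 ler_wpM2l.
Qed.

(** A crude bound by the trace of the Gram matrix; it makes the set behind [opnorm] bounded, so that
    its [sup] is meaningful. *)
Lemma bounded_gram m n (M : 'M[C]_(m, n)) : exists2 k, 0 <= k & bounded_by k M.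
Proof.
have s0 : 0 <= \sum_i gram_diag M i by apply: sumr_ge0 => i _; exact: gram_diag_ge0.
exists (Num.sqrt (\sum_i gram_diag M i)) => [|v]; first exact: sqrtr_ge0.
rewrite !nrm2_l2norm -sqrtrM//; rewrite ler_wsqrtr// nrm2_mulmx_gram mulr_suml.
apply: ler_sum => i _; rewrite ler_wpM2l ?gram_diag_ge0//.
rewrite (nrm2_gram_mx M) (bigD1 i)//= lerDl.
by apply: sumr_ge0 => j _; exact: nsq_ge0.
Qed.

Lemma has_sup_opnorm m n (M : 'M[C]_(m, n)) :
  has_sup [set l2norm (M *m v) | v in [set v : 'cV[C]_n | l2norm v <= 1]].
Proof.
split; first by exists (l2norm (M *m 0)), 0 => //=; rewrite /l2norm big1 ?sqrtr0// => i _; rewrite mxE cabs_sqr nsq0.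
have [k k0 Mk] := bounded_gram M; exists k => _ [v /= v1 <-].
by apply: (le_trans (Mk v)); rewrite -[leRHS]mulr1 ler_wpM2l.
Qed.

Lemma opnorm_ge0 m n (M : 'M[C]_(m, n)) : 0 <= opnorm M.
Proof.
have z1 : l2norm (0 : 'cV[C]_n) <= 1.
  by rewrite /l2norm big1 ?sqrtr0// => i _; rewrite mxE cabs_sqr nsq0.
apply: le_trans (ub_le_sup (proj2 (has_sup_opnorm M)) _); last by exists 0; [exact: z1|reflexivity].
exact: l2norm_ge0.
Qed.

Lemma bounded_opnorm m n (M : 'M[C]_(m, n)) : bounded_by (opnorm M) M.
Proof.
move=> v; have [->|v0] := eqVneq v 0.
  rewrite mulmx0 [leLHS](_ : _ = 0); first by rewrite mulr_ge0 ?opnorm_ge0 ?l2norm_ge0.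
  by apply/eqP; rewrite l2norm_eq0.
have nv : 0 < l2norm v by rewrite lt0r l2norm_eq0 v0 l2norm_ge0.
have cE : cabs ((l2norm v)^-1)%:C = (l2norm v)^-1.
  by rewrite cabs_nsq nsq_real sqrtr_sqr ger0_norm// invr_ge0 l2norm_ge0.
pose w := ((l2norm v)^-1)%:C *: v.
have w1 : l2norm w <= 1 by rewrite l2normZ cE mulVf// gt_eqF.
rewrite -ler_pdivrMr// mulrC -cE -l2normZ scalemxAr.
by apply: (ub_le_sup (proj2 (has_sup_opnorm M))); exists w.
Qed.

End operator_norm.

(** * Perturbation of isometries and of the QR factor *)

Section perturbation.
Context {R : realType}.
Local Notation C := R[i].

Lemma nrm2_delta m (i : 'I_m) : nrm2 (delta_mx i 0 : 'cV[C]_m) = 1.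
Proof.
rewrite /nrm2 (bigD1 i)//= big1 ?addr0; first by rewrite mxE !eqxx nsq1.
by move=> j ji; rewrite mxE (negPf ji) nsq0.
Qed.

Lemma gram_conj_mul m n (W : 'M[C]_(m, n)) :
  W^t* *m W = (gram_mx W)^t* *m diag_mx (\row_i (gram_diag W i)%:C) *m gram_mx W.
Proof.
rewrite gram_decomp; congr (_ *m diag_mx _ *m _); apply/rowP => i.
by rewrite mxE gram_diagE.
Qed.

(* W *m X is the isometric factor of the polar decomposition of W. *)
Lemma nearest_isometry m n (W : 'M[C]_(m, n)) (eta : R) : eta < 1 ->
  (forall v, (1 - eta) * l2norm v <= l2norm (W *m v)) ->
  (forall v, l2norm (W *m v) <= (1 + eta) * l2norm v) ->
  exists2 X : 'M[C]_n, (W *m X)^t* *m (W *m X) = 1%:M & bounded_by eta (W - W *m X).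
Proof.
move=> eta1 lo hi; pose Pm := gram_mx W; pose s i := Num.sqrt (gram_diag W i).
have uP : Pm \is unitarymx by exact: gram_unitary.
have PP : Pm *m Pm^t* = 1%:M by exact/unitarymxP.
have PP' : Pm^t* *m Pm = 1%:M by exact: unitary_conjtr_mul.
have sE i : s i = l2norm (W *m (Pm^t* *m delta_mx i 0)).
  rewrite nrm2_l2norm /s; congr Num.sqrt; rewrite nrm2_mulmx_gram -/Pm mulmxA PP mul1mx.
  rewrite (bigD1 i)//= big1; first by rewrite mxE !eqxx nsq1 mulr1 addr0.
  by move=> j ji; rewrite mxE (negPf ji) nsq0 mulr0.
have n1 i : l2norm (Pm^t* *m delta_mx i 0) = 1.
  by rewrite nrm2_l2norm nrm2_isometry ?nrm2_delta ?sqrtr1// trmxCK.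
have s_lo i : 1 - eta <= s i by have := lo (Pm^t* *m delta_mx i 0); rewrite -sE n1 mulr1.
have s_hi i : s i <= 1 + eta by have := hi (Pm^t* *m delta_mx i 0); rewrite -sE n1 mulr1.
have s_gt0 i : 0 < s i by apply: lt_le_trans (s_lo i); rewrite subr_gt0.
pose dg (f : 'I_n -> R) : 'M[C]_n := diag_mx (\row_i (f i)%:C).
have dgM f g : dg f *m dg g = dg (fun i => f i * g i).
  apply/matrixP => i j; rewrite mul_diag_mx !mxE; case: eqP => _; last by rewrite !mulr0n mulr0.
  by rewrite !mulr1n rmorphM.
have dg1 f : (forall i, f i = 1) -> dg f = 1%:M.
  by move=> f1; apply/matrixP => i j; rewrite !mxE f1; case: eqP.
have dgC f : (dg f)^t* = dg f.
  apply/matrixP => i j; rewrite !mxE eq_sym; case: eqP => [->|_]; last by rewrite !mulr0n rmorph0.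
  by rewrite !mulr1n; exact: conjc_real.
have QC : (Pm^t*)^t* = Pm by exact: trmxCK.
have isoQ v : nrm2 (Pm^t* *m v) = nrm2 v by rewrite nrm2_isometry// trmxCK.
have gW := gram_conj_mul W; rewrite -/Pm in gW.
move: (Pm^t*) PP PP' QC isoQ gW => Q PP PP' QC isoQ gW.
have QC' : Pm^t* = Q by rewrite -QC trmxCK.
(* Functional calculus for the Gram matrix of W in its eigenbasis: products and differences of [Y f]
   are pointwise in f. *)
pose Y f : 'M[C]_n := Q *m dg f *m Pm.
have YM f g : Y f *m Y g = Y (fun i => f i * g i).
  by rewrite /Y -dgM !mulmxA -!(mulmxA _ Pm Q) PP mulmx1.
have Y1 f : (forall i, f i = 1) -> Y f = 1%:M by move=> f1; rewrite /Y dg1// mulmx1.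
have YB f g : Y f - Y g = Y (fun i => f i - g i).
  rewrite /Y -(mulmxBl _ _ Pm) -(mulmxBr Q) /dg -linearB; congr (Q *m diag_mx _ *m Pm).
  by apply/rowP => i; rewrite !mxE rmorphB.
have WW : W^t* *m W = Y (fun i => s i ^+ 2).
  rewrite gW; congr (_ *m _ *m _); congr diag_mx; apply/rowP => i.
  by rewrite !mxE sqr_sqrtr// gram_diag_ge0.
pose X := Y (fun i => (s i)^-1).
(* X is the inverse square root of the Gram matrix of W, hence self-adjoint. *)
have XC : X^t* = X by rewrite /X /Y 2!mulmx_conjtr dgC QC' QC mulmxA.
have iso : (W *m X)^t* *m (W *m X) = 1%:M.
  rewrite mulmx_conjtr XC -mulmxA (mulmxA (W^t*)) WW !YM Y1// => i.
  by field; rewrite gt_eqF.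
exists X => // v.
(* An isometry times a matrix with eigenvalues s_i - 1, all of modulus at most eta. *)
have -> : W - W *m X = (W *m X) *m Y (fun i => s i - 1).
  rewrite -{1}(mulmx1 W) -(Y1 (fun=> 1))// -mulmxBr YB -mulmxA YM; congr (_ *m Y _).
  by apply/funext => i; field; rewrite gt_eqF.
rewrite -mulmxA !nrm2_l2norm (nrm2_isometry _ iso) /Y -!mulmxA isoQ.
(* For negative eta the two bounds on s_i are contradictory, so W has no columns. *)
have [eta0|eta0] := leP 0 eta; last first.
  have no (i : 'I_n) : False by have := le_trans (s_lo i) (s_hi i); lra.
  by rewrite /nrm2 !big1 ?sqrtr0 ?mulr0// => i; case: (no i).
rewrite -[eta]ger0_norm// -sqrtr_sqr -sqrtrM ?sqr_ge0// ler_wsqrtr//.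
rewrite -(nrm2_unitary v uP) /nrm2 mulr_sumr; apply: ler_sum => i _.
rewrite mul_diag_mx !mxE nsqM nsq_real ler_wpM2r ?nsq_ge0//.
rewrite -[X in X <= _]real_normK ?num_real// lerXn2r ?nnegrE//.
by rewrite ler_norml; apply/andP; split; [have := s_lo i|have := s_hi i]; lra.
Qed.

End perturbation.

Section deflate_perturbation.
Context {R : realType}.
Local Notation C := R[i].

Lemma first_colsE n r (hrn : (r <= n)%N) (X : 'M[C]_n) :
  first_cols hrn X = X *m first_cols hrn 1%:M.
Proof. by rewrite /first_cols mulmx_colsub mulmx1. Qed.

Lemma first_cols_isometry n r (hrn : (r <= n)%N) :
  (first_cols hrn (1%:M : 'M[C]_n))^t* *m first_cols hrn 1%:M = 1%:M.
Proof.
apply/matrixP => i j; rewrite !mxE (bigD1 (widen_ord hrn i))//= big1.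
  rewrite !mxE eqxx rmorph1 mul1r addr0.
  by congr (nat_of_bool _)%:R; apply/eqP/eqP => [/(congr1 val) /= h|->//]; exact: val_inj.
by move=> k /negPf ki; rewrite !mxE ki rmorph0 mul0r.
Qed.

(** Upper triangularity confines the first r columns of T to the first r rows; T1 is the leading
    block. *)
Lemma first_cols_trig n r (hrn : (r <= n)%N) (T : 'M[C]_n) : is_trig_mx T^T ->
  exists T1 : 'M[C]_r, T *m first_cols hrn 1%:M = first_cols hrn 1%:M *m T1.
Proof.
move=> /is_trig_mxP tT.
exists (\matrix_(i, j) T (widen_ord hrn i) (widen_ord hrn j)).
rewrite -first_colsE; apply/matrixP => i j; rewrite [LHS]mxE [RHS]mxE.
have [ir|ri] := ltnP i r.
  rewrite (bigD1 (Ordinal ir))//= big1 ?addr0.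
    by rewrite !mxE (_ : widen_ord hrn (Ordinal ir) = i) ?eqxx ?mul1r//; exact: val_inj.
  move=> k /eqP ki; rewrite !mxE; case: eqP => [ik|]; last by rewrite mul0r.
  by case: ki; apply: val_inj; have /= := congr1 val ik.
rewrite big1.
  have := tT (widen_ord hrn j) i; rewrite mxE; apply.
  exact: leq_trans (ltn_ord j) ri.
move=> k _; rewrite !mxE; case: eqP => [ik|]; last by rewrite mul0r.
by move: ri; rewrite ik /= leqNgt ltn_ord.
Qed.

Lemma unitmx_inj m (M : 'M[C]_m) : (forall v : 'cV[C]_m, M *m v = 0 -> v = 0) -> M \in unitmx.
Proof.
move=> inj; rewrite -unitmx_tr -row_free_unit; apply: inj_row_free => v vM.
by apply: trmx_inj; rewrite trmx0; apply: inj; rewrite -[M]trmxK -trmx_mul vM trmx0.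
Qed.

(** The inclusion given by U = A X is an equality by rank count; the transposes pass to row
    spaces. *)
Lemma isometry_mxrange n r (A : 'M[C]_n) (U : 'M[C]_(n, r)) (X : 'M[C]_(n, r)) :
  \rank A = r -> U^t* *m U = 1%:M -> U = A *m X -> mxrange U = mxrange A.
Proof.
move=> rA UU UE.
have rU : \rank U = r.
  apply/eqP; rewrite eqn_leq rank_leq_col /=.
  by rewrite -{1}(mxrank1 C r) -UU mxrankM_maxr.
have sub : (U^T <= A^T)%MS by rewrite UE trmx_mul submxMl.
have /submxP[Y YE] : (A^T <= U^T)%MS.
  by rewrite -(geq_leqif (mxrank_leqif_sup sub)) !mxrank_tr rA rU.
have AE : A = U *m Y^T by rewrite -[A]trmxK YE trmx_mul trmxK.
apply/seteqP; split => _ [v _ <-].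
  by exists (X *m v) => //; rewrite mulmxA -UE.
by exists (Y^T *m v) => //; rewrite mulmxA -AE.
Qed.

(** Let S select the first r columns, so that A' S = Q' S T1. As |T1 v| >= (m0 - delta) |v|,
    dividing by T1 turns the error delta into eta = delta / (m0 - delta) between Q' S and W = A G S
    T1^-1. Since Q' S is isometric, the singular values of W lie within eta of 1, and its isometric
    factor costs another eta: hence the factor 2. The condition 2 delta < m0 says eta < 1. *)
Lemma deflate_perturbation n r (hrn : (r <= n)%N) (A G A' Q' Q T : 'M[C]_n)
    (a delta m0 : R) :
  \rank A = r -> Q' \is unitarymx -> Q'^t* *m A' = T -> is_trig_mx T^T ->
  bounded_by delta (A' - A *m G) -> 0 <= delta -> 0 <= a ->
  (forall v, m0 * l2norm v <= l2norm (A *m G *m first_cols hrn 1%:M *m v)) ->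
  2 * delta < m0 -> bounded_by a (Q - Q') ->
  exists U : 'M[C]_(n, r), [/\ U^t* *m U = 1%:M, mxrange U = mxrange A &
    opnorm (first_cols hrn Q - U) <= a + 2 * (delta / (m0 - delta))].
Proof.
move=> rA uQ QA tT hd d0 a0 hm dm hQ.
have [T1 TE] := first_cols_trig hrn tT.
set S := first_cols hrn 1%:M in hm TE *.
have SS : S^t* *m S = 1%:M by exact: first_cols_isometry.
have A'E : A' *m S = Q' *m S *m T1.
  rewrite -mulmxA -TE -QA !mulmxA (_ : Q' *m Q'^t* = 1%:M) ?mul1mx//.
  exact/unitarymxP.
have md : 0 < m0 - delta by lra.
pose eta := delta / (m0 - delta).
have eta0 : 0 <= eta by rewrite divr_ge0// ltW.
have eta1 : eta < 1 by rewrite ltr_pdivrMr//; lra.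
have nQS (v : 'cV[C]_r) : l2norm (Q' *m S *m v) = l2norm v.
  by rewrite !nrm2_l2norm -mulmxA nrm2_unitary// nrm2_isometry.
have dS (v : 'cV[C]_r) : l2norm (A' *m S *m v - A *m G *m S *m v) <= delta * l2norm v.
  rewrite -mulmxBl -mulmxBl -mulmxA; apply: (le_trans (hd _)).
  by rewrite !nrm2_l2norm nrm2_isometry.
have T1_lo (v : 'cV[C]_r) : (m0 - delta) * l2norm v <= l2norm (T1 *m v).
  rewrite -(nQS (T1 *m v)) mulmxA -A'E mulrBl lerBlDr; apply: (le_trans (hm v)).
  rewrite -[X in l2norm X <= _](subrK (A' *m S *m v)) addrC.
  by apply: (le_trans (l2normD _ _)); rewrite lerD2l -l2normN opprB.
have uT : T1 \in unitmx.
  apply: unitmx_inj => v Tv; apply/eqP; rewrite -l2norm_eq0 eq_le l2norm_ge0 andbT.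
  rewrite -(pmulr_rle0 _ md); apply: (le_trans (T1_lo v)); rewrite Tv.
  by rewrite le_eqVlt l2norm_eq0 eqxx.
pose W := A *m G *m S *m invmx T1.
have hW : bounded_by eta (Q' *m S - W).
  move=> v; rewrite -(mulKVmx uT v); move: (invmx T1 *m v) => y.
  rewrite mulmxBl /W !mulmxA mulmxKV// -A'E; apply: (le_trans (dS y)).
  rewrite /eta mulrAC ler_pdivlMr// -mulrA ler_wpM2l// mulrC; exact: T1_lo.
have [X XX hX] : exists2 X : 'M[C]_r, (W *m X)^t* *m (W *m X) = 1%:M &
    bounded_by eta (W - W *m X).
  apply: (nearest_isometry eta1) => v.
    rewrite mulrBl mul1r lerBlDr -{1}(nQS v) -{1}[Q' *m S *m v](subrK (W *m v)) addrC.
    by apply: (le_trans (l2normD _ _)); rewrite lerD2l -mulmxBl.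
  rewrite mulrDl mul1r -{1}(nQS v) -{1}[W *m v](subrK (Q' *m S *m v)) addrC.
  by apply: (le_trans (l2normD _ _)); rewrite lerD2l -l2normN opprB -mulmxBl.
exists (W *m X); split => //.
  by apply: (isometry_mxrange (X := G *m S *m invmx T1 *m X)) => //; rewrite /W !mulmxA.
apply: opnorm_le; first by rewrite addr_ge0// mulr_ge0.
have -> : first_cols hrn Q - W *m X = (Q - Q') *m S + ((Q' *m S - W) + (W - W *m X)).
  by rewrite first_colsE -/S mulmxBl !addrA !subrK.
rewrite -[a]mulr1 mulrDl mul1r -/eta; apply: bounded_byD; last exact: bounded_byD.
by apply: bounded_byM => //; exact: bounded_isometry.
Qed.

End deflate_perturbation.

(** * Sorted singular values *)

Section singular_value_rows.
Context {R : realType}.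
Local Notation C := R[i].

Lemma singular_values_sorted n (A : 'M[C]_n) :
  sorted (fun a b : R => b <= a) (singular_values A).
Proof. by apply: sort_sorted => a b; exact: le_total. Qed.

Lemma size_singular_values n (A : 'M[C]_n) : size (singular_values A) = n.
Proof. by rewrite size_sort size_map -cardE card_ord. Qed.

Lemma nth_singular_values n (A : 'M[C]_n) (j k : nat) : (j <= k)%N -> (k < n)%N ->
  nth 0 (singular_values A) k <= nth 0 (singular_values A) j.
Proof.
move=> jk kn; apply: (sorted_leq_nth _ _ 0 (singular_values_sorted A)) => //.
- by move=> a b e ba /le_trans; exact.
- by rewrite inE size_singular_values (leq_ltn_trans jk).
- by rewrite inE size_singular_values.
Qed.

Lemma sigma_ge0 k n (A : 'M[C]_n) : 0 <= sigma k A.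
Proof.
rewrite /sigma; have [kn|nk] := ltnP k.-1 (size (singular_values A)).
  have := mem_nth 0 kn; rewrite mem_sort => /mapP[i _ ->]; exact: sqrtr_ge0.
by rewrite nth_default.
Qed.

Lemma gram_diag_sigma n (A : 'M[C]_n) i : gram_diag A i <= sigma 1 A ^+ 2.
Proof.
have h : Num.sqrt (gram_diag A i) \in singular_values A.
  by rewrite mem_sort; apply/mapP; exists i => //; rewrite mem_enum.
rewrite -[X in X <= _]sqr_sqrtr ?gram_diag_ge0//.
rewrite lerXn2r ?nnegrE ?sqrtr_ge0 ?sigma_ge0//.
rewrite -(nth_index 0 h); apply: nth_singular_values => //.
by rewrite -[X in (_ < X)%N](size_singular_values A) index_mem.
Qed.

Lemma bounded_sigma n (A : 'M[C]_n) : bounded_by (sigma 1 A) A.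
Proof.
move=> v; rewrite -[sigma 1 A]ger0_norm ?sigma_ge0// -sqrtr_sqr !nrm2_l2norm.
rewrite -sqrtrM ?sqr_ge0// ler_wsqrtr// nrm2_mulmx_gram (nrm2_gram_mx A) mulr_sumr.
by apply: ler_sum => i _; rewrite ler_wpM2r ?nsq_ge0// gram_diag_sigma.
Qed.

Lemma sigma_le r n (A : 'M[C]_n) : (r <= n)%N -> sigma r A <= sigma 1 A.
Proof.
case: n A => [|n] A rn; last by apply: nth_singular_values => //; case: r rn.
by rewrite /sigma !nth_default// size_singular_values.
Qed.

(* The rows of W are right singular vectors of A. *)
Lemma singular_rows r n (A : 'M[C]_n) : (r <= n)%N ->
  exists2 W : 'M[C]_(r, n), W \is unitarymx &
    forall v, sigma r A * l2norm (W *m v) <= l2norm (A *m v).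
Proof.
move=> rn; pose p := fun y : R => sigma r A <= y.
pose I := [set i : 'I_n | p (Num.sqrt (gram_diag A i))]%SET.
(* The first r entries of the sorted list are at least [sigma r A], so at least r indices qualify;
   ties may add more, and [f] picks r of them. *)
have rI : (r <= #|I|)%N.
  have -> : #|I| = count p (singular_values A).
    rewrite (permP (permEl (perm_sort _ _))) count_map cardE [in LHS]/enum_mem size_filter.
    by rewrite -enumT; apply: eq_count => i; rewrite /= inE.
  rewrite -(cat_take_drop r (singular_values A)) count_cat.
  apply: leq_trans (leq_addr _ _); rewrite -{1}(size_takel (s := singular_values A) (n0 := r)).
    rewrite leq_eqVlt eq_sym -all_count; apply/orP; left.
    apply/(all_nthP 0) => j; rewrite size_takel ?size_singular_values// => jr.
    rewrite nth_take// /p /sigma; apply: nth_singular_values.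
      by rewrite -ltnS prednK// (leq_ltn_trans _ jr).
    by rewrite prednK// (leq_ltn_trans _ jr).
  by rewrite size_singular_values.
pose f (k : 'I_r) : 'I_n := enum_val (widen_ord rI k).
have f_inj : injective f.
  by move=> k l /enum_val_inj/(congr1 val) /= kl; exact: val_inj.
have fP k : sigma r A <= Num.sqrt (gram_diag A (f k)).
  by have := enum_valP (widen_ord rI k); rewrite inE.
exists (rowsub f (gram_mx A)) => [|v].
  apply/unitarymxP/matrixP => k l.
  have /matrixP/(_ (f k) (f l)) := unitarymxP (gram_unitary A).
  rewrite !mxE (inj_eq f_inj) => <-.
  by apply: eq_bigr => j _; rewrite !mxE.
rewrite -[sigma r A]ger0_norm ?sigma_ge0// -sqrtr_sqr !nrm2_l2norm.
rewrite -sqrtrM ?sqr_ge0// ler_wsqrtr// (nrm2_mulmx_gram A).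
pose F i := gram_diag A i * nsq ((gram_mx A *m v) i 0).
apply: (@le_trans _ _ (\sum_k F (f k))).
  rewrite /nrm2 mulr_sumr; apply: ler_sum => k _.
  rewrite mul_rowsub_mx mxE ler_wpM2r ?nsq_ge0//.
  rewrite -[leRHS]sqr_sqrtr ?gram_diag_ge0//.
  by rewrite lerXn2r ?nnegrE ?sqrtr_ge0 ?sigma_ge0.
have -> : \sum_k F (f k) = \sum_(i in f @: [set: 'I_r]%SET) F i.
  rewrite big_imset /=; last by move=> k l _ _; exact: f_inj.
  by apply: eq_bigl => k; rewrite inE.
rewrite [leRHS](bigID (fun i => i \in f @: [set: 'I_r]%SET)) /= lerDl.
by apply: sumr_ge0 => i _; rewrite mulr_ge0 ?gram_diag_ge0 ?nsq_ge0.
Qed.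

End singular_value_rows.

(** Everything is measured by D / y, with D = K beta (s1 + 2) and y = sr x, which the last
    hypothesis bounds by 1/5. The pieces are a <= 0.18 D / y and delta / (m0 - delta) <= 2.91 D / y,
    and 0.18 + 2 * 2.91 = 6. *)
Lemma deflate_constants (R : realType) (a b c beta K x s1 sr : R) :
  0 <= a -> 0 <= b -> 0 <= c -> 0 < beta -> 4 * a + 2 * b + 2 * c <= beta ->
  0 < x -> 2 * x <= K -> 0 < sr -> sr <= s1 ->
  K * beta * (s1 + 2) <= sr * x / 5 ->
  let delta := ((a * (1 + c) + c) * (s1 + beta) + beta) * ((1 + b) * K) in
  let m0 := sr * (2 / 5 * x - b * K) in
  [/\ 0 <= delta, 2 * delta < m0 &
    a + 2 * (delta / (m0 - delta)) <= 6 * ((s1 + 2) / sr) * (K / x) * beta].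
Proof.
move=> a0 b0 c0 beta0 abc x0 xK sr0 sr1 hD.
have K0 : 0 < K by lra.
have s0 : 0 < s1 + 2 by lra.
pose D := K * beta * (s1 + 2); pose y := sr * x.
have y0 : 0 < y by rewrite mulr_gt0.
have D0 : 0 < D by rewrite !mulr_gt0.
have Dy : D <= y / 5 by [].
have yK : y <= (s1 + 2) * (K / 2) by apply: ler_pM; lra.
(* D <= y/5 and y <= (s1 + 2) K / 2 together leave no room for a larger beta. *)
have beta1 : beta <= 1 / 10.
  have h : K * (s1 + 2) * beta <= K * (s1 + 2) * (1 / 10).
    rewrite mulrAC; apply: (le_trans hD); rewrite -/y; lra.
  by rewrite ler_pM2l ?mulr_gt0// in h.
have h2 : a <= 18 / 100 * (D / y).
  apply: (@le_trans _ _ (beta / 4)); first by lra.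
  rewrite mulrA ler_pdivlMr//.
  have : beta * y <= beta * ((s1 + 2) * (K / 2)) by rewrite ler_pM2l.
  by clear -D0; rewrite /D in D0 *; lra.
have bD : sr * (b * K) <= D / 2.
  have -> : D / 2 = (s1 + 2) * (beta / 2 * K) by rewrite /D; ring.
  by apply: ler_pM; [lra|exact: mulr_ge0 b0 (ltW K0)|lra|rewrite ler_pM2r//; lra].
have rhoE : 6 * ((s1 + 2) / sr) * (K / x) * beta = 6 * (D / y).
  by rewrite /D /y; field; rewrite !gt_eqF.
have b1 : 1 + b <= 21 / 20 by lra.
have b10 : 0 <= 1 + b by lra.
have s10 : 0 <= s1 by lra.
have e1 : a * (1 + c) + c <= beta / 2.
  have : a * (1 + c) <= a * 2 by apply: ler_wpM2l => //; lra.
  lra.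
have e10 : 0 <= a * (1 + c) + c by rewrite addr_ge0// mulr_ge0//; lra.
have e2 : (a * (1 + c) + c) * (s1 + beta) + beta <= 21 / 40 * beta * (s1 + 2).
  have sb : 0 <= s1 + beta by rewrite addr_ge0// ltW.
  have := ler_wpM2r sb e1.
  have : beta * beta <= beta * (1 / 10) by rewrite ler_pM2l.
  have : 0 <= beta * s1 by rewrite mulr_ge0// ltW.
  clear; lra.
have e20 : 0 <= (a * (1 + c) + c) * (s1 + beta) + beta.
  by rewrite addr_ge0 ?(ltW beta0)// mulr_ge0// addr_ge0// ltW.
move=> delta m0.
have d0 : 0 <= delta by rewrite !mulr_ge0// ltW.
(* 21/40 collects the input and rounding errors, 21/20 bounds 1 + b; their product is 441/800. *)
have dD : delta <= 441 / 800 * D.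
  have -> : 441 / 800 * D = (21 / 40 * beta * (s1 + 2)) * (21 / 20 * K) by rewrite /D; field.
  by apply: ler_pM => //; [rewrite mulr_ge0// ltW|rewrite ler_pM2r].
have mD : 2 / 5 * y - D / 2 <= m0.
  have -> : m0 = 2 / 5 * y - sr * (b * K) by rewrite /m0 /y; ring.
  by rewrite lerD2l lerN2.
rewrite rhoE; move: m0 delta D y h2 d0 dD mD y0 D0 Dy {rhoE yK bD hD} => m0 delta D y.
clear -a0; move=> h2 d0 dD mD y0 D0 Dy.
split => //; first by lra.
have q0 : 0 < m0 - delta by lra.
(* By D <= y/5, m0 - delta >= (2/5) y - (1/2 + 441/800) D >= 0.1897 y. *)
have h1 : delta / (m0 - delta) <= 291 / 100 * (D / y).
  rewrite ler_pdivrMr// -mulrA.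
  have : D / y * (1897 / 10000 * y) <= D / y * (m0 - delta).
    by apply: ler_wpM2l; [rewrite divr_ge0// ltW|lra].
  rewrite mulrCA divfK ?gt_eqF//; move: dD D0; clear; lra.
move: h1 h2; clear; lra.
Qed.

(** * Transfer of events through the coupling *)

Section coupling.
Context {R : realType}.
Local Notation CM := (measurableTypeR R * measurableTypeR R)%type.
Local Notation C := R[i].

Lemma violated_upper m n (k : R) (M : 'M[C]_(m, n)) : 0 <= k ->
  ~ violated (-1) (k ^+ 2) M <-> bounded_by k M.
Proof.
move=> k0; have E v : (l2norm (M *m v) <= k * l2norm v) = (0 <= -1 * nrm2 (M *m v) + k ^+ 2 * nrm2 v).
  rewrite -(@ler_pXn2r _ 2)// ?nnegrE ?mulr_ge0 ?l2norm_ge0// exprMn !l2norm_sqr.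
  by rewrite mulN1r addrC subr_ge0.
split=> [nv v|b [v]]; last by rewrite ltNge -E b.
by rewrite E leNgt; apply/negP => h; apply: nv; exists v.
Qed.

Lemma violated_lower m n (k : R) (M : 'M[C]_(m, n)) : 0 <= k ->
  ~ violated 1 (- k ^+ 2) M <-> forall v, k * l2norm v <= l2norm (M *m v).
Proof.
move=> k0; have E v : (k * l2norm v <= l2norm (M *m v)) = (0 <= 1 * nrm2 (M *m v) - k ^+ 2 * nrm2 v).
  rewrite -(@ler_pXn2r _ 2)// ?nnegrE ?mulr_ge0 ?l2norm_ge0// exprMn !l2norm_sqr.
  by rewrite mul1r subr_ge0.
split=> [nv v|b [v]]; last by rewrite mulNr ltNge -E b.
by rewrite E leNgt; apply/negP => h; apply: nv; exists v; rewrite mulNr.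
Qed.

(** The difference |v|^2 - |W v|^2 is the squared norm of v - W^* W v. *)
Lemma l2norm_coisometry m n (W : 'M[C]_(m, n)) (v : 'cV[C]_n) :
  W \is unitarymx -> l2norm (W *m v) <= l2norm v.
Proof.
move=> /unitarymxP WW; rewrite !nrm2_l2norm ler_wsqrtr// -subr_ge0.
have := erefl (W *m v); move: {1 3}(W *m v) => X XE.
have -> : nrm2 v - nrm2 X = nrm2 (v - W^t* *m X); last exact: nrm2_ge0.
apply: (@complexI R); rewrite rmorphB /= -!nrm2E.
have vE : (v - W^t* *m X)^t* = v^t* - X^t* *m W.
  by rewrite linearB /= map_mxB mulmx_conjtr trmxCK.
have vX : v^t* *m W^t* = X^t* by rewrite XE mulmx_conjtr.
have -> : (v - W^t* *m X)^t* *m (v - W^t* *m X) = v^t* *m v - X^t* *m X.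
  rewrite vE mulmxBl !mulmxBr -!mulmxA -XE (mulmxA W) WW mul1mx.
  by rewrite (mulmxA (v^t*)) vX subrr subr0.
by move: (_^t* *m _) (_^t* *m _) => a b; rewrite !mxE.
Qed.

(** The Frobenius norm of D is at most k times that of G, and each of the n columns of G has norm at
    most g; hence the factor sqrt n. *)
Lemma bounded_entrywise m n (D G : 'M[C]_(m, n)) (k g : R) : 0 <= k -> 0 <= g ->
  (forall i j, cabs (D i j) <= k * cabs (G i j)) -> bounded_by g G ->
  bounded_by (Num.sqrt n%:R * k * g) D.
Proof.
move=> k0 g0 DG gG v.
have colG j : \sum_i nsq (G i j) <= g ^+ 2.
  have := gG (delta_mx j 0); rewrite -colE !nrm2_l2norm nrm2_delta sqrtr1 mulr1.
  rewrite -(@ler_pXn2r _ 2)// ?nnegrE ?sqrtr_ge0// sqr_sqrtr ?nrm2_ge0//.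
  by rewrite /nrm2; under eq_bigr do rewrite mxE.
have Dij i j : nsq (D i j) <= k ^+ 2 * nsq (G i j).
  rewrite -!cabs_sqr -exprMn lerXn2r ?nnegrE ?mulr_ge0//;
    by rewrite cabs_nsq sqrtr_ge0.
rewrite -(@ler_pXn2r _ 2)// ?nnegrE ?mulr_ge0 ?l2norm_ge0 ?sqrtr_ge0//.
rewrite !exprMn !l2norm_sqr sqr_sqrtr ?ler0n//.
apply: (@le_trans _ _ (\sum_i (\sum_j nsq (D i j)) * nrm2 v)).
  apply: ler_sum => i _; rewrite mxE.
  have := cauchy_schwarz (row i D)^T v; rewrite /nrm2.
  under eq_bigr do rewrite !mxE.
  by under [X in _ <= X * _]eq_bigr do rewrite !mxE.
rewrite -mulr_suml ler_wpM2r ?nrm2_ge0// exchange_big /=.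
apply: (@le_trans _ _ (\sum_(j < n) k ^+ 2 * g ^+ 2)).
  apply: ler_sum => j _; apply: (@le_trans _ _ (k ^+ 2 * \sum_i nsq (G i j))).
    by rewrite mulr_sumr; apply: ler_sum.
  by rewrite ler_wpM2l ?sqr_ge0.
by rewrite sumr_const card_ord -[leLHS]mulr_natl mulrA.
Qed.

Definition map_tuple2 T T' m n (f : T -> T') (z : m.-tuple (n.-tuple T)) :
    m.-tuple (n.-tuple T') := map_tuple (map_tuple f) z.

Lemma iid_map_tuple2 d d' (T : measurableType d) (T' : measurableType d')
    (mu : probability T R) (nu : probability T' R) (f : T -> T') m n A :
  measurable_fun [set: T] f ->
  (forall B, measurable B -> mu (f @^-1` B) = nu B) -> measurable A ->
  iid (iid mu n) m (@map_tuple2 _ _ m n f @^-1` A) = iid (iid nu n) m A.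
Proof.
move=> mf fE mA.
apply: (iid_map (mu := iid mu n) (nu := iid nu n) (measurable_map_tuple mf)) => // B mB.
exact: iid_map.
Qed.

Lemma measurable_map_tuple2 d d' (T : measurableType d) (T' : measurableType d')
    (f : T -> T') m n (A : set (m.-tuple (n.-tuple T'))) :
  measurable_fun [set: T] f -> measurable A ->
  measurable (@map_tuple2 _ _ m n f @^-1` A).
Proof.
move=> mf mA; rewrite -[X in measurable X]setTI.
by apply: (measurable_map_tuple (measurable_map_tuple mf)).
Qed.

(** An independent copy of [kappa] for every entry couples the two matrix laws, and almost surely
    all entries lie in [S]. *)
Lemma coupling_transfer d (T : measurableType d) (mu nu : probability T R)
    (kappa : probability (T * T)%type R) (S : set (T * T)) m n
    (A B : set (m.-tuple (n.-tuple T))) :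
  (forall D, measurable D -> kappa (fst @^-1` D) = mu D) ->
  (forall D, measurable D -> kappa (snd @^-1` D) = nu D) ->
  measurable S -> kappa S = 1%E -> measurable A -> measurable B ->
  (forall z : m.-tuple (n.-tuple (T * T)), box2 (fun _ _ => S) z ->
     A (map_tuple2 fst z) -> B (map_tuple2 snd z)) ->
  (iid (iid mu n) m A <= iid (iid nu n) m B)%E.
Proof.
move=> k1 k2 mS kS mA mB AB; pose Q := iid (iid kappa n) m.
have mBox : measurable (box2 (m := m) (n := n) (fun _ _ => S)).
  rewrite (_ : box2 _ = box (fun _ => box (fun _ => S)))//.
  by apply: measurable_box => j; exact: measurable_box.
have QS : Q (~` box2 (fun _ _ => S)) = 0%E.
  rewrite probability_setC//= iid2_box//.
  by rewrite big1 ?subee// => j _; rewrite big1.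
have m1 : measurable_fun [set: T * T] fst by exact: measurable_fst.
have m2 : measurable_fun [set: T * T] snd by exact: measurable_snd.
have mA' := measurable_map_tuple2 m1 mA.
have mB' := measurable_map_tuple2 m2 mB.
rewrite -(iid_map_tuple2 m1 k1 mA) -(iid_map_tuple2 m2 k2 mB).
apply: (@le_trans _ _ (Q (map_tuple2 snd @^-1` B `|` ~` box2 (fun _ _ => S)))).
  apply: le_measure; rewrite ?inE//; first by apply: measurableU => //; exact: measurableC.
  by move=> z Az; case: (pselect (box2 (fun _ _ => S) z)) => Sz; [left; exact: AB|right].
apply: (le_trans (measureU2 _ _ _)) => //; first exact: measurableC.
by rewrite [X in (_ + X)%E]QS adde0.
Qed.

End coupling.

(** * Explicit tail bounds and the law of the calls *)

Section deflate_event.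
Context {R : realType}.
Local Notation CM := (measurableTypeR R * measurableTypeR R)%type.
Local Notation C := R[i].

Lemma sqrt2_bounds : 7 / 5 <= Num.sqrt 2 :> R /\ Num.sqrt 2 <= 3 / 2 :> R.
Proof.
have h : Num.sqrt 2 ^+ 2 = 2 :> R by rewrite sqr_sqrtr.
have h0 : 0 <= Num.sqrt 2 :> R by exact: sqrtr_ge0.
by split; rewrite -(@ler_pXn2r _ 2)// ?nnegrE ?h//; lra.
Qed.

(* With e = 1/(10+3t), the factor (10+3t)^(2(n-1)) lost in [norm_tail] is
   absorbed because (1-e)^2 (2 sqrt 2 + t)^2 >= t^2 + 2 ln(10+3t). *)
Lemma norm_tail_exponent (t : R) : 0 < t ->
  let e := (10 + 3 * t)^-1 in
  2 * (16 / 5 + 12 / 5 * t) + t ^+ 2 <= (1 - e) ^+ 2 * (2 * Num.sqrt 2 + t) ^+ 2 /\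
  10 + 3 * t <= expR (16 / 5 + 12 / 5 * t).
Proof.
move=> t0 e; have [s1 s2] := sqrt2_bounds.
have y0 : 0 < 10 + 3 * t by lra.
have e0 : 0 < e by rewrite invr_gt0.
have ey : e * (10 + 3 * t) = 1 by rewrite mulVf// gt_eqF.
split.
  have kE : (2 * Num.sqrt 2 + t) ^+ 2 = 8 + 4 * Num.sqrt 2 * t + t ^+ 2 :> R.
    by rewrite sqrrD exprMn sqr_sqrtr//; ring.
  rewrite kE; set q := 8 + _ + _.
  have q0 : 0 <= q by rewrite !addr_ge0 ?mulr_ge0 ?sqrtr_ge0 ?sqr_ge0//; lra.
  have st1 : 7 / 5 * t <= Num.sqrt 2 * t by rewrite ler_pM2r.
  have st2 : Num.sqrt 2 * t <= 3 / 2 * t by rewrite ler_pM2r.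
  have tt : 0 <= t ^+ 2 by exact: sqr_ge0.
  (* Since (1 - e)^2 q >= q - 2 e q and sqrt 2 >= 7/5, at least 32/5 + (24/5) t + t^2 remains; half
     of its affine part is the exponent 16/5 + (12/5) t. *)
  have eq : e * q <= 4 / 5 + 2 / 5 * t.
    have -> : 4 / 5 + 2 / 5 * t = e * ((10 + 3 * t) * (4 / 5 + 2 / 5 * t)).
      by rewrite mulrA ey mul1r.
    rewrite ler_pM2l// /q; lra.
  have -> : (1 - e) ^+ 2 * q = q - 2 * (e * q) + e ^+ 2 * q by ring.
  have : 0 <= e ^+ 2 * q by rewrite mulr_ge0// sqr_ge0.
  rewrite {2}/q; lra.
(* exp(16/5) >= (1 + 1/10)^32 >= 10. *)
have h : 10 <= expR (16 / 5) :> R.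
  have : (1 + 10^-1 : R) ^+ 32 <= expR (10^-1) ^+ 32.
    by rewrite lerXn2r ?nnegrE ?expR_ge0 ?expR_ge1Dx//; lra.
  rewrite -expRM_natl (_ : 32%:R * 10^-1 = 16 / 5 :> R); last by field.
  apply: le_trans; rewrite -[leLHS]mul1r.
  lra.
rewrite expRD; apply: (@le_trans _ _ (10 * (1 + 12 / 5 * t))); first by lra.
by apply: ler_pM => //; [lra|exact: expR_ge1Dx].
Qed.

Lemma gaussian_norm_tail n (t : R) : (0 < n)%N -> 0 < t ->
  (iid (iid (@cgm R) n) n
     [set z | violated (-1) (((2 * Num.sqrt 2 + t) * Num.sqrt n%:R) ^+ 2) (gmat z)]
   <= (expR (- (n%:R * t ^+ 2)))%:E)%E.
Proof.
case: n => // n _ t0; have [k1 k2] := norm_tail_exponent t0.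
set e := (10 + 3 * t)^-1 in k1; set s := 16 / 5 + 12 / 5 * t in k1 k2.
have y0 : 0 < 10 + 3 * t by lra.
have e0 : 0 < e by rewrite invr_gt0.
have e1 : e <= 1 / 10.
  by rewrite -[leRHS]mul1r mul1r div1r lef_pV2 ?posrE//; lra.
set L := (_ ^+ 2).
have := @norm_tail R n L (1 - e) _ _ (sqr_ge0 _).
rewrite (_ : 1 - (1 - e) = e); last by ring.
set p := iid _ _ _ => /(_ _ _)/wrap[||h]; [lra|lra|].
have pf : p \is a fin_num by apply: fin_num_measure; apply: measurable_violated => i j; exact: cmeas_gmat.
rewrite -(fineK pf) -EFinM !lee_fin in h *.
set q := fine p in h *; clearbody q; clear p pf.
have LE : L = (2 * Num.sqrt 2 + t) ^+ 2 * n.+1%:R by rewrite /L exprMn sqr_sqrtr.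
have ey : e * (10 + 3 * t) = 1 by rewrite mulVf// gt_eqF.
have q1 : q <= ((10 + 3 * t) ^+ n) ^+ 2 * expR (- ((1 - e) ^+ 2 * L)).
  rewrite (_ : q = ((10 + 3 * t) ^+ n) ^+ 2 * ((e ^+ n) ^+ 2 * q)).
    by rewrite ler_wpM2l// sqr_ge0.
  by rewrite mulrA -!exprMn [_ * e]mulrC ey !expr1n mul1r.
apply: (le_trans q1).
(* In dimension n + 1 the loss is (10 + 3 t)^(2 n) <= exp(2 n s), while the exponent supplies (2 s +
   t^2) (n + 1). *)
apply: (@le_trans _ _ ((expR s ^+ n) ^+ 2 * expR (- ((2 * s + t ^+ 2) * n.+1%:R)))).
  have y1 := ltW y0; apply: ler_pM.
  - exact: sqr_ge0.
  - exact: expR_ge0.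
  - by rewrite !lerXn2r ?nnegrE ?exprn_ge0 ?expR_ge0.
  - by rewrite ler_expR lerN2 LE mulrA ler_wpM2r.
rewrite -!expRM_natl -expRD ler_expR -natr1.
have s0 : 0 <= s by rewrite /s; lra.
lra.
Qed.

Lemma gmat_first_cols n r (hrn : (r <= n)%N) (z : n.-tuple (n.-tuple CM)) :
  gmat z *m first_cols hrn 1%:M = gmat [tuple tnth z (widen_ord hrn i) | i < r].
Proof.
by rewrite -first_colsE; apply/matrixP => i j; rewrite !mxE tnth_mktuple.
Qed.

(** The first r columns again form an independent family, so [min_tail] applies; 3 (100/99) (2/5)^2
    = 16/33 <= 1/2. *)
Lemma gaussian_min_tail n r (hrn : (r <= n)%N) (W : 'M[C]_(r, n)) (x : R) :
  W \is unitarymx ->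
  (iid (iid (@cgm R) n) n
     [set z | violated 1 (- (2 / 5 * x) ^+ 2) (W *m gmat z *m first_cols hrn 1%:M)]
   <= (r%:R / 2 * x ^+ 2)%:E)%E.
Proof.
move=> uW.
have mB : measurable [set z : r.-tuple (n.-tuple CM) |
    violated 1 (- (2 / 5 * x) ^+ 2) (W *m gmat z)].
  by apply: measurable_violated => i j; exact: cmeas_Wgmat.
have winj : injective (widen_ord hrn) by move=> i j /(congr1 val) /= ij; exact: val_inj.
have := min_tail (sqr_ge0 (2 / 5 * x)) uW.
rewrite -(iid_subtuple (iid cgm n) winj mB).
rewrite (_ : _ @^-1` _ = [set z : n.-tuple (n.-tuple CM) |
    violated 1 (- (2 / 5 * x) ^+ 2) (W *m gmat z *m first_cols hrn 1%:M)]); last first.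
  by apply/seteqP; split => z /=; rewrite -mulmxA gmat_first_cols.
move=> /le_trans; apply; rewrite lee_fin exprMn.
have : 0 <= r%:R * x ^+ 2 by rewrite mulr_ge0 ?sqr_ge0.
lra.
Qed.

Section calls.
Context (F : fp_arith R) (pr : primitives F) (d : measure_display).
Context (Om : measurableType d) (P : probability Om R) (n : nat).
Context (call : 'I_n -> 'I_n -> Om -> counted (fp F)).
Context (hcall : independent_normal_calls pr P call).

(** The column index is outermost, as in [gmat]. *)
Definition call_tuple w : n.-tuple (n.-tuple CM) :=
  [tuple [tuple c2r (fpval (value (call i j w))) | i < n] | j < n].

Lemma gmat_call_tuple w : gmat (call_tuple w) = mxval (\matrix_(i, j) value (call i j w)).
Proof. by apply/matrixP => i j; rewrite !mxE !tnth_mktuple c2rK. Qed.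

Lemma measurable_call_tuple : measurable_fun [set: Om] call_tuple.
Proof.
apply/measurable_fun_tnthP => j; apply/measurable_fun_tnthP => i /=.
rewrite (_ : _ \o _ = (fun w => c2r (fpval (value (call i j w))) : CM)).
  exact: (call_meas hcall).
by apply/funext => w /=; rewrite !tnth_mktuple.
Qed.

Lemma law_call_tuple A : measurable A ->
  P (call_tuple @^-1` A) = iid (iid (normal_law pr) n) n A.
Proof.
apply: (@iid2_unique _ _ _ (normal_law pr) n n (law P measurable_call_tuple)) => B mB.
rewrite lawE.
have := call_indep hcall [set: 'I_n * 'I_n]%SET (B := fun ij => B ij.2 ij.1) (fun ij => mB _ _).
rewrite (_ : [set w | _] = call_tuple @^-1` box2 B); last first.
  apply/seteqP; split => w /= h.
    by move=> j i; rewrite !tnth_mktuple; exact: (h (i, j) (finset.in_setT _)).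
  by move=> [i j] _ /=; have := h j i; rewrite !tnth_mktuple.
move=> ->; rewrite exchange_big pair_bigA /=.
by apply: eq_big => [ij|[i j] _]; [rewrite inE|exact: (call_law hcall)].
Qed.

End calls.

End deflate_event.

(** * Signs and sizes of the rounding errors *)

Section primitive_errors.
Context {R : realType}.
Local Notation CM := (measurableTypeR R * measurableTypeR R)%type.
Local Notation C := R[i].
Context (F : fp_arith R) (pr : primitives F).

Lemma mach_prec_ge0 : 0 <= mach_prec F.
Proof.
have := fl_err F 1; rewrite (_ : cabs 1 = 1) ?mulr1; last by rewrite cabs_nsq nsq1 sqrtr1.
by apply: le_trans; rewrite cabs_nsq sqrtr_ge0.
Qed.

Definition coupled : set (CM * CM) :=
  [set p | cabs (r2c p.1 - r2c p.2) <= cabs (r2c p.2) * c_N pr * mach_prec F].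

Lemma measurable_cabs d (T : measurableType d) (f : T -> C) :
  cmeas f -> measurable_fun [set: T] (fun x => cabs (f x)).
Proof.
move=> mf; under eq_fun do rewrite cabs_nsq.
apply: (@measurableT_comp _ _ _ _ _ _ (@Num.sqrt R)); last exact: measurable_nsq.
by apply: continuous_measurable_fun; exact: sqrt_continuous.
Qed.

Lemma measurable_coupled : measurable coupled.
Proof.
have c1 : cmeas (fun p : CM * CM => r2c p.1) by apply: cmeas_r2c; exact: measurable_fst.
have c2 : cmeas (fun p : CM * CM => r2c p.2) by apply: cmeas_r2c; exact: measurable_snd.
apply: measurable_le_fun.
  apply: measurable_cabs; under eq_fun do rewrite -mulN1r.
  by apply: cmeasD => //; apply: cmeasM => //; exact: cmeas_cst.
by do 2![apply: measurable_funM => //]; exact: measurable_cabs.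
Qed.

Lemma coupling_exists : exists2 kappa : probability (CM * CM)%type R,
  is_coupling (normal_law pr) (@cgm R) kappa & kappa coupled = 1%E.
Proof.
have [kappa hk ae] := normal_coupling pr; exists kappa => //.
have k0 : kappa (~` coupled) = 0%E.
  by apply/negligibleP; [apply: measurableC; exact: measurable_coupled|exact: ae].
rewrite -[coupled]setCK probability_setC ?k0 ?sube0//.
by apply: measurableC; exact: measurable_coupled.
Qed.

(** The coupling inequality holds almost surely and |z| >= 1 has positive probability, so both hold
    at some point; there the right-hand side is nonnegative and its factor |z| is positive. *)
Lemma c_N_ge0 : 0 <= c_N pr * mach_prec F.
Proof.
have [kappa [_ k2] kS] := coupling_exists.
pose D := [set p : CM | 1 <= nsq (r2c p)].
have mD : measurable D by apply: measurable_le_fun => //; exact: measurable_r2c_nsq.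
have kD : kappa (snd @^-1` D) = (expR (- 1))%:E by rewrite k2// -cgm_tail.
have mD' : measurable (snd @^-1` D : set (CM * CM)).
  by rewrite -[X in measurable X]setTI; exact: measurable_snd.
have [p [pS pD]] : coupled `&` (snd @^-1` D) !=set0.
  apply/set0P/negP => /eqP e0.
  have le0 : (kappa (snd @^-1` D) <= kappa (~` coupled))%E.
    apply: le_measure; rewrite ?inE//; first by apply: measurableC; exact: measurable_coupled.
    move=> p pD pS; have : (coupled `&` (snd @^-1` D)) p by split.
    by rewrite e0.
  move: le0; rewrite kD probability_setC ?kS ?subee//; last exact: measurable_coupled.
  by rewrite lee_fin leNgt expR_gt0.
have p0 : 0 < cabs (r2c p.2).
  by rewrite cabs_nsq sqrtr_gt0; apply: lt_le_trans pD.
rewrite -(pmulr_rge0 _ p0) mulrA; apply: le_trans pS.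
by rewrite cabs_nsq sqrtr_ge0.
Qed.

Lemma mu_QR_ge0 n : (0 < n)%N -> 0 <= (mu_QR pr).[n%:R] * mach_prec F.
Proof.
move=> n0; have [A' [Q' [_ _ _ h _]]] := QR_err pr (const_mx (fl F 0) : 'M[fp F]_n) n0.
by apply: le_trans h; exact: opnorm_ge0.
Qed.

Lemma mu_MM_ge0 n : (0 < n)%N -> 0 <= (mu_MM pr).[n%:R] * mach_prec F.
Proof.
move=> n0; rewrite mulr_ge0 ?mach_prec_ge0//.
by apply: le_trans (mu_MM_ge10 pr n0).
Qed.

Lemma precision_budget n (beta : R) : (0 < n)%N -> 0 < beta ->
  mach_prec F <= u_DEFLATE pr beta n ->
  4 * ((mu_QR pr).[n%:R] * mach_prec F) + 2 * (Num.sqrt n%:R * (c_N pr * mach_prec F))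
    + 2 * ((mu_MM pr).[n%:R] * mach_prec F) <= beta.
Proof.
move=> n0 b0; rewrite /u_DEFLATE; set den := _ + _ + _ => hu.
have -> : 4 * ((mu_QR pr).[n%:R] * mach_prec F) + 2 * (Num.sqrt n%:R * (c_N pr * mach_prec F))
    + 2 * ((mu_MM pr).[n%:R] * mach_prec F) = mach_prec F * den by rewrite /den; ring.
(* If the denominator is not positive, the total is at most 0, hence below beta. *)
have [d0|d0] := ltP 0 den; first by rewrite -ler_pdivlMr.
apply: le_trans (ltW b0).
by rewrite mulr_ge0_le0// mach_prec_ge0.
Qed.

End primitive_errors.

(** * The failure event for the random factor *)

Section bad_event.
Context {R : realType}.
Local Notation CM := (measurableTypeR R * measurableTypeR R)%type.
Local Notation C := R[i].
Context (F : fp_arith R) (pr : primitives F) (n r : nat) (hrn : (r <= n)%N).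
Context (W : 'M[C]_(r, n)).

Definition bad (k l : R) : set (n.-tuple (n.-tuple CM)) :=
  [set z | violated (-1) (k ^+ 2) (gmat z)] `|`
  [set z | violated 1 (- l ^+ 2) (W *m gmat z *m first_cols hrn 1%:M)].

Lemma measurable_bad k l : measurable (bad k l).
Proof.
apply: measurableU; first by apply: measurable_violated => i j; exact: cmeas_gmat.
apply: measurable_violated => i j; apply: cmeas_mulmx => [a b|a b]; last exact: cmeas_cst.
exact: cmeas_Wgmat.
Qed.

Lemma badP k l z : 0 <= k -> 0 <= l -> ~ bad k l z <->
  bounded_by k (gmat z) /\
  forall v, l * l2norm v <= l2norm (W *m gmat z *m first_cols hrn 1%:M *m v).
Proof.
move=> k0 l0; rewrite -(violated_upper _ k0) -(violated_lower _ l0).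
by split=> [h|[h1 h2] [/h1|/h2]//]; split => hv; apply: h; [left|right].
Qed.

Lemma bad_gaussian (t x : R) : (0 < n)%N -> 0 < t -> W \is unitarymx ->
  (iid (iid (@cgm R) n) n (bad ((2 * Num.sqrt 2 + t) * Num.sqrt n%:R) (2 / 5 * x))
   <= (expR (- (n%:R * t ^+ 2)) + r%:R / 2 * x ^+ 2)%:E)%E.
Proof.
move=> n0 t0 uW; apply: (le_trans (measureU2 _ _ _)).
- by apply: measurable_violated => i j; exact: cmeas_gmat.
- apply: measurable_violated => i j; apply: cmeas_mulmx => [a b|a b]; last exact: cmeas_cst.
  exact: cmeas_Wgmat.
by rewrite EFinD leeD// ?gaussian_norm_tail// gaussian_min_tail.
Qed.

(** Rounding the entries moves the matrix by at most b K in norm. As [W] and the selection of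
    columns do not increase norms, the upper bound grows and the lower bound shrinks by that amount,
    so a good Gaussian matrix is coupled to a good computed one. *)
Lemma bad_normal_law (K x : R) : W \is unitarymx -> 0 <= K -> 0 <= x ->
  let b := Num.sqrt n%:R * (c_N pr * mach_prec F) in b * K <= x ->
  (iid (iid (normal_law pr) n) n (bad ((1 + b) * K) (x - b * K))
   <= iid (iid (@cgm R) n) n (bad K x))%E.
Proof.
move=> uW K0 x0 b bK; have [kappa [k1 k2] kS] := coupling_exists pr.
have b0 : 0 <= b by rewrite mulr_ge0 ?sqrtr_ge0 ?c_N_ge0.
apply: (coupling_transfer k1 k2 (measurable_coupled pr) kS) => [||z zS].
- exact: measurable_bad.
- exact: measurable_bad.
apply: contraPP => /badP[]// Gk Gl.
have D : bounded_by (b * K) (gmat (map_tuple2 fst z) - gmat (map_tuple2 snd z)).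
  apply: (bounded_entrywise (c_N_ge0 pr) K0 _ Gk) => i j.
  rewrite !mxE !tnth_map; have := zS j i.
  by rewrite /coupled /= -mulrA mulrC.
set G := gmat (map_tuple2 snd z) in Gk Gl D; set G' := gmat (map_tuple2 fst z) in D.
apply/badP; [by rewrite mulr_ge0// addr_ge0|by rewrite subr_ge0|].
rewrite -/G'; have GE : G' = G + (G' - G) by rewrite addrC subrK.
split; first by rewrite GE mulrDl mul1r; exact: bounded_byD.
move=> v; rewrite mulrBl lerBlDr; apply: (le_trans (Gl v)).
have -> : W *m G *m first_cols hrn 1%:M *m v =
    W *m G' *m first_cols hrn 1%:M *m v - W *m ((G' - G) *m (first_cols hrn 1%:M *m v)).
  by rewrite -!mulmxA -mulmxBr -mulmxBl opprB addrC subrK.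
apply: (le_trans (l2normD _ _)); rewrite lerD2l l2normN.
apply: (le_trans (l2norm_coisometry _ uW)); apply: (le_trans (D _)).
by rewrite !nrm2_l2norm (nrm2_isometry _ (first_cols_isometry hrn)).
Qed.

End bad_event.

(** [delta] adds three deviations of the factored matrix from A G~: multiplication, c (s + beta) g;
    input, beta g; backward error of QR, a (1 + c) (s + beta) g. *)
Lemma deflate_output (R : realType) (F : fp_arith R) (pr : primitives F)
    (n r : nat) (hrn : (r <= n)%N) (At Gt : 'M[fp F]_n) (A : 'M[R[i]]_n)
    (a delta m0 c s g beta : R) :
  a = (mu_QR pr).[n%:R] * mach_prec F -> c = (mu_MM pr).[n%:R] * mach_prec F ->
  (0 < n)%N -> \rank A = r -> opnorm (mxval At - A) <= beta -> bounded_by s A ->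
  bounded_by g (mxval Gt) -> 0 <= s -> 0 <= g -> 0 <= beta ->
  delta = ((a * (1 + c) + c) * (s + beta) + beta) * g -> 2 * delta < m0 ->
  (forall v, m0 * l2norm v <= l2norm (A *m mxval Gt *m first_cols hrn 1%:M *m v)) ->
  exists U : 'M[R[i]]_(n, r), [/\ U^t* *m U = 1%:M, mxrange U = mxrange A &
    opnorm (first_cols hrn (mxval (value (QR pr (value (MM pr At Gt)))).1) - U)
      <= a + 2 * (delta / (m0 - delta))].
Proof.
move=> aE cE n0 rA hAt hA hG s0 g0 beta0 dE dm hm.
have a0 : 0 <= a by rewrite aE mu_QR_ge0.
have c0 : 0 <= c by rewrite cE mu_MM_ge0.
set M := value (MM pr At Gt).
have [A' [Q' [uQ QA tri hQ hM]]] := QR_err pr M n0.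
have hBA : bounded_by beta (mxval At - A).
  exact: bounded_byW hAt (bounded_opnorm _).
have hB : opnorm (mxval At) <= s + beta.
  apply: opnorm_le; first by rewrite addr_ge0.
  by rewrite -[mxval At](subrK A) addrC; exact: bounded_byD.
have hG' : opnorm (mxval Gt) <= g by exact: opnorm_le.
have sb0 : 0 <= s + beta by rewrite addr_ge0.
have hMM : bounded_by (c * (s + beta) * g) (mxval M - mxval At *m mxval Gt).
  apply: bounded_byW (bounded_opnorm _); apply: (le_trans (MM_err pr At Gt n0)).
  rewrite -cE; apply: ler_pM; [|exact: opnorm_ge0| |exact: hG'].
    by apply: mulr_ge0 => //; exact: opnorm_ge0.
  exact: ler_wpM2l.
have hBG : bounded_by ((s + beta) * g) (mxval At *m mxval Gt).
  by apply: bounded_byM => //; exact: bounded_byW hB (bounded_opnorm _).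
have hM' : opnorm (mxval M) <= (1 + c) * (s + beta) * g.
  apply: opnorm_le; first by rewrite !mulr_ge0// addr_ge0.
  have -> : (1 + c) * (s + beta) * g = c * (s + beta) * g + (s + beta) * g by ring.
  rewrite -[mxval M](subrK (mxval At *m mxval Gt)).
  exact: bounded_byD.
have hA' : bounded_by (a * ((1 + c) * (s + beta) * g)) (mxval M - A').
  apply: bounded_byW (bounded_opnorm _); apply: (le_trans hM).
  by rewrite -aE ler_wpM2l.
have delta0 : 0 <= delta.
  by rewrite dE mulr_ge0// addr_ge0// mulr_ge0// addr_ge0// mulr_ge0// addr_ge0.
have hQ' : bounded_by a (mxval (value (QR pr M)).1 - Q').
  by rewrite aE; exact: bounded_byW hQ (bounded_opnorm _).
apply: (deflate_perturbation rA uQ QA tri _ delta0 a0 hm dm hQ').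
have -> : A' - A *m mxval Gt = (mxval M - mxval At *m mxval Gt)
    + (mxval At - A) *m mxval Gt - (mxval M - A').
  rewrite mulmxBl; move: (mxval At *m _) (A *m _) (mxval M) => X Y Z.
  by rewrite (addrA (Z - X)) subrK opprB [RHS]addrC addrA subrK.
have -> : delta = c * (s + beta) * g + beta * g + a * ((1 + c) * (s + beta) * g).
  by rewrite dE; ring.
by apply: bounded_byB => //; apply: bounded_byD => //; exact: bounded_byM.
Qed.

Theorem theorem3p3 (R : realType) (F : fp_arith R) (pr : primitives F)
  (n r : nat) (hrn : (r <= n)%N) (At : 'M[fp F]_n)
  (A : 'M[R[i]]_n) (t x beta : R)
  (d : measure_display) (Om : measurableType d) (P : probability Om R)
  (call : 'I_n -> 'I_n -> Om -> counted (fp F))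
  (hcall : independent_normal_calls pr P call)
  (hrank : \rank A = r)
  (ht : 0 < t) (hx : 0 < x) (hbeta : 0 < beta)
  (hAt : opnorm (mxval At - A) <= beta)
  (hbeta_le : beta <= 1 / 5 * (sigma r A / (sigma 1 A + 2))
                        * (x / ((2 * Num.sqrt 2 + t) * Num.sqrt n%:R)))
  (hle1 : 1 / 5 * (sigma r A / (sigma 1 A + 2))
            * (x / ((2 * Num.sqrt 2 + t) * Num.sqrt n%:R)) <= 1)
  (hu : mach_prec F <= u_DEFLATE pr beta n) :
  (exists E : set Om,
    [/\ measurable E,
        ((1 - 2 * expR (- (n%:R * t ^+ 2)) - r%:R / 2 * x ^+ 2)%:E <= P E)%E &
        forall w, E w ->
          exists U : 'M[R[i]]_(n, r),
            [/\ U^t* *m U = 1%:M,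
                mxrange U = mxrange A &
                opnorm (mxval (value (DEFLATE pr hrn At (fun i j => call i j w)))
                        - U)
                  <= 6 * ((sigma 1 A + 2) / sigma r A)
                       * (((2 * Num.sqrt 2 + t) * Num.sqrt n%:R) / x) * beta]])
  /\
  (forall w, (flops (DEFLATE pr hrn At (fun i j => call i j w))
                <= T_MM pr n + T_QR pr n + T_N pr * n ^ 2)%N).
Proof.
split; last first.
  move=> w; rewrite /= addn0 addnC leq_add ?leq_add ?MM_flops ?QR_flops//.
  apply: (@leq_trans (\sum_(i < n) \sum_(j < n) T_N pr)).
    by apply: leq_sum => i _; apply: leq_sum => j _; exact: (call_flops hcall).
  by rewrite !sum_nat_const !card_ord mulnA mulnn mulnC.
set K := (2 * Num.sqrt 2 + t) * Num.sqrt n%:R in hbeta_le hle1 *.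
set p := 1 - _ - _.
have s10 : 0 <= sigma 1 A by exact: sigma_ge0.
have s12 : 0 < sigma 1 A + 2 by lra.
(* For n = 0 the quotient by K = 0 is 0 by convention, and beta would not be positive. *)
have n0 : (0 < n)%N.
  rewrite lt0n; apply/eqP => n0; move: hbeta_le.
  rewrite /K (_ : n%:R = 0); last by rewrite n0.
  by rewrite sqrtr0 mulr0 invr0 !mulr0 leNgt hbeta.
have sq1 : 1 <= Num.sqrt n%:R :> R by rewrite -{1}sqrtr1 ler_wsqrtr// ler1n.
have [r2 r2'] := @sqrt2_bounds R.
have K0 : 0 < K by rewrite mulr_gt0//; lra.
have sr0 : 0 < sigma r A.
  rewrite lt0r sigma_ge0 andbT; apply/eqP => s0; move: hbeta_le.
  by rewrite s0 mul0r mulr0 mul0r leNgt hbeta.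
(* A nonpositive target is met by the empty event; otherwise p > 0 bounds x. *)
have [p0|p0] := leP p 0.
  by exists set0; split => //; rewrite measure0 lee_fin.
(* For r = 0, A is zero and U has no columns; extracting a bound on x from p > 0 takes r >= 1. *)
have [r0|r0] := posnP r.
  exists setT; split => //; first by rewrite probability_setT lee_fin /p r0 mul0r mul0r subr0 lerBlDr lerDl mulr_ge0 ?expR_ge0.
  move=> w _; exists 0; split.
  - by apply/matrixP => i; have := ltn_ord i; rewrite {2}r0.
  - have /eqP -> : A == 0 by rewrite -mxrank_eq0 hrank r0.
    apply/seteqP; split => _ [v _ <-].
      by exists 0 => //; rewrite !mul0mx.
    by exists 0 => //; rewrite !mul0mx.
  apply: opnorm_le; first by rewrite !mulr_ge0 ?invr_ge0//; lra.
  move=> v; rewrite (_ : v = 0); last by apply/colP => i; have := ltn_ord i; rewrite {2}r0.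
  by rewrite mulmx0 [X in X <= _](_ : _ = 0) ?mulr_ge0 ?invr_ge0 ?l2norm_ge0//;
    [lra..|apply/eqP; rewrite l2norm_eq0].
pose a := (mu_QR pr).[n%:R] * mach_prec F; pose c := (mu_MM pr).[n%:R] * mach_prec F.
pose b := Num.sqrt n%:R * (c_N pr * mach_prec F).
have a0 : 0 <= a by exact: mu_QR_ge0.
have c0 : 0 <= c by exact: mu_MM_ge0.
have b0 : 0 <= b by rewrite mulr_ge0 ?sqrtr_ge0 ?c_N_ge0.
have abc : 4 * a + 2 * b + 2 * c <= beta by exact: precision_budget.
have hD : K * beta * (sigma 1 A + 2) <= sigma r A * x / 5.
  have -> : sigma r A * x / 5 = K * (1 / 5 * (sigma r A / (sigma 1 A + 2)) * (x / K))
      * (sigma 1 A + 2) by field; rewrite !gt_eqF.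
  by rewrite ler_pM2r// ler_pM2l.
(* p > 0 gives (r/2) x^2 < 1, so x <= sqrt 2, while K >= 2 sqrt 2. *)
have xK : 2 * x <= K.
  have x2 : x ^+ 2 <= 2.
    have : x ^+ 2 <= r%:R * x ^+ 2 by rewrite ler_peMl ?sqr_ge0// ler1n.
    have := expR_gt0 (- (n%:R * t ^+ 2)); move: p0; rewrite /p; lra.
  have : x <= Num.sqrt 2.
    by rewrite -[x]ger0_norm ?(ltW hx)// -sqrtr_sqr ler_wsqrtr.
  have : (2 * Num.sqrt 2 + t) * 1 <= K by rewrite ler_pM2l//; lra.
  lra.
(* The rounding of the entries does not exhaust the lower bound 2x/5: b <= beta, and K beta <= x/5
   because sigma_r <= sigma_1 + 2. *)
have bK : b * K <= 2 / 5 * x.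
  have : b * K <= beta * K by rewrite ler_pM2r//; lra.
  have : K * beta * (sigma 1 A + 2) <= x / 5 * (sigma 1 A + 2).
    have : sigma r A * x <= (sigma 1 A + 2) * x.
      by rewrite ler_wpM2r ?(ltW hx)//; have := sigma_le A hrn; lra.
    move: hD; lra.
  rewrite ler_pM2r//; lra.
have [W uW hW] := singular_rows A hrn.
pose B := bad hrn W ((1 + b) * K) (2 / 5 * x - b * K).
have mB : measurable B by exact: measurable_bad.
have mT := measurable_call_tuple hcall.
have mE : measurable (call_tuple call @^-1` B) by rewrite -[X in measurable X]setTI; exact: mT.
(* The event refers to the computed Gaussian factor alone, which makes it measurable; on it the rest
   of the argument is deterministic. *)
exists (~` (call_tuple call @^-1` B)); split; first exact: measurableC.
  rewrite probability_setC// (law_call_tuple hcall mB).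
  have x25 : 0 <= 2 / 5 * x by rewrite mulr_ge0// ltW.
  have := le_trans (bad_normal_law hrn uW (ltW K0) x25 bK) (bad_gaussian hrn x n0 ht uW).
  rewrite -/B => h.
  apply: (@le_trans _ _ (1 - (expR (- (n%:R * t ^+ 2)) + r%:R / 2 * x ^+ 2)%:E)%E).
    by rewrite -EFinB lee_fin /p; have := expR_ge0 (- (n%:R * t ^+ 2)); lra.
  by rewrite leeB.
have K1 : 0 <= (1 + b) * K by rewrite mulr_ge0 ?addr_ge0// ltW.
have l0 : 0 <= 2 / 5 * x - b * K by rewrite subr_ge0.
move=> w nB; have [hG hWG] := (@badP _ n r hrn W _ _ (call_tuple call w) K1 l0).1 nB.
rewrite gmat_call_tuple in hG hWG.
have [d0 dm dle] := deflate_constants a0 b0 c0 hbeta abc hx xK sr0 (sigma_le A hrn) hD.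
set delta := _ * _ in d0 dm dle; set m0 := _ * (_ - _) in dm dle.
have hm v : m0 * l2norm v <=
    l2norm (A *m mxval (\matrix_(i, j) value (call i j w)) *m first_cols hrn 1%:M *m v).
  rewrite /m0 -mulrA; apply: le_trans (ler_wpM2l (ltW sr0) (hWG v)) _.
  by rewrite -!mulmxA; exact: hW.
have [U [UU UA hU]] := deflate_output (erefl a) (erefl c) n0 hrank hAt (@bounded_sigma _ _ A)
  hG s10 K1 (ltW hbeta) (erefl delta) dm hm.
exists U; split => //; apply: le_trans dle.
rewrite [X in opnorm (X - _)](_ : _ = first_cols hrn (mxval
  (value (QR pr (value (MM pr At (\matrix_(i, j) value (call i j w)))))).1))//.
by apply/matrixP => i j; rewrite !mxE.
Qed.
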